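(* Let $G\subset \mathrm{Diff}(\mathbb C^n,0)$ be an irreducible group having a basic set of generators $\{f_1,\ldots,f_{\nu+1}\}$ which all have the same linear part $Df_j(0)=A\in \mathrm{GL}(n,\mathbb C)$, $j=1,\ldots,\nu+1$. Assume that the eigenvalues $\lambda_1,\ldots,\lambda_n$ of $A$ are such that each $\lambda_j$ is a root of unity of order $p^{s_j}$, where $p$ is a single prime number (the same for all $j$) and $s_j\in\mathbb N=\{0,1,2,\ldots\}$. Then $G$ is finite cyclic. Indeed, $G$ is analytically conjugate to the cyclic group generated by a diagonal matrix $\mathrm{diag}(\xi_1,\ldots,\xi_n)$ where each $\xi_j$ is a root of unity of order $p^{r_j}$ for some $r_j\in\mathbb N$.
   Context: $\mathrm{Diff}(\mathbb C^n,0)$ denotes the group (under composition) of germs at $0$ of holomorphic diffeomorphisms of $\mathbb C^n$ fixing the origin. A subgroup $G\subset \mathrm{Diff}(\mathbb C^n,0)$ is called irreducible if it admits a finite set of generators $f_1,\ldots,f_{\nu+1}$ (called a basic set of generators; repetitions $f_i=f_j$ are allowed) such that (a) $f_1\circ f_2\circ\cdots\circ f_{\nu+1}=\mathrm{Id}$, and (b) for all $i,j$, $f_i$ and $f_j$ are conjugate in $G$, i.e. there is $h\in G$ with $f_i\circ h=h\circ f_j$. *)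

(* Defs.v *)
From Stdlib Require Import Reals List ZArith Znumtheory.
From Stdlib Require Fin.
Open Scope R_scope.

Definition Cx : Type := (R * R)%type.
Definition C0 : Cx := (0, 0).
Definition C1 : Cx := (1, 0).
Definition Cadd (a b : Cx) : Cx := (fst a + fst b, snd a + snd b).
Definition Copp (a : Cx) : Cx := (- fst a, - snd a).
Definition Csub (a b : Cx) : Cx := Cadd a (Copp b).
Definition Cmul (a b : Cx) : Cx :=
  (fst a * fst b - snd a * snd b, fst a * snd b + snd a * fst b).
Definition Cnorm (a : Cx) : R := sqrt (fst a * fst a + snd a * snd a).
Fixpoint Cpow (a : Cx) (k : nat) : Cx :=
  match k with O => C1 | S k' => Cmul a (Cpow a k') end.

Definition root_of_unity_of_order (z : Cx) (m : nat) : Prop :=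
  (0 < m)%nat /\ Cpow z m = C1 /\ (forall k : nat, (0 < k < m)%nat -> Cpow z k <> C1).

Fixpoint fin_fold {A : Type} (op : A -> A -> A) (e : A) (n : nat)
  : (Fin.t n -> A) -> A :=
  match n return (Fin.t n -> A) -> A with
  | O => fun _ => e
  | S m => fun f => op (f Fin.F1) (fin_fold op e m (fun i => f (Fin.FS i)))
  end.
Definition Csum (n : nat) (f : Fin.t n -> Cx) : Cx := fin_fold Cadd C0 n f.
Definition Rsum (n : nat) (f : Fin.t n -> R) : R := fin_fold Rplus 0 n f.

Definition Cn (n : nat) : Type := Fin.t n -> Cx.
Definition Cn0 (n : nat) : Cn n := fun _ => C0.
Definition Cnadd {n} (z w : Cn n) : Cn n := fun i => Cadd (z i) (w i).
Definition Map (n : nat) : Type := Cn n -> Cn n.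
Definition idmap (n : nat) : Map n := fun z => z.
Definition mcomp {n} (f g : Map n) : Map n := fun z => f (g z).
Definition Mat (n : nat) : Type := Fin.t n -> Fin.t n -> Cx.
Definition matvec {n} (M : Mat n) (v : Cn n) : Cn n :=
  fun j => Csum n (fun k => Cmul (M j k) (v k)).

Definition near0 {n} (r : R) (z : Cn n) : Prop := forall i, Cnorm (z i) < r.

Definition has_cderiv {n} (F : Map n) (z : Cn n) (M : Mat n) : Prop :=
  forall eps, 0 < eps -> exists d, 0 < d /\
    forall h : Cn n, near0 d h -> forall j,
      Cnorm (Csub (Csub (F (Cnadd z h) j) (F z j)) (matvec M h j))
        <= eps * Rsum n (fun i => Cnorm (h i)).

Definition holo_near0 {n} (F : Map n) : Prop :=
  exists r, 0 < r /\ forall z : Cn n, near0 r z -> exists M, has_cderiv F z M.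

Definition germ_eq {n} (F G : Map n) : Prop :=
  exists r, 0 < r /\ forall z : Cn n, near0 r z -> forall i, F z i = G z i.

Definition germ_diff {n} (F : Map n) : Prop :=
  (forall i, F (Cn0 n) i = C0) /\ holo_near0 F /\
  exists G : Map n, (forall i, G (Cn0 n) i = C0) /\ holo_near0 G /\
    germ_eq (mcomp F G) (idmap n) /\ germ_eq (mcomp G F) (idmap n).

Definition linear_part {n} (F : Map n) (A : Mat n) : Prop := has_cderiv F (Cn0 n) A.

Definition subgroup {n} (G : Map n -> Prop) : Prop :=
  (forall f, G f -> germ_diff f) /\
  (forall f g, G f -> germ_eq f g -> G g) /\
  G (idmap n) /\
  (forall f g, G f -> G g -> G (mcomp f g)) /\
  (forall f, G f -> exists g, G g /\ germ_eq (mcomp f g) (idmap n)).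

Definition generated_by {n} (G : Map n -> Prop) (gens : list (Map n)) : Prop :=
  forall f, G f <-> (forall H, subgroup H -> (forall g, In g gens -> H g) -> H f).

Definition compose_list {n} (l : list (Map n)) : Map n :=
  fold_right mcomp (idmap n) l.

(* basic set of generators f_1,...,f_{nu+1} (a list, repetitions allowed) *)
Definition basic_set {n} (G : Map n -> Prop) (gens : list (Map n)) : Prop :=
  gens <> nil /\ generated_by G gens /\
  germ_eq (compose_list gens) (idmap n) /\
  (forall fi fj, In fi gens -> In fj gens ->
     exists h, G h /\ germ_eq (mcomp fi h) (mcomp h fj)).

Definition irreducible {n} (G : Map n -> Prop) : Prop :=
  exists gens, basic_set G gens.

Definition eigenvalue {n} (A : Mat n) (lam : Cx) : Prop :=
  exists v : Cn n, (exists i, v i <> C0) /\ forall i, matvec A v i = Cmul lam (v i).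

Definition diag_map {n} (xi : Fin.t n -> Cx) : Map n := fun z j => Cmul (xi j) (z j).

Definition map_pow {n} (f : Map n) (k : nat) : Map n := Nat.iter k (mcomp f) (idmap n).

Definition finite_cyclic {n} (G : Map n -> Prop) : Prop :=
  exists g N, G g /\ (0 < N)%nat /\
    forall f, G f <-> exists k, (k < N)%nat /\ germ_eq f (map_pow g k).

(* Main.v *)
(** Let [A] be the common linear part; [A^m = 1], where [m] is the number of generators, and [A] has
    order a power [q] of [p].  Fix one generator [f] and suppose that all generators agree with [f]
    up to [O(|z|^k)].  Write [g = f + u_g o A] and let [s u = A u A^-1].  Modulo [O(|z|^(k+1))],
    commutation with [f] is measured by a cocycle with values in the additive group of germs
    [O(|z|^k)], and for every element of the group this cocycle lies in [(1 - s) L], where [L] is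
    the [Z[s]]-span of the [u_g].  As [g] is conjugate to [f], each [u_g] lies in [(1 - s) L].
    Nakayama's argument gives [d(s) u_g = 0] with [d] in [Z[X]] and [d(1) = 1]; such a [d] is prime
    to [X^q - 1] over [Q]: at a common root [zeta], [1 - zeta] would be a unit among the algebraic
    integers, but [p] divides [(1 - zeta)^q].  Hence [u_g = 0] modulo [O(|z|^(k+1))], all generators
    coincide, the group is generated by [f] with [f^m = 1], and averaging [A^-k f^k] linearizes it.

    Holomorphy means existence of the complex derivative at every point, so that Goursat's lemma is
    needed; in logarithmic coordinates it yields the Schwarz-type bound from which all
    estimates on holomorphic germs follow. *)

From HB Require structures.
From mathcomp Require all_boot all_algebra all_field boolp Rstruct complex.
From Coquelicot Require Import Coquelicot.
From Stdlib Require Import Reals List ZArith Znumtheory Lra Lia.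
From Stdlib Require Import FunctionalExtensionality IndefiniteDescription.
From Stdlib Require Fin.
Require Import Defs.
Open Scope R_scope.

(** * Goursat's lemma for closed 1-forms *)

(** Agreement modulo [O(|z|^k)] replaces Taylor coefficients: no power series is formed, and the
    induction rests on one analytic fact, that a holomorphic germ which is [o(|z|^k)] is
    [O(|z|^(k+1))]. The group gives no control over the conjugating elements beyond closure under
    composition and inversion. On cocycles these operations amount to sums, opposites and powers of
    [s], never to complex multiples; hence [L] is a module over [Z[s]] and [d] has integer
    coefficients. Integrality is what makes [d(1) = 1] useful, for over [C] nothing would keep such
    a [d] away from the roots of unity other than 1. The prime power enters at the same point: for a
    root of unity [zeta] of order 6, [1 - zeta] is a unit. The negligible germs, by contrast, form a
    complex vector space, so that the nonzero integer in a Bezout identity between [d] and [X^q - 1]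
    can be divided out. *)

Definition closed_at (P Q : R -> R -> R) (x y : R) : Prop :=
  exists px l qy, differentiable_pt_lim P x y px l /\ differentiable_pt_lim Q x y l qy.

(** The counterclockwise integral of [P dx + Q dy]. The [l] shared by both derivatives in
    [closed_at] makes this form closed; the partial derivatives need not be continuous, so Green's
    formula is not at hand. *)
Definition bdry_int (P Q : R -> R -> R) (x y a b : R) : R :=
  RInt (fun t => P t y) x (x + a) + RInt (fun t => Q (x + a) t) y (y + b)
  - RInt (fun t => P t (y + b)) x (x + a) - RInt (fun t => Q x t) y (y + b).

Lemma differentiable_continuity_2d P x y lx ly :
  differentiable_pt_lim P x y lx ly -> continuity_2d_pt P x y.
Proof.
intros H; apply differentiable_continuity_pt.
exists lx, ly; exact H.
Qed.

Lemma continuity_2d_continuous_1 P x y :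
  continuity_2d_pt P x y -> continuous (fun t => P t y) x.
Proof.
intros H; apply continuity_pt_filterlim; intros eps He.
destruct (H (mkposreal eps He)) as [d Hd].
exists d; split; [apply cond_pos|].
intros t [_ Ht]; apply Hd; [exact Ht|].
rewrite Rminus_diag, Rabs_R0; apply cond_pos.
Qed.

Lemma continuity_2d_continuous_2 P x y :
  continuity_2d_pt P x y -> continuous (fun t => P x t) y.
Proof.
intros H; apply continuity_pt_filterlim; intros eps He.
destruct (H (mkposreal eps He)) as [d Hd].
exists d; split; [apply cond_pos|].
intros t [_ Ht]; apply Hd; [|exact Ht].
rewrite Rminus_diag, Rabs_R0; apply cond_pos.
Qed.

Lemma ex_RInt_continuous_le (f : R -> R) a b :
  a <= b -> (forall t, a <= t <= b -> continuous f t) -> ex_RInt f a b.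
Proof.
intros Hab H; apply (ex_RInt_continuous (V := R_CompleteNormedModule)).
intros t Ht; rewrite Rmin_left, Rmax_right in Ht by lra; auto.
Qed.

Section Rectangle.
Variables (P Q : R -> R -> R) (x0 y0 a0 b0 : R).
Hypothesis Ha0 : 0 <= a0.
Hypothesis Hb0 : 0 <= b0.
Hypothesis HPQ : forall x y, x0 <= x <= x0 + a0 -> y0 <= y <= y0 + b0 -> closed_at P Q x y.

Lemma ex_RInt_horizontal u v y :
  x0 <= u -> u <= v -> v <= x0 + a0 -> y0 <= y <= y0 + b0 -> ex_RInt (fun t => P t y) u v.
Proof.
intros H1 H2 H3 H4; apply ex_RInt_continuous_le; [lra|].
intros t Ht; destruct (HPQ t y) as (px & l & qy & HP & _); try lra.
exact (continuity_2d_continuous_1 _ _ _ (differentiable_continuity_2d _ _ _ _ _ HP)).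
Qed.

Lemma ex_RInt_vertical u v x :
  y0 <= u -> u <= v -> v <= y0 + b0 -> x0 <= x <= x0 + a0 -> ex_RInt (fun t => Q x t) u v.
Proof.
intros H1 H2 H3 H4; apply ex_RInt_continuous_le; [lra|].
intros t Ht; destruct (HPQ x t) as (px & l & qy & _ & HQ); try lra.
exact (continuity_2d_continuous_2 _ _ _ (differentiable_continuity_2d _ _ _ _ _ HQ)).
Qed.

Definition subrect (x y a b : R) : Prop :=
  0 <= a /\ 0 <= b /\ x0 <= x /\ x + a <= x0 + a0 /\ y0 <= y /\ y + b <= y0 + b0.

Lemma bdry_int_quarter x y a b :
  subrect x y (2 * a) (2 * b) ->
  bdry_int P Q x y (2 * a) (2 * b) =
  bdry_int P Q x y a b + bdry_int P Q (x + a) y a b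
  + bdry_int P Q x (y + b) a b + bdry_int P Q (x + a) (y + b) a b.
Proof.
intros (H1 & H2 & H3 & H4 & H5 & H6).
assert (CP : forall z, y <= z <= y + 2 * b -> RInt (fun t => P t z) x (x + 2 * a) =
  RInt (fun t => P t z) x (x + a) + RInt (fun t => P t z) (x + a) (x + 2 * a)).
{ intros z Hz; symmetry; apply (RInt_Chasles (V := R_CompleteNormedModule));
  apply ex_RInt_horizontal; lra. }
assert (CQ : forall z, x <= z <= x + 2 * a -> RInt (fun t => Q z t) y (y + 2 * b) =
  RInt (fun t => Q z t) y (y + b) + RInt (fun t => Q z t) (y + b) (y + 2 * b)).
{ intros z Hz; symmetry; apply (RInt_Chasles (V := R_CompleteNormedModule));
  apply ex_RInt_vertical; lra. }
unfold bdry_int.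
replace (x + a + a) with (x + 2 * a) by ring.
replace (y + b + b) with (y + 2 * b) by ring.
rewrite 2!CP, 2!CQ by lra; ring.
Qed.

(** The affine part of the form is itself closed and integrates to 0 over the boundary, and the
    remainder is at most [eps (a + b)] on sides of total length [2 (a + b)]. The rectangle has to
    contain [(x, y)] for the remainder to be of this size. *)
Lemma bdry_int_small x y :
  x0 <= x <= x0 + a0 -> y0 <= y <= y0 + b0 -> forall eps, 0 < eps ->
  exists d, 0 < d /\ forall u v a b, subrect u v a b -> a < d -> b < d ->
    u <= x <= u + a -> v <= y <= v + b ->
    Rabs (bdry_int P Q u v a b) <= 2 * eps * (a + b) * (a + b).
Proof.
intros Hx Hy eps He.
destruct (HPQ x y Hx Hy) as (px & l & qy & HP & HQ).
destruct (HP (mkposreal eps He)) as [d1 Hd1]; destruct (HQ (mkposreal eps He)) as [d2 Hd2].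
simpl in Hd1, Hd2.
exists (Rmin d1 d2); split; [apply Rmin_pos; apply cond_pos|].
intros u v a b (H1 & H2 & H3 & H4 & H5 & H6) Had Hbd Hu Hv.
pose proof (Rmin_l d1 d2); pose proof (Rmin_r d1 d2).
assert (EP : forall s t, u <= s <= u + a -> v <= t <= v + b ->
  Rabs (P s t - P x y - (px * (s - x) + l * (t - y))) <= eps * (a + b)).
{ intros s t Hs Ht.
  assert (A1 : Rabs (s - x) <= a) by (apply Rabs_le; lra).
  assert (A2 : Rabs (t - y) <= b) by (apply Rabs_le; lra).
  eapply Rle_trans; [apply Hd1; lra|].
  apply Rmult_le_compat_l; [lra|]. apply Rmax_lub; lra. }
assert (EQ : forall s t, u <= s <= u + a -> v <= t <= v + b ->
  Rabs (Q s t - Q x y - (l * (s - x) + qy * (t - y))) <= eps * (a + b)).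
{ intros s t Hs Ht.
  assert (A1 : Rabs (s - x) <= a) by (apply Rabs_le; lra).
  assert (A2 : Rabs (t - y) <= b) by (apply Rabs_le; lra).
  eapply Rle_trans; [apply Hd2; lra|].
  apply Rmult_le_compat_l; [lra|]. apply Rmax_lub; lra. }
(* Opposite sides are paired: the increment [l b] of [P] between bottom and top cancels against the
   increment [l a] of [Q] in [D2], as both integrate to [a l b]. *)
assert (D1 : RInt (fun t => P t v) u (u + a) - RInt (fun t => P t (v + b)) u (u + a) + a * (l * b)
  = RInt (fun t => P t v - P t (v + b) + l * b) u (u + a)).
{ symmetry; apply is_RInt_unique.
  replace (a * (l * b)) with (@scal R_AbsRing R_NormedModule (u + a - u) (l * b))
    by (unfold scal; simpl; unfold mult; simpl; ring).
  apply (is_RInt_plus (V := R_NormedModule)); [|apply (is_RInt_const (V := R_NormedModule))].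
  apply (is_RInt_minus (V := R_NormedModule));
    apply (RInt_correct (V := R_CompleteNormedModule)); apply ex_RInt_horizontal; lra. }
assert (D2 : RInt (fun t => Q (u + a) t) v (v + b) - RInt (fun t => Q u t) v (v + b) - b * (l * a)
  = RInt (fun t => Q (u + a) t - Q u t - l * a) v (v + b)).
{ symmetry; apply is_RInt_unique.
  replace (b * (l * a)) with (@scal R_AbsRing R_NormedModule (v + b - v) (l * a))
    by (unfold scal; simpl; unfold mult; simpl; ring).
  apply (is_RInt_minus (V := R_NormedModule)); [|apply (is_RInt_const (V := R_NormedModule))].
  apply (is_RInt_minus (V := R_NormedModule));
    apply (RInt_correct (V := R_CompleteNormedModule)); apply ex_RInt_vertical; lra. }
assert (B1 : Rabs (RInt (fun t => P t v - P t (v + b) + l * b) u (u + a))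
  <= a * (2 * (eps * (a + b)))).
{ replace (a * (2 * (eps * (a + b)))) with ((u + a - u) * (2 * (eps * (a + b)))) by ring.
  apply abs_RInt_le_const; [lra| |].
  - apply (ex_RInt_plus (V := R_NormedModule)); [|apply (ex_RInt_const (V := R_NormedModule))].
    apply (ex_RInt_minus (V := R_NormedModule)); apply ex_RInt_horizontal; lra.
  - intros t Ht.
    assert (E1 := EP t v Ht ltac:(lra)); assert (E2 := EP t (v + b) Ht ltac:(lra)).
    apply Rabs_le_between in E1; apply Rabs_le_between in E2; apply Rabs_le; lra. }
assert (B2 : Rabs (RInt (fun t => Q (u + a) t - Q u t - l * a) v (v + b))
  <= b * (2 * (eps * (a + b)))).
{ replace (b * (2 * (eps * (a + b)))) with ((v + b - v) * (2 * (eps * (a + b)))) by ring.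
  apply abs_RInt_le_const; [lra| |].
  - apply (ex_RInt_minus (V := R_NormedModule)); [|apply (ex_RInt_const (V := R_NormedModule))].
    apply (ex_RInt_minus (V := R_NormedModule)); apply ex_RInt_vertical; lra.
  - intros t Ht.
    assert (E1 := EQ u t ltac:(lra) Ht); assert (E2 := EQ (u + a) t ltac:(lra) Ht).
    apply Rabs_le_between in E1; apply Rabs_le_between in E2; apply Rabs_le; lra. }
rewrite <- D1 in B1; rewrite <- D2 in B2.
apply Rabs_le_between in B1; apply Rabs_le_between in B2.
unfold bdry_int; apply Rabs_le; lra.
Qed.

(** Goursat's bisection. The last quarter is taken by default: if each of the first three carries
    less than a quarter of the integral, the triangle inequality leaves enough for it. *)
Definition quarter_step (a b : R) (z : R * R) : R * R :=
  let (x, y) := z in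
  let c := Rabs (bdry_int P Q x y (2 * a) (2 * b)) in
  if Rle_dec c (4 * Rabs (bdry_int P Q x y a b)) then (x, y) else
  if Rle_dec c (4 * Rabs (bdry_int P Q (x + a) y a b)) then (x + a, y) else
  if Rle_dec c (4 * Rabs (bdry_int P Q x (y + b) a b)) then (x, y + b) else
  (x + a, y + b).

Fixpoint quarter_seq (n : nat) : R * R :=
  match n with
  | O => (x0, y0)
  | S k => quarter_step (a0 / 2 ^ S k) (b0 / 2 ^ S k) (quarter_seq k)
  end.

Lemma quarter_stepP a b z :
  subrect (fst z) (snd z) (2 * a) (2 * b) ->
  let z' := quarter_step a b z in
  (fst z' = fst z \/ fst z' = fst z + a) /\ (snd z' = snd z \/ snd z' = snd z + b) /\
  Rabs (bdry_int P Q (fst z) (snd z) (2 * a) (2 * b))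
    <= 4 * Rabs (bdry_int P Q (fst z') (snd z') a b).
Proof.
destruct z as [x y]; simpl fst; simpl snd; intros H; unfold quarter_step.
assert (E := bdry_int_quarter _ _ _ _ H).
destruct Rle_dec as [h1|h1]; [simpl; repeat split; auto|].
destruct Rle_dec as [h2|h2]; [simpl; repeat split; auto|].
destruct Rle_dec as [h3|h3]; [simpl; repeat split; auto|].
simpl; repeat split; auto.
apply Rnot_le_lt in h1; apply Rnot_le_lt in h2; apply Rnot_le_lt in h3.
rewrite E in h1, h2, h3 |- *.
revert h1 h2 h3; unfold Rabs; repeat destruct Rcase_abs; lra.
Qed.

Lemma quarter_seqP n :
  let z := quarter_seq n in
  subrect (fst z) (snd z) (a0 / 2 ^ n) (b0 / 2 ^ n) /\
  Rabs (bdry_int P Q x0 y0 a0 b0)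
    <= 4 ^ n * Rabs (bdry_int P Q (fst z) (snd z) (a0 / 2 ^ n) (b0 / 2 ^ n)).
Proof.
induction n as [|n [IH1 IH2]].
- simpl; rewrite 2!Rdiv_1_r; split; [unfold subrect; lra|lra].
- assert (Hp : 0 < 2 ^ n) by (apply pow_lt; lra).
  assert (Ea : a0 / 2 ^ n = 2 * (a0 / 2 ^ S n)) by (simpl; field; lra).
  assert (Eb : b0 / 2 ^ n = 2 * (b0 / 2 ^ S n)) by (simpl; field; lra).
  rewrite Ea, Eb in IH1, IH2.
  destruct (quarter_stepP _ _ _ IH1) as (H1 & H2 & H3).
  change (quarter_seq (S n)) with (quarter_step (a0 / 2 ^ S n) (b0 / 2 ^ S n) (quarter_seq n)).
  set (z' := quarter_step _ _ _) in *; split.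
  + destruct IH1 as (K1 & K2 & K3 & K4 & K5 & K6).
    unfold subrect; destruct H1 as [->| ->]; destruct H2 as [->| ->]; lra.
  + eapply Rle_trans; [apply IH2|].
    change (4 ^ S n) with (4 * 4 ^ n).
    assert (0 < 4 ^ n) by (apply pow_lt; lra). nra.
Qed.

(** The supremum of the left ends works, every right end being an upper bound of them. The form with
    a left end and a width fits both the bisected rectangles and the geometric sequences used to
    invert germs. *)
Lemma nested_intervals (lo w : nat -> R) :
  (forall n, 0 <= w n) -> (forall n, lo n <= lo (S n)) ->
  (forall n, lo (S n) + w (S n) <= lo n + w n) ->
  exists l, forall n, lo n <= l <= lo n + w n.
Proof.
intros Hw Hlo Hhi.
assert (M : forall n k, lo n <= lo (n + k)%nat).
{ intros n k; induction k as [|k IH]; [rewrite Nat.add_0_r; lra|].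
  rewrite Nat.add_succ_r; eapply Rle_trans; [apply IH|apply Hlo]. }
assert (M' : forall n k, lo (n + k)%nat + w (n + k)%nat <= lo n + w n).
{ intros n k; induction k as [|k IH]; [rewrite Nat.add_0_r; lra|].
  rewrite Nat.add_succ_r; eapply Rle_trans; [apply Hhi|apply IH]. }
assert (U : forall n k, lo k <= lo n + w n).
{ intros n k; eapply Rle_trans; [apply (M k n)|].
  rewrite Nat.add_comm; specialize (M' n k); specialize (Hw (n + k)%nat); lra. }
destruct (completeness (fun r => exists k, r = lo k)) as [l [L1 L2]].
- exists (lo 0%nat + w 0%nat); intros r [k ->]; apply U.
- exists (lo 0%nat); eauto.
- exists l; intros n; split; [apply L1; eauto|].
  apply L2; intros r [k ->]; apply U.
Qed.

Theorem goursat_rectangle : bdry_int P Q x0 y0 a0 b0 = 0.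
Proof.
assert (Hp : forall n, 0 < 2 ^ n) by (intro n; apply pow_lt; lra).
assert (St : forall n, 
  (fst (quarter_seq (S n)) = fst (quarter_seq n) \/
   fst (quarter_seq (S n)) = fst (quarter_seq n) + a0 / 2 ^ S n) /\
  (snd (quarter_seq (S n)) = snd (quarter_seq n) \/
   snd (quarter_seq (S n)) = snd (quarter_seq n) + b0 / 2 ^ S n) /\
  a0 / 2 ^ n = 2 * (a0 / 2 ^ S n) /\ b0 / 2 ^ n = 2 * (b0 / 2 ^ S n)).
{ intros n; specialize (Hp n).
  assert (Ea : a0 / 2 ^ n = 2 * (a0 / 2 ^ S n)) by (simpl; field; lra).
  assert (Eb : b0 / 2 ^ n = 2 * (b0 / 2 ^ S n)) by (simpl; field; lra).
  destruct (quarter_seqP n) as [IH1 _]; rewrite Ea, Eb in IH1.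
  destruct (quarter_stepP _ _ _ IH1) as (H1 & H2 & _); auto. }
assert (Hw : forall c n, 0 <= c -> 0 <= c / 2 ^ n).
{ intros c n Hc; apply Rdiv_le_0_compat; auto. }
destruct (nested_intervals (fun n => fst (quarter_seq n)) (fun n => a0 / 2 ^ n)) as [x Hx].
{ intros n; auto. }
{ intros n; cbv beta; destruct (St n) as (H1 & _); specialize (Hw a0 (S n) Ha0); lra. }
{ intros n; cbv beta; destruct (St n) as (H1 & _ & H2 & _); specialize (Hw a0 (S n) Ha0); lra. }
destruct (nested_intervals (fun n => snd (quarter_seq n)) (fun n => b0 / 2 ^ n)) as [y Hy].
{ intros n; auto. }
{ intros n; cbv beta; destruct (St n) as (_ & H1 & _); specialize (Hw b0 (S n) Hb0); lra. }
{ intros n; cbv beta; destruct (St n) as (_ & H1 & _ & H2); specialize (Hw b0 (S n) Hb0); lra. }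
assert (Hx0 := Hx 0%nat); assert (Hy0 := Hy 0%nat); simpl in Hx0, Hy0.
rewrite Rdiv_1_r in Hx0, Hy0.
(* At stage [n] the factor [4 ^ n] of [quarter_seqP] meets the square of a side sum divided by
   [2 ^ n], so the bound does not depend on [n]. *)
assert (B : forall eps, 0 < eps ->
  Rabs (bdry_int P Q x0 y0 a0 b0) <= 2 * eps * (a0 + b0) * (a0 + b0)).
{ intros eps He.
  destruct (bdry_int_small x y Hx0 Hy0 eps He) as (d & Hd & Hs).
  assert (Hn : exists n, (a0 + b0) / 2 ^ n < d).
  { destruct (pow_lt_1_zero (/ 2) ltac:(rewrite Rabs_pos_eq; lra) (d / (a0 + b0 + 1)))
      as [n Hn]; [apply Rdiv_lt_0_compat; lra|].
    exists n; specialize (Hn n (le_n n)).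
    rewrite Rabs_pos_eq in Hn by (apply pow_le; lra).
    apply (Rmult_lt_compat_r (a0 + b0 + 1)) in Hn; [|lra].
    unfold Rdiv in Hn at 1; rewrite Rmult_assoc, Rinv_l, Rmult_1_r in Hn by lra.
    rewrite pow_inv in Hn.
    assert (0 < / 2 ^ n) by (apply Rinv_0_lt_compat; auto). unfold Rdiv; nra. }
  destruct Hn as [n Hn].
  assert (Hab : (a0 + b0) / 2 ^ n = a0 / 2 ^ n + b0 / 2 ^ n) by (field; specialize (Hp n); lra).
  destruct (quarter_seqP n) as [S1 S2].
  pose proof (Hw a0 n Ha0); pose proof (Hw b0 n Hb0).
  assert (Bn := Hs _ _ _ _ S1 ltac:(lra) ltac:(lra) (Hx n) (Hy n)).
  eapply Rle_trans; [apply S2|].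
  assert (H4 : 4 ^ n = 2 ^ n * 2 ^ n) by (rewrite <- Rpow_mult_distr; f_equal; lra).
  eapply Rle_trans; [apply Rmult_le_compat_l; [apply pow_le; lra|apply Bn]|].
  rewrite H4; apply Req_le; specialize (Hp n); field; lra. }
destruct (Req_dec (bdry_int P Q x0 y0 a0 b0) 0) as [e|ne]; [exact e|exfalso].
apply Rabs_pos_lt in ne; set (c := Rabs _) in *.
set (s := a0 + b0) in *; assert (0 <= s * s) by apply Rle_0_sqr.
(* With this [eps] the bound falls below [c / 2]; the summand 1 covers a degenerate rectangle. *)
specialize (B (c / (4 * (s * s + 1))) ltac:(apply Rdiv_lt_0_compat; lra)).
assert (E : 2 * (c / (4 * (s * s + 1))) * s * s = c * (s * s / (s * s + 1)) / 2) by (field; lra).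
rewrite E in B.
replace (s * s / (s * s + 1)) with (1 - / (s * s + 1)) in B by (field; lra).
assert (0 < / (s * s + 1)) by (apply Rinv_0_lt_compat; lra).
nra.
Qed.

End Rectangle.

(** * Complex numbers *)

Definition Cinv (z : Cx) : Cx := Complex.Cinv z.
Definition Cdiv (z w : Cx) : Cx := Cmul z (Cinv w).
Definition Cconj (z : Cx) : Cx := (fst z, - snd z).

Lemma Cx_eq (z w : Cx) : fst z = fst w -> snd z = snd w -> z = w.
Proof. destruct z, w; simpl; intros -> ->; reflexivity. Qed.

Lemma Cx_ring_theory : ring_theory C0 C1 Cadd Cmul Csub Copp (@eq Cx).
Proof. constructor; intros; apply Cx_eq; simpl; ring. Qed.

Lemma Cmul_Cinv_l (z : Cx) : z <> C0 -> Cmul (Cinv z) z = C1.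
Proof. intros H; exact (Cinv_l z H). Qed.

Lemma C1_neq_C0 : C1 <> C0.
Proof. intros H; apply (f_equal fst) in H; simpl in H; lra. Qed.

Lemma Cx_field_theory : field_theory C0 C1 Cadd Cmul Csub Copp Cdiv Cinv (@eq Cx).
Proof.
constructor; [exact Cx_ring_theory|exact C1_neq_C0|reflexivity|exact Cmul_Cinv_l].
Qed.

Add Field Cx_field : Cx_field_theory.

Lemma Cx_eq_dec (z w : Cx) : {z = w} + {z <> w}.
Proof.
destruct (Req_EM_T (fst z) (fst w)) as [e1|n1].
- destruct (Req_EM_T (snd z) (snd w)) as [e2|n2].
  + left; apply Cx_eq; assumption.
  + right; intros ->; apply n2; reflexivity.
- right; intros ->; apply n1; reflexivity.
Defined.

Lemma Cnorm_Cmod z : Cnorm z = Cmod z.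
Proof. unfold Cnorm, Cmod; f_equal; ring. Qed.

Lemma Cnorm_ge0 z : 0 <= Cnorm z.
Proof. apply sqrt_pos. Qed.

Lemma Cnorm_C0 : Cnorm C0 = 0.
Proof. rewrite Cnorm_Cmod; exact Cmod_0. Qed.

Lemma Cnorm_C1 : Cnorm C1 = 1.
Proof. rewrite Cnorm_Cmod; exact Cmod_1. Qed.

Lemma Cnorm_mul z w : Cnorm (Cmul z w) = Cnorm z * Cnorm w.
Proof. rewrite 3!Cnorm_Cmod; exact (Cmod_mult z w). Qed.

Lemma Cnorm_add z w : Cnorm (Cadd z w) <= Cnorm z + Cnorm w.
Proof. rewrite 3!Cnorm_Cmod; exact (Cmod_triangle z w). Qed.

Lemma Cnorm_opp z : Cnorm (Copp z) = Cnorm z.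
Proof. rewrite 2!Cnorm_Cmod; exact (Cmod_opp z). Qed.

Lemma Cnorm_sub z w : Cnorm (Csub z w) <= Cnorm z + Cnorm w.
Proof. unfold Csub; rewrite <- (Cnorm_opp w); apply Cnorm_add. Qed.

Lemma Cnorm_sub_sym z w : Cnorm (Csub z w) = Cnorm (Csub w z).
Proof. rewrite <- Cnorm_opp; f_equal; ring. Qed.

Lemma Cnorm_sub_ge z w : Cnorm z - Cnorm w <= Cnorm (Csub z w).
Proof.
assert (H := Cnorm_add (Csub z w) w).
replace (Cadd (Csub z w) w) with z in H by ring; lra.
Qed.

Lemma Cnorm_eq0 z : Cnorm z = 0 -> z = C0.
Proof. rewrite Cnorm_Cmod; exact (Cmod_eq_0 z). Qed.

Lemma Cnorm_gt0 z : z <> C0 -> 0 < Cnorm z.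
Proof.
intros H; destruct (Cnorm_ge0 z) as [h|h]; [exact h|].
exfalso; apply H, Cnorm_eq0; auto.
Qed.

Lemma Cnorm_neq0 z : 0 < Cnorm z -> z <> C0.
Proof. intros H ->; rewrite Cnorm_C0 in H; lra. Qed.

Lemma Cnorm_inv z : z <> C0 -> Cnorm (Cinv z) = / Cnorm z.
Proof. intros H; rewrite 2!Cnorm_Cmod; exact (Cmod_inv z H). Qed.

Lemma Cnorm_pow z k : Cnorm (Cpow z k) = Cnorm z ^ k.
Proof.
induction k as [|k IH]; simpl; [apply Cnorm_C1|].
rewrite Cnorm_mul, IH; reflexivity.
Qed.

Lemma Cnorm_sqr z : Cnorm z * Cnorm z = fst z * fst z + snd z * snd z.
Proof. apply sqrt_sqrt; nra. Qed.

Lemma Cnorm_conj z : Cnorm (Cconj z) = Cnorm z.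
Proof. unfold Cnorm; simpl; f_equal; ring. Qed.

Lemma Cnorm_real (r : R) : Cnorm (r, 0) = Rabs r.
Proof. rewrite Cnorm_Cmod; exact (Cmod_R r). Qed.

Lemma Rabs_fst_le z : Rabs (fst z) <= Cnorm z.
Proof. rewrite Cnorm_Cmod; eapply Rle_trans; [apply Rmax_l|exact (Rmax_Cmod z)]. Qed.

Lemma Rabs_snd_le z : Rabs (snd z) <= Cnorm z.
Proof. rewrite Cnorm_Cmod; eapply Rle_trans; [apply Rmax_r|exact (Rmax_Cmod z)]. Qed.

Lemma Cnorm_le_parts z : Cnorm z <= Rabs (fst z) + Rabs (snd z).
Proof.
replace z with (Cadd (fst z, 0) (Cmul (0, 1) (snd z, 0))) at 1
  by (apply Cx_eq; simpl; ring).
eapply Rle_trans; [apply Cnorm_add|].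
rewrite Cnorm_mul, 2!Cnorm_real.
replace (Cnorm (0, 1)) with 1; [lra|].
unfold Cnorm; simpl; replace (0 * 0 + 1 * 1) with 1 by ring; rewrite sqrt_1; reflexivity.
Qed.

(** * Complex differentiability in one variable *)

Definition ccont (f : Cx -> Cx) (w : Cx) : Prop :=
  forall eps, 0 < eps -> exists d, 0 < d /\
    forall z, Cnorm (Csub z w) < d -> Cnorm (Csub (f z) (f w)) < eps.

(* Caratheodory's formulation: the slope extends continuously. *)
Definition cdiff (f : Cx -> Cx) (w : Cx) : Prop :=
  exists phi, ccont phi w /\ exists r, 0 < r /\
    forall z, Cnorm (Csub z w) < r -> f z = Cadd (f w) (Cmul (phi z) (Csub z w)).

Lemma Csub_diag z : Csub z z = C0.
Proof. ring. Qed.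

Lemma ccont_const c w : ccont (fun _ => c) w.
Proof.
intros eps He; exists 1; split; [lra|]; intros z _.
rewrite Csub_diag, Cnorm_C0; exact He.
Qed.

Lemma ccont_id w : ccont (fun z => z) w.
Proof. intros eps He; exists eps; split; auto. Qed.

Lemma ccont_add f g w : ccont f w -> ccont g w -> ccont (fun z => Cadd (f z) (g z)) w.
Proof.
intros Hf Hg eps He.
destruct (Hf (eps / 2)) as (d1 & Hd1 & H1); [lra|].
destruct (Hg (eps / 2)) as (d2 & Hd2 & H2); [lra|].
exists (Rmin d1 d2); split; [apply Rmin_pos; lra|]; intros z Hz.
pose proof (Rmin_l d1 d2); pose proof (Rmin_r d1 d2).
specialize (H1 z ltac:(lra)); specialize (H2 z ltac:(lra)).
replace (Csub (Cadd (f z) (g z)) (Cadd (f w) (g w)))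
  with (Cadd (Csub (f z) (f w)) (Csub (g z) (g w))) by ring.
eapply Rle_lt_trans; [apply Cnorm_add|]; lra.
Qed.

Lemma ccont_mul f g w : ccont f w -> ccont g w -> ccont (fun z => Cmul (f z) (g z)) w.
Proof.
intros Hf Hg eps He.
set (A := Cnorm (f w)); set (B := Cnorm (g w)).
assert (HA : 0 <= A) by apply Cnorm_ge0; assert (HB : 0 <= B) by apply Cnorm_ge0.
set (e := Rmin 1 (eps / (A + B + 2))).
assert (He' : 0 < e) by (apply Rmin_pos; [lra|apply Rdiv_lt_0_compat; lra]).
assert (He1 : e <= 1) by apply Rmin_l.
assert (He2 : e * (A + B + 2) <= eps).
{ replace eps with (eps / (A + B + 2) * (A + B + 2)) by (field; lra).
  apply Rmult_le_compat_r; [lra|apply Rmin_r]. }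
destruct (Hf e He') as (d1 & Hd1 & H1).
destruct (Hg e He') as (d2 & Hd2 & H2).
exists (Rmin d1 d2); split; [apply Rmin_pos; lra|]; intros z Hz.
pose proof (Rmin_l d1 d2); pose proof (Rmin_r d1 d2).
specialize (H1 z ltac:(lra)); specialize (H2 z ltac:(lra)).
replace (Csub (Cmul (f z) (g z)) (Cmul (f w) (g w)))
  with (Cadd (Cmul (Csub (f z) (f w)) (Csub (g z) (g w)))
       (Cadd (Cmul (Csub (f z) (f w)) (g w)) (Cmul (f w) (Csub (g z) (g w))))) by ring.
eapply Rle_lt_trans; [apply Cnorm_add|].
eapply Rle_lt_trans; [apply Rplus_le_compat_l, Cnorm_add|].
rewrite 3!Cnorm_mul; fold A B.
assert (0 <= Cnorm (Csub (f z) (f w))) by apply Cnorm_ge0.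
assert (0 <= Cnorm (Csub (g z) (g w))) by apply Cnorm_ge0.
nra.
Qed.

Lemma ccont_inv f w : ccont f w -> f w <> C0 -> ccont (fun z => Cinv (f z)) w.
Proof.
intros Hf H0 eps He.
set (A := Cnorm (f w)); assert (HA : 0 < A) by (apply Cnorm_gt0, H0).
set (e := Rmin (A / 2) (eps * (A * A / 4))).
assert (HAA : 0 < A * A) by nra.
assert (He' : 0 < e) by (apply Rmin_pos; [lra|apply Rmult_lt_0_compat; lra]).
destruct (Hf e He') as (d & Hd & H1); exists d; split; [exact Hd|]; intros z Hz.
specialize (H1 z Hz).
assert (E1 : e <= A / 2) by apply Rmin_l; assert (E2 : e <= eps * (A * A / 4)) by apply Rmin_r.
assert (Hz2 : A / 2 <= Cnorm (f z)).
{ assert (K := Cnorm_sub_ge (f w) (f z)); rewrite Cnorm_sub_sym in K; fold A in K; lra. }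
assert (Hfz : f z <> C0) by (apply Cnorm_neq0; lra).
replace (Csub (Cinv (f z)) (Cinv (f w)))
  with (Cmul (Csub (f w) (f z)) (Cinv (Cmul (f z) (f w)))) by (field; auto).
assert (Hm : A * A / 2 <= Cnorm (Cmul (f z) (f w))) by (rewrite Cnorm_mul; fold A; nra).
rewrite Cnorm_mul, Cnorm_inv by (apply Cnorm_neq0; lra).
rewrite Cnorm_sub_sym.
apply Rle_lt_trans with (eps * (A * A / 4) * / (A * A / 2)).
- apply Rmult_le_compat; [apply Cnorm_ge0| |lra|apply Rinv_le_contravar; lra].
  left; apply Rinv_0_lt_compat; lra.
- replace (eps * (A * A / 4) * / (A * A / 2)) with (eps / 2) by (field; lra); lra.
Qed.

Lemma ccont_comp f g w : ccont f (g w) -> ccont g w -> ccont (fun z => f (g z)) w.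
Proof.
intros Hf Hg eps He.
destruct (Hf eps He) as (d1 & Hd1 & H1); destruct (Hg d1 Hd1) as (d2 & Hd2 & H2).
exists d2; split; auto.
Qed.

Lemma ccont_ext_loc f g w :
  (exists r, 0 < r /\ forall z, Cnorm (Csub z w) < r -> f z = g z) -> ccont f w -> ccont g w.
Proof.
intros (r & Hr & E) Hf eps He; destruct (Hf eps He) as (d & Hd & H).
exists (Rmin r d); split; [apply Rmin_pos; lra|]; intros z Hz.
pose proof (Rmin_l r d); pose proof (Rmin_r r d).
rewrite <- 2!E; [apply H; lra| |lra].
rewrite Csub_diag, Cnorm_C0; exact Hr.
Qed.

Lemma cdiff_ccont f w : cdiff f w -> ccont f w.
Proof.
intros (phi & Hphi & r & Hr & E).
apply ccont_ext_loc with (fun z => Cadd (f w) (Cmul (phi z) (Csub z w))).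
- exists r; split; [exact Hr|]; intros z Hz; symmetry; auto.
- apply ccont_add; [apply ccont_const|apply ccont_mul; [exact Hphi|]].
  apply ccont_add; [apply ccont_id|apply ccont_const].
Qed.

Lemma cdiff_ext_loc f g w :
  (exists r, 0 < r /\ forall z, Cnorm (Csub z w) < r -> f z = g z) -> cdiff f w -> cdiff g w.
Proof.
intros (r & Hr & E) (phi & Hphi & s & Hs & F).
exists phi; split; [exact Hphi|].
exists (Rmin r s); split; [apply Rmin_pos; lra|]; intros z Hz.
pose proof (Rmin_l r s); pose proof (Rmin_r r s).
rewrite <- 2!E; [apply F; lra| |lra].
rewrite Csub_diag, Cnorm_C0; exact Hr.
Qed.

Lemma cdiff_const c w : cdiff (fun _ => c) w.
Proof.
exists (fun _ => C0); split; [apply ccont_const|].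
exists 1; split; [lra|]; intros; ring.
Qed.

Lemma cdiff_id w : cdiff (fun z => z) w.
Proof.
exists (fun _ => C1); split; [apply ccont_const|].
exists 1; split; [lra|]; intros; ring.
Qed.

Lemma cdiff_add f g w : cdiff f w -> cdiff g w -> cdiff (fun z => Cadd (f z) (g z)) w.
Proof.
intros (phi & Hphi & r & Hr & E) (psi & Hpsi & s & Hs & F).
exists (fun z => Cadd (phi z) (psi z)); split; [apply ccont_add; assumption|].
exists (Rmin r s); split; [apply Rmin_pos; lra|]; intros z Hz.
pose proof (Rmin_l r s); pose proof (Rmin_r r s).
rewrite (E z), (F z) by lra; ring.
Qed.

Lemma cdiff_mul f g w : cdiff f w -> cdiff g w -> cdiff (fun z => Cmul (f z) (g z)) w.
Proof.
intros Hf Hg; assert (Cg := cdiff_ccont _ _ Hg); revert Hf Hg.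
intros (phi & Hphi & r & Hr & E) (psi & Hpsi & s & Hs & F).
exists (fun z => Cadd (Cmul (phi z) (g z)) (Cmul (f w) (psi z))); split.
{ apply ccont_add; apply ccont_mul; auto using ccont_const. }
exists (Rmin r s); split; [apply Rmin_pos; lra|]; intros z Hz.
pose proof (Rmin_l r s); pose proof (Rmin_r r s).
rewrite (E z), (F z) by lra; ring.
Qed.

Lemma cdiff_inv f w : cdiff f w -> f w <> C0 -> cdiff (fun z => Cinv (f z)) w.
Proof.
intros Hf H0; assert (Cf := cdiff_ccont _ _ Hf); revert Hf.
intros (phi & Hphi & r & Hr & E).
exists (fun z => Cmul (Copp (phi z)) (Cmul (Cinv (f z)) (Cinv (f w)))); split.
{ apply ccont_mul; [|apply ccont_mul; [apply ccont_inv; assumption|apply ccont_const]].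
  apply ccont_ext_loc with (fun z => Cmul (Copp C1) (phi z)).
  - exists 1; split; [lra|]; intros; ring.
  - apply ccont_mul; [apply ccont_const|exact Hphi]. }
assert (HA := Cnorm_gt0 _ H0).
destruct (Cf (Cnorm (f w)) HA) as (d & Hd & Hn).
exists (Rmin r d); split; [apply Rmin_pos; lra|]; intros z Hz.
pose proof (Rmin_l r d); pose proof (Rmin_r r d).
assert (Hfz : f z <> C0).
{ specialize (Hn z ltac:(lra)); intros e; rewrite e in Hn.
  replace (Csub C0 (f w)) with (Copp (f w)) in Hn by ring.
  rewrite Cnorm_opp in Hn; lra. }
assert (Ez := E z ltac:(lra)).
assert (K : Cmul (phi z) (Csub z w) = Csub (f z) (f w)) by (rewrite Ez; ring).
replace (Cmul (Cmul (Copp (phi z)) (Cmul (Cinv (f z)) (Cinv (f w)))) (Csub z w))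
  with (Cmul (Copp (Cmul (phi z) (Csub z w))) (Cmul (Cinv (f z)) (Cinv (f w)))) by ring.
rewrite K; field; auto.
Qed.

Lemma cdiff_comp f g w : cdiff f (g w) -> cdiff g w -> cdiff (fun z => f (g z)) w.
Proof.
intros Hf Hg; assert (Cg := cdiff_ccont _ _ Hg); revert Hf Hg.
intros (phi & Hphi & r & Hr & E) (psi & Hpsi & s & Hs & F).
exists (fun z => Cmul (phi (g z)) (psi z)); split.
{ apply ccont_mul; [apply ccont_comp; assumption|exact Hpsi]. }
destruct (Cg r Hr) as (d & Hd & Hn).
exists (Rmin d s); split; [apply Rmin_pos; lra|]; intros z Hz.
pose proof (Rmin_l d s); pose proof (Rmin_r d s).
rewrite (E (g z)) by (apply Hn; lra).
assert (Fz := F z ltac:(lra)).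
assert (K : Cmul (psi z) (Csub z w) = Csub (g z) (g w)) by (rewrite Fz; ring).
replace (Cmul (Cmul (phi (g z)) (psi z)) (Csub z w))
  with (Cmul (phi (g z)) (Cmul (psi z) (Csub z w))) by ring.
rewrite K; reflexivity.
Qed.

Lemma cdiff_pow f k w : cdiff f w -> cdiff (fun z => Cpow (f z) k) w.
Proof.
intros Hf; induction k as [|k IH]; simpl; [apply cdiff_const|].
apply cdiff_mul; assumption.
Qed.

Lemma cdiff_of_derivative f w d :
  (forall eps, 0 < eps -> exists r, 0 < r /\ forall h, Cnorm h < r ->
     Cnorm (Csub (Csub (f (Cadd w h)) (f w)) (Cmul d h)) <= eps * Cnorm h) ->
  cdiff f w.
Proof.
intros H.
exists (fun z => if Cx_eq_dec z w then d else Cmul (Csub (f z) (f w)) (Cinv (Csub z w))).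
split.
- intros eps He; destruct (H (eps / 2)) as (r & Hr & K); [lra|].
  exists r; split; [exact Hr|]; intros z Hz.
  destruct (Cx_eq_dec w w) as [_|n]; [|exfalso; auto].
  destruct (Cx_eq_dec z w) as [e|n].
  + rewrite Csub_diag, Cnorm_C0; exact He.
  + specialize (K (Csub z w) Hz).
    replace (Cadd w (Csub z w)) with z in K by ring.
    assert (Hn : Csub z w <> C0).
    { intros e; apply n; replace z with (Cadd (Csub z w) w) by ring; rewrite e; ring. }
    replace (Csub (Cmul (Csub (f z) (f w)) (Cinv (Csub z w))) d)
      with (Cmul (Csub (Csub (f z) (f w)) (Cmul d (Csub z w))) (Cinv (Csub z w)))
      by (field; auto).
    rewrite Cnorm_mul, Cnorm_inv by exact Hn.
    assert (P := Cnorm_gt0 _ Hn).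
    apply Rle_lt_trans with (eps / 2 * Cnorm (Csub z w) * / Cnorm (Csub z w)).
    * apply Rmult_le_compat_r; [left; apply Rinv_0_lt_compat; lra|exact K].
    * rewrite Rmult_assoc, Rinv_r; lra.
- exists 1; split; [lra|]; intros z _.
  destruct (Cx_eq_dec z w) as [->|n]; [ring|].
  field; intros e; apply n; replace z with (Cadd (Csub z w) w) by ring; rewrite e; ring.
Qed.

(** * The complex exponential *)

Definition Cexp (w : Cx) : Cx := (exp (fst w) * cos (snd w), exp (fst w) * sin (snd w)).

Lemma Cexp_add z w : Cexp (Cadd z w) = Cmul (Cexp z) (Cexp w).
Proof.
apply Cx_eq; simpl; rewrite exp_plus; [rewrite cos_plus|rewrite sin_plus]; ring.
Qed.

Lemma Cnorm_Cexp w : Cnorm (Cexp w) = exp (fst w).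
Proof.
apply Rsqr_inj; [apply Cnorm_ge0|left; apply exp_pos|].
unfold Rsqr; rewrite Cnorm_sqr; unfold Cexp; simpl.
assert (H := sin2_cos2 (snd w)); unfold Rsqr in H.
transitivity (exp (fst w) * exp (fst w) *
  (sin (snd w) * sin (snd w) + cos (snd w) * cos (snd w))); [ring|rewrite H; ring].
Qed.

Lemma derivable_pt_lim_0 (f : R -> R) l : derivable_pt_lim f 0 l ->
  forall eps, 0 < eps -> exists d, 0 < d /\
    forall h, Rabs h < d -> Rabs (f h - f 0 - l * h) <= eps * Rabs h.
Proof.
intros H eps He; destruct (H eps He) as [d Hd].
exists d; split; [apply cond_pos|]; intros h Hh.
destruct (Req_dec h 0) as [->|n].
- replace (f 0 - f 0 - l * 0) with 0 by ring; rewrite Rabs_R0; lra.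
- specialize (Hd h n Hh); rewrite Rplus_0_l in Hd.
  replace (f h - f 0 - l * h) with (((f h - f 0) / h - l) * h) by (field; exact n).
  rewrite Rabs_mult; apply Rmult_le_compat_r; [apply Rabs_pos|lra].
Qed.

Lemma Cexp_derivative_0 eps : 0 < eps -> exists r, 0 < r /\ forall h, Cnorm h < r ->
  Cnorm (Csub (Csub (Cexp h) C1) h) <= eps * Cnorm h.
Proof.
(* The error splits into the terms [B1] to [B4], of sizes [e N], [2 e N], [4 e N] and [e N], which
   add up to [8 e N]. *)
intros He; set (e := Rmin 1 (eps / 8)).
assert (He0 : 0 < e) by (apply Rmin_pos; lra).
assert (He1 : e <= 1) by apply Rmin_l; assert (He2 : e <= eps / 8) by apply Rmin_r.
destruct (derivable_pt_lim_0 exp 1 ltac:(rewrite <- exp_0; apply derivable_pt_lim_exp) e He0)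
  as (d1 & P1 & D1).
destruct (derivable_pt_lim_0 cos 0
  ltac:(replace 0 with (- sin 0) at 2 by (rewrite sin_0; ring); apply derivable_pt_lim_cos) e He0)
  as (d2 & P2 & D2).
destruct (derivable_pt_lim_0 sin 1 ltac:(rewrite <- cos_0; apply derivable_pt_lim_sin) e He0)
  as (d3 & P3 & D3).
rewrite exp_0 in D1; rewrite cos_0 in D2; rewrite sin_0 in D3.
exists (Rmin e (Rmin d1 (Rmin d2 d3))); split; [repeat apply Rmin_pos; lra|].
intros [x y] Hh; assert (Hx := Rabs_fst_le (x, y)); assert (Hy := Rabs_snd_le (x, y)).
simpl in Hx, Hy; set (N := Cnorm (x, y)) in *.
assert (M1 := Rmin_l e (Rmin d1 (Rmin d2 d3))); assert (M2 := Rmin_r e (Rmin d1 (Rmin d2 d3))).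
assert (M3 := Rmin_l d1 (Rmin d2 d3)); assert (M4 := Rmin_r d1 (Rmin d2 d3)).
assert (M5 := Rmin_l d2 d3); assert (M6 := Rmin_r d2 d3).
specialize (D1 x ltac:(lra)); specialize (D2 y ltac:(lra)); specialize (D3 y ltac:(lra)).
assert (Px := Rabs_pos x); assert (Py := Rabs_pos y).
eapply Rle_trans; [apply Cnorm_le_parts|]; simpl.
set (E := exp x - 1 - 1 * x) in *; set (C := cos y - 1 - 0 * y) in *.
set (S := sin y - 0 - 1 * y) in *.
replace (exp x * cos y + - (1) + - x) with (E * cos y + (1 + x) * C) by (unfold E, C; ring).
replace (exp x * sin y + -0 + - y) with ((E + x) * (S + y) + S) by (unfold E, S; ring).
assert (B1 : Rabs (E * cos y) <= e * N).
{ rewrite Rabs_mult; assert (Rabs (cos y) <= 1) by (apply Rabs_le, COS_bound).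
  assert (Q := Rabs_pos (cos y)); assert (Q' := Rabs_pos E); nra. }
assert (B2 : Rabs ((1 + x) * C) <= 2 * (e * N)).
{ rewrite Rabs_mult; assert (Q := Rabs_triang 1 x); rewrite Rabs_R1 in Q.
  assert (Q' := Rabs_pos C); assert (Q'' := Rabs_pos (1 + x)).
  apply Rmult_le_compat; try lra; nra. }
assert (B3 : Rabs ((E + x) * (S + y)) <= 4 * (e * N)).
{ rewrite Rabs_mult; assert (Q := Rabs_triang E x); assert (Q' := Rabs_triang S y).
  assert (R1 := Rabs_pos (E + x)); assert (R2 := Rabs_pos (S + y)).
  replace (4 * (e * N)) with ((2 * e) * (2 * N)) by ring.
  apply Rmult_le_compat; try lra; nra. }
assert (B4 : Rabs S <= e * N) by nra.
assert (T1 := Rabs_triang (E * cos y) ((1 + x) * C)).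
assert (T2 := Rabs_triang ((E + x) * (S + y)) S).
assert (B5 : e * N <= eps / 8 * N) by (apply Rmult_le_compat_r; lra).
lra.
Qed.

Lemma cdiff_Cexp w : cdiff Cexp w.
Proof.
apply cdiff_of_derivative with (Cexp w); intros eps He.
assert (Hp : 0 < Cnorm (Cexp w)) by (rewrite Cnorm_Cexp; apply exp_pos).
destruct (Cexp_derivative_0 (eps / Cnorm (Cexp w))) as (r & Hr & H).
{ apply Rdiv_lt_0_compat; lra. }
exists r; split; [exact Hr|]; intros h Hh; specialize (H h Hh).
rewrite Cexp_add.
replace (Csub (Csub (Cmul (Cexp w) (Cexp h)) (Cexp w)) (Cmul (Cexp w) h))
  with (Cmul (Cexp w) (Csub (Csub (Cexp h) C1) h)) by ring.
rewrite Cnorm_mul.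
eapply Rle_trans; [apply Rmult_le_compat_l; [lra|exact H]|].
apply Req_le; field; lra.
Qed.

(** * A Schwarz lemma of arbitrary order *)

Lemma ccont_continuity_2d Psi x y :
  ccont Psi (x, y) -> continuity_2d_pt (fun u v => fst (Psi (u, v))) x y.
Proof.
intros H eps; destruct (H eps (cond_pos eps)) as (d & Hd & K).
assert (Hd2 : 0 < d / 2) by lra.
exists (mkposreal _ Hd2); simpl; intros u v Hu Hv.
assert (Hn : Cnorm (Csub (u, v) (x, y)) < d).
{ eapply Rle_lt_trans; [apply Cnorm_le_parts|]; simpl; fold (u - x) (v - y); lra. }
eapply Rle_lt_trans; [|apply (K _ Hn)].
exact (Rabs_fst_le (Csub (Psi (u, v)) (Psi (x, y)))).
Qed.

(* By the Cauchy-Riemann equations, [Im (Psi dw)] is a closed form. *)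
Lemma cdiff_closed_at Psi x y :
  cdiff Psi (x, y) ->
  closed_at (fun u v => snd (Psi (u, v))) (fun u v => fst (Psi (u, v))) x y.
Proof.
intros (phi & Hphi & r & Hr & E).
destruct (phi (x, y)) as [al be] eqn:Ephi.
exists be, al, (- be).
assert (K : forall eps, 0 < eps -> exists d, 0 < d /\ forall u v,
  Rabs (u - x) < d -> Rabs (v - y) < d ->
  Cnorm (Csub (Csub (Psi (u, v)) (Psi (x, y))) (Cmul (al, be) (u - x, v - y)))
    <= eps * Rmax (Rabs (u - x)) (Rabs (v - y))).
{ intros eps He; destruct (Hphi (eps / 2)) as (d & Hd & K); [lra|].
  exists (Rmin r d / 2); split; [assert (0 < Rmin r d) by (apply Rmin_pos; lra); lra|].
  intros u v Hu Hv; pose proof (Rmin_l r d); pose proof (Rmin_r r d).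
  set (h := Csub (u, v) (x, y)).
  assert (Hh : Cnorm h <= 2 * Rmax (Rabs (u - x)) (Rabs (v - y))).
  { eapply Rle_trans; [apply Cnorm_le_parts|]; simpl; fold (u - x) (v - y).
    pose proof (Rmax_l (Rabs (u - x)) (Rabs (v - y))).
    pose proof (Rmax_r (Rabs (u - x)) (Rabs (v - y))); lra. }
  assert (Hh2 : Cnorm h < Rmin r d).
  { eapply Rle_lt_trans; [apply Cnorm_le_parts|]; simpl; fold (u - x) (v - y); lra. }
  rewrite (E (u, v)) by (fold h; lra); fold h.
  specialize (K (u, v) ltac:(fold h; lra)); rewrite Ephi in K.
  change (u - x, v - y) with h.
  replace (Csub (Csub (Cadd (Psi (x, y)) (Cmul (phi (u, v)) h)) (Psi (x, y))) (Cmul (al, be) h))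
    with (Cmul (Csub (phi (u, v)) (al, be)) h) by ring.
  rewrite Cnorm_mul; assert (Q := Cnorm_ge0 h).
  assert (Q' := Cnorm_ge0 (Csub (phi (u, v)) (al, be))).
  apply Rle_trans with (eps / 2 * (2 * Rmax (Rabs (u - x)) (Rabs (v - y)))); [|lra].
  apply Rmult_le_compat; lra. }
split; intros eps; destruct (K eps (cond_pos eps)) as (d & Hd & L);
  exists (mkposreal d Hd); simpl; intros u v Hu Hv;
  (eapply Rle_trans; [|apply (L u v Hu Hv)]).
- eapply Rle_trans; [|apply Rabs_snd_le]; apply Req_le; f_equal; simpl; ring.
- eapply Rle_trans; [|apply Rabs_fst_le]; apply Req_le; f_equal; simpl; ring.
Qed.

(** On the circle of radius [exp s] one has [dt = dz / (i z)], so this is the real part of the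
    contour integral of [Phi z / (i z)]. The coordinates [(s, t)] turn an annulus into a rectangle,
    so that Goursat's lemma for rectangles suffices. *)
Definition circle_int (Phi : Cx -> Cx) (s : R) : R :=
  RInt (fun t => fst (Phi (Cexp (s, t)))) 0 (2 * PI).

Lemma Cexp_2PI s : Cexp (s, 0 + 2 * PI) = Cexp (s, 0).
Proof.
apply Cx_eq; simpl; rewrite Rplus_0_l; rewrite ?cos_2PI, ?sin_2PI, ?cos_0, ?sin_0; reflexivity.
Qed.

(** The sides [t = 0] and [t = 2 PI] of the rectangle have the same image, so their contributions
    cancel and the closed form of [cdiff_closed_at] leaves only the two circles. *)
Lemma circle_int_const Phi s0 s1 :
  s0 <= s1 -> (forall z, exp s0 <= Cnorm z <= exp s1 -> cdiff Phi z) ->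
  circle_int Phi s0 = circle_int Phi s1.
Proof.
intros Hs HPhi; pose proof PI_RGT_0 as HPI.
assert (Hcl : forall x y, s0 <= x <= s0 + (s1 - s0) -> 0 <= y <= 0 + 2 * PI ->
  closed_at (fun u v => snd (Phi (Cexp (u, v)))) (fun u v => fst (Phi (Cexp (u, v)))) x y).
{ intros x y Hx _.
  apply (cdiff_closed_at (fun w => Phi (Cexp w))).
  apply cdiff_comp; [|apply cdiff_Cexp].
  apply HPhi; rewrite Cnorm_Cexp; simpl.
  split; (destruct (Req_dec x s0) as [->|]; [|]); try (right; reflexivity).
  - left; apply exp_increasing; lra.
  - destruct (Req_dec s0 s1) as [->|]; [right; reflexivity|left; apply exp_increasing; lra].
  - destruct (Req_dec x s1) as [->|]; [right; reflexivity|left; apply exp_increasing; lra]. }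
assert (G := goursat_rectangle _ _ s0 0 (s1 - s0) (2 * PI) ltac:(lra) ltac:(lra) Hcl).
unfold bdry_int in G; cbv beta in G.
replace (s0 + (s1 - s0)) with s1 in G by ring.
assert (Ep : RInt (fun t => snd (Phi (Cexp (t, 0 + 2 * PI)))) s0 s1 =
  RInt (fun t => snd (Phi (Cexp (t, 0)))) s0 s1).
{ apply RInt_ext; intros t _; rewrite Cexp_2PI; reflexivity. }
rewrite Ep, Rplus_0_l in G; unfold circle_int; lra.
Qed.

Lemma ex_RInt_circle Phi s :
  (forall z, Cnorm z = exp s -> ccont Phi z) ->
  ex_RInt (fun t => fst (Phi (Cexp (s, t)))) 0 (2 * PI).
Proof.
intros H; apply ex_RInt_continuous_le; [pose proof PI_RGT_0; lra|].
intros t _.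
apply (continuity_2d_continuous_2 (fun u v => fst (Phi (Cexp (u, v))))).
apply (ccont_continuity_2d (fun w => Phi (Cexp w))).
apply ccont_comp; [|apply cdiff_ccont, cdiff_Cexp].
apply H, Cnorm_Cexp.
Qed.

Lemma circle_int_continuous Phi L d0 :
  0 < d0 -> (forall s z, Rabs (s - L) < d0 -> Cnorm z = exp s -> ccont Phi z) ->
  forall eps, 0 < eps -> exists d, 0 < d /\ forall s, Rabs (s - L) < d ->
    Rabs (circle_int Phi s - circle_int Phi L) <= eps.
Proof.
intros Hd0 H eps He; pose proof PI_RGT_0 as HPI.
assert (He2 : 0 < eps / (2 * PI)) by (apply Rdiv_lt_0_compat; lra).
destruct (uniform_continuity_2d_1d (fun t s => fst (Phi (Cexp (s, t)))) 0 (2 * PI) L)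
  with (eps := mkposreal (eps / (2 * PI)) He2) as [d Hd].
{ intros t _ e.
  destruct (ccont_continuity_2d (fun w => Phi (Cexp w)) L t) with (eps := e) as [d Hd].
  - apply ccont_comp; [|apply cdiff_ccont, cdiff_Cexp].
    apply (H L); [rewrite Rminus_diag, Rabs_R0; exact Hd0|apply Cnorm_Cexp].
  - exists d; intros u v Hu Hv; apply Hd; assumption. }
simpl in Hd; assert (Pd := cond_pos d).
exists (Rmin d d0); split; [apply Rmin_pos; lra|]; intros s Hs.
pose proof (Rmin_l d d0); pose proof (Rmin_r d d0).
unfold circle_int.
assert (I1 : ex_RInt (fun t => fst (Phi (Cexp (s, t)))) 0 (2 * PI)).
{ apply ex_RInt_circle; intros z; apply H; lra. }
assert (I2 : ex_RInt (fun t => fst (Phi (Cexp (L, t)))) 0 (2 * PI)).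
{ apply ex_RInt_circle; intros z; apply H; rewrite Rminus_diag, Rabs_R0; exact Hd0. }
assert (E := RInt_minus (V := R_CompleteNormedModule) _ _ _ _ I1 I2).
change (RInt (fun t => fst (Phi (Cexp (s, t)))) 0 (2 * PI) -
  RInt (fun t => fst (Phi (Cexp (L, t)))) 0 (2 * PI)) with
 (minus (RInt (fun t => fst (Phi (Cexp (s, t)))) 0 (2 * PI) : R_CompleteNormedModule)
  (RInt (fun t => fst (Phi (Cexp (L, t)))) 0 (2 * PI))).
rewrite <- E.
replace eps with ((2 * PI - 0) * (eps / (2 * PI))) by (field; lra).
apply abs_RInt_le_const; [lra| |].
- apply (ex_RInt_minus (V := R_NormedModule)); assumption.
- intros t Ht; left; apply Rabs_lt_between in Hs.
  apply (Hd t L t s); try lra.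
  rewrite Rminus_diag, Rabs_R0; lra.
Qed.

(** Serves in place of a removable singularity theorem: the kernel below is only known to be
    continuous at one point of the circle of radius [exp L]. The integral is constant on either side
    and continuous in the radius, so it does not jump there. *)
Lemma circle_int_const_across Phi L s0 s1 :
  s0 < L -> L < s1 ->
  (forall z, exp s0 <= Cnorm z <= exp s1 -> ccont Phi z) ->
  (forall z, exp s0 <= Cnorm z <= exp s1 -> Cnorm z <> exp L -> cdiff Phi z) ->
  circle_int Phi s0 = circle_int Phi s1.
Proof.
intros H0 H1 HC HD.
assert (Hexp : forall u v, u < v -> exp u < exp v) by (intros; apply exp_increasing; assumption).
assert (Hexp' : forall u v, u <= v -> exp u <= exp v).
{ intros u v [h|h]; [left; auto|right; rewrite h; reflexivity]. }
assert (B : forall eps, 0 < eps -> Rabs (circle_int Phi s0 - circle_int Phi s1) <= 2 * eps).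
{ intros eps He.
  set (d0 := Rmin (L - s0) (s1 - L)).
  assert (Hd0 : 0 < d0) by (apply Rmin_pos; lra).
  assert (M1 : d0 <= L - s0) by apply Rmin_l; assert (M2 : d0 <= s1 - L) by apply Rmin_r.
  destruct (circle_int_continuous Phi L d0 Hd0) with (eps := eps) as (d & Hd & K).
  - intros s z Hs Hz; apply Rabs_lt_between in Hs.
    apply HC; rewrite Hz; split; apply Hexp'; lra.
  - exact He.
  - set (e := Rmin d d0 / 2).
    assert (He1 : 0 < Rmin d d0) by (apply Rmin_pos; lra).
    assert (M3 := Rmin_l d d0); assert (M4 := Rmin_r d d0).
    assert (E0 : circle_int Phi s0 = circle_int Phi (L - e)).
    { apply circle_int_const; [unfold e; lra|]; intros z Hz.
      assert (Q := Hexp (L - e) L ltac:(unfold e; lra)).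
      assert (Q' := Hexp L s1 H1).
      apply HD; lra. }
    assert (E1 : circle_int Phi (L + e) = circle_int Phi s1).
    { apply circle_int_const; [unfold e; lra|]; intros z Hz.
      assert (Q := Hexp L (L + e) ltac:(unfold e; lra)).
      assert (Q' := Hexp s0 L H0).
      apply HD; lra. }
    rewrite E0, <- E1.
    assert (K1 := K (L - e) ltac:(apply Rabs_lt_between; unfold e; lra)).
    assert (K2 := K (L + e) ltac:(apply Rabs_lt_between; unfold e; lra)).
    apply Rabs_le_between in K1; apply Rabs_le_between in K2; apply Rabs_le; lra. }
destruct (Req_dec (circle_int Phi s0) (circle_int Phi s1)) as [e|n]; [exact e|exfalso].
assert (P : 0 < Rabs (circle_int Phi s0 - circle_int Phi s1)) by (apply Rabs_pos_lt; lra).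
specialize (B (Rabs (circle_int Phi s0 - circle_int Phi s1) / 4) ltac:(lra)); lra.
Qed.

(** With [w = a / z] in the closed unit disc this is [1 / (1 - w)], a Moebius map into a half plane.
    The lower bound replaces the exact mean of [z / (z - a)] given by Cauchy's formula. *)
Lemma Re_div_sub_ge a z :
  z <> a -> Cnorm a <= Cnorm z -> 1 / 2 <= fst (Cmul z (Cinv (Csub z a))).
Proof.
intros Hne Haz.
assert (Hn : Csub z a <> C0).
{ intros e; apply Hne; replace z with (Cadd (Csub z a) a) by ring; rewrite e; ring. }
assert (P := Cnorm_gt0 _ Hn).
assert (Q : Cnorm (Csub z a) * Cnorm (Csub z a) =
  (fst z - fst a) * (fst z - fst a) + (snd z - snd a) * (snd z - snd a)).
{ rewrite Cnorm_sqr; simpl; ring. }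
assert (Hden : 0 < (fst z - fst a) * (fst z - fst a) + (snd z - snd a) * (snd z - snd a))
  by (rewrite <- Q; nra).
assert (Ez := Cnorm_sqr z); assert (Ea := Cnorm_sqr a).
assert (Cnorm a * Cnorm a <= Cnorm z * Cnorm z).
{ assert (0 <= Cnorm a) by apply Cnorm_ge0; apply Rmult_le_compat; lra. }
unfold Cinv, Complex.Cinv; simpl.
replace (fst z + - fst a) with (fst z - fst a) by ring.
replace (snd z + - snd a) with (snd z - snd a) by ring.
set (D := (fst z - fst a) * ((fst z - fst a) * 1) + (snd z - snd a) * ((snd z - snd a) * 1)).
assert (ED : D = (fst z - fst a) * (fst z - fst a) + (snd z - snd a) * (snd z - snd a))
  by (unfold D; ring).
replace (fst z * ((fst z - fst a) / D) - snd z * (- (snd z - snd a) / D))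
  with ((fst z * (fst z - fst a) + snd z * (snd z - snd a)) / D) by (field; lra).
apply Rmult_le_reg_r with D; [lra|].
unfold Rdiv at 2; rewrite Rmult_assoc, Rinv_l, Rmult_1_r by lra.
rewrite ED; nra.
Qed.

Section Schwarz.
Variables (g : Cx -> Cx) (rho M : R) (k : nat) (a : Cx).
Hypothesis Hrho : 0 < rho.
Hypothesis Hg : forall z, Cnorm z <= rho -> cdiff g z.
Hypothesis HM : forall z, Cnorm z = rho -> Cnorm (g z) <= M.
Hypothesis Ho : forall eps, 0 < eps -> exists d, 0 < d /\
  forall z, Cnorm z < d -> Cnorm (g z) <= eps * Cnorm z ^ k.
Hypothesis Ha : a <> C0.
Hypothesis Harho : Cnorm a <= rho / 2.

(** The factor [(a / z)^(k+1)] is 1 at [z = a], so the difference vanishes there, while on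
    [|z| = rho] its modulus is the decay rate wanted for [g a]. *)
Let num (z : Cx) : Cx := Csub (Cmul (g z) (Cpow (Cmul a (Cinv z)) (S k))) (g a).

Lemma cdiff_num z : z <> C0 -> Cnorm z <= rho -> cdiff num z.
Proof.
intros Hz Hzr; unfold num, Csub.
apply cdiff_add; [|apply cdiff_const].
apply cdiff_mul; [apply Hg, Hzr|apply cdiff_pow].
apply cdiff_mul; [apply cdiff_const|apply cdiff_inv; [apply cdiff_id|exact Hz]].
Qed.

Lemma Cpow_C1 n : Cpow C1 n = C1.
Proof. induction n as [|n IH]; simpl; [reflexivity|rewrite IH; ring]. Qed.

Lemma num_a : num a = C0.
Proof.
unfold num; replace (Cmul a (Cinv a)) with C1 by (field; exact Ha).
rewrite Cpow_C1; ring.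
Qed.

(* The kernel [z (g(z) (a/z)^(k+1) - g(a)) / (z - a)] has a removable singularity at [a], and its
   circular means tend to [0] with the radius because [g] is [o(z^k)]. *)
Lemma schwarz_kernel :
  exists Phi : Cx -> Cx,
  (forall z, z <> C0 -> Cnorm z <= rho -> ccont Phi z) /\
  (forall z, z <> C0 -> Cnorm z <= rho -> z <> a -> cdiff Phi z) /\
  (forall z, z <> a -> Phi z =
     Cmul (Cconj (g a)) (Cmul (Cmul z (Cinv (Csub z a))) (num z))).
Proof.
assert (Pa := Cnorm_gt0 _ Ha).
assert (Hsub : forall z w, z <> w -> Csub z w <> C0).
{ intros z w n e; apply n; replace z with (Cadd (Csub z w) w) by ring; rewrite e; ring. }
destruct (cdiff_num a Ha ltac:(lra)) as (nu & Hnu & r & Hr & E).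
rewrite num_a in E.
set (f := fun z => Cmul (Cconj (g a)) (Cmul (Cmul z (Cinv (Csub z a))) (num z))).
set (Phi := fun z => if Cx_eq_dec z a then Cmul (Cconj (g a)) (Cmul z (nu z)) else f z).
assert (Ef : forall z, z <> a -> Phi z = f z).
{ intros z n; unfold Phi; destruct (Cx_eq_dec z a); [contradiction|reflexivity]. }
assert (D : forall z, z <> C0 -> Cnorm z <= rho -> z <> a -> cdiff Phi z).
{ intros z Hz Hzr Hza.
  apply cdiff_ext_loc with f.
  - exists (Cnorm (Csub z a)); split; [apply Cnorm_gt0, Hsub, Hza|].
    intros w Hw; symmetry; apply Ef; intros ->; rewrite Cnorm_sub_sym in Hw; lra.
  - unfold f; apply cdiff_mul; [apply cdiff_const|apply cdiff_mul; [|apply cdiff_num; assumption]].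
    apply cdiff_mul; [apply cdiff_id|apply cdiff_inv; [|apply Hsub, Hza]].
    apply cdiff_add; [apply cdiff_id|apply cdiff_const]. }
exists Phi; repeat split; [|exact D|exact Ef].
intros z Hz Hzr; destruct (Cx_eq_dec z a) as [->|n]; [|apply cdiff_ccont, D; assumption].
apply ccont_ext_loc with (fun z => Cmul (Cconj (g a)) (Cmul z (nu z))).
- exists r; split; [exact Hr|]; intros z Hz'; unfold Phi.
  destruct (Cx_eq_dec z a) as [->|n]; [reflexivity|].
  unfold f; rewrite (E z Hz'); field; apply Hsub, n.
- apply ccont_mul; [apply ccont_const|apply ccont_mul; [apply ccont_id|exact Hnu]].
Qed.

(** The circular means of the kernel are constant in the radius and tend to 0. On [|z| = rho] the
    real part of the kernel is at most [2 B X - B^2 / 2], where [B = |g a|] and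
    [X = M (|a| / rho)^(k+1)]: the factor [z / (z - a)] has modulus at most 2, because
    [|a| <= rho / 2], and real part at least 1/2. A zero mean then forces [B <= 4 X]. *)
Lemma schwarz_nonzero : Cnorm (g a) <= 4 * M * (Cnorm a / rho) ^ S k.
Proof.
pose proof PI_RGT_0 as HPI.
destruct schwarz_kernel as (Phi & HC & HD & E).
assert (Pa := Cnorm_gt0 _ Ha); set (A := Cnorm a) in *.
set (B := Cnorm (g a)); assert (HB : 0 <= B) by apply Cnorm_ge0.
set (L := ln A).
assert (HL : exp L = A) by (apply exp_ln; lra).
assert (Hlnr : exp (ln rho) = rho) by (apply exp_ln; lra).
assert (HLr : L < ln rho) by (apply ln_increasing; lra).
assert (Hle : forall u v, u <= v -> exp u <= exp v).
{ intros u v [h|h]; [left; apply exp_increasing; auto|right; rewrite h; reflexivity]. }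
assert (Hnz : forall s z, exp s <= Cnorm z -> z <> C0).
{ intros s z Hz; apply Cnorm_neq0; pose proof (exp_pos s); lra. }
assert (Zero : forall eps, 0 < eps -> Rabs (circle_int Phi (ln rho)) <= 2 * PI * eps).
{ intros eps He.
  set (e := eps / ((B + 1) * 4 * (A ^ k + B / A + 1))).
  assert (HAk : 0 < A ^ k) by (apply pow_lt; lra).
  assert (HBA : 0 <= B / A) by (apply Rdiv_le_0_compat; lra).
  assert (Hden : 0 < (B + 1) * 4 * (A ^ k + B / A + 1)) by (apply Rmult_lt_0_compat; lra).
  assert (He' : 0 < e) by (apply Rdiv_lt_0_compat; lra).
  destruct (Ho e He') as (d & Hd & K).
  set (r := Rmin (d / 2) (Rmin (A / 2) e)).
  assert (Hr : 0 < r) by (repeat apply Rmin_pos; lra).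
  assert (R1 : r <= d / 2) by apply Rmin_l.
  assert (R2 : r <= A / 2) by (eapply Rle_trans; [apply Rmin_r|apply Rmin_l]).
  assert (R3 : r <= e) by (eapply Rle_trans; [apply Rmin_r|apply Rmin_r]).
  set (s := ln r).
  assert (Hs : exp s = r) by (apply exp_ln; lra).
  assert (HsL : s < L) by (apply ln_increasing; lra).
  rewrite <- (circle_int_const_across Phi L s (ln rho)); try assumption.
  2:{ intros z Hz; rewrite Hlnr in Hz; apply HC; [apply (Hnz s); lra|lra]. }
  2:{ intros z Hz Hne; rewrite Hlnr in Hz; apply HD; [apply (Hnz s); lra|lra|].
      intros ->; apply Hne; rewrite HL; reflexivity. }
  unfold circle_int.
  replace (2 * PI * eps) with ((2 * PI - 0) * eps) by ring.
  apply abs_RInt_le_const; [lra| |].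
  { apply ex_RInt_circle; intros z Hz; apply HC; [apply (Hnz s); lra|lra]. }
  intros t _; set (z := Cexp (s, t)).
  assert (Hz : Cnorm z = r) by (unfold z; rewrite Cnorm_Cexp; exact Hs).
  assert (Hza : z <> a) by (intros e'; rewrite e' in Hz; fold A in Hz; lra).
  assert (Hz0 : z <> C0) by (apply Cnorm_neq0; lra).
  eapply Rle_trans; [apply Rabs_fst_le|].
  rewrite (E z Hza), 3!Cnorm_mul, Cnorm_conj; fold B.
  assert (Hsub : A / 2 <= Cnorm (Csub z a)).
  { assert (Q := Cnorm_sub_ge a z); rewrite Cnorm_sub_sym in Q; fold A in Q; lra. }
  rewrite Cnorm_inv by (apply Cnorm_neq0; lra).
  assert (Hinv : / Cnorm (Csub z a) <= 2 / A).
  { replace (2 / A) with (/ (A / 2)) by (field; lra); apply Rinv_le_contravar; lra. }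
  assert (Hinv0 : 0 < / Cnorm (Csub z a)) by (apply Rinv_0_lt_compat; lra).
  (* The factor [z] of the kernel absorbs one power of the pole of [(a / z)^(k+1)], and the [o(z^k)]
     hypothesis absorbs the others at the price of [e]. *)
  assert (Hnum : Cnorm z * Cnorm (num z) <= e * A ^ S k + r * B).
  { assert (Q : Cnorm (num z) <= Cnorm (g z) * (A / r) ^ S k + B).
    { unfold num; eapply Rle_trans; [apply Cnorm_sub|]; fold B; right; f_equal.
      rewrite Cnorm_mul, Cnorm_pow, Cnorm_mul, Cnorm_inv, Hz by exact Hz0; reflexivity. }
    rewrite Hz; eapply Rle_trans; [apply Rmult_le_compat_l; [lra|exact Q]|].
    rewrite Rmult_plus_distr_l; apply Rplus_le_compat_r.
    specialize (K z ltac:(lra)); rewrite Hz in K.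
    assert (Hpos : 0 < (A / r) ^ S k) by (apply pow_lt, Rdiv_lt_0_compat; lra).
    apply Rle_trans with (r * (e * r ^ k * (A / r) ^ S k)).
    - apply Rmult_le_compat_l; [lra|apply Rmult_le_compat_r; lra].
    - right; unfold Rdiv; rewrite Rpow_mult_distr, pow_inv.
      assert (0 < r ^ k) by (apply pow_lt; lra); simpl; field; lra. }
  apply Rle_trans with (B * ((2 / A) * (e * A ^ S k + r * B))).
  { apply Rmult_le_compat_l; [exact HB|].
    replace (Cnorm z * / Cnorm (Csub z a) * Cnorm (num z))
      with (/ Cnorm (Csub z a) * (Cnorm z * Cnorm (num z))) by ring.
    apply Rmult_le_compat; [lra| |exact Hinv|exact Hnum].
    apply Rmult_le_pos; apply Cnorm_ge0. }
  apply Rle_trans with (B * ((2 / A) * (e * A ^ S k + e * B))).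
  { apply Rmult_le_compat_l; [exact HB|apply Rmult_le_compat_l].
    - left; apply Rdiv_lt_0_compat; lra.
    - apply Rplus_le_compat_l, Rmult_le_compat_r; assumption. }
  replace (B * (2 / A * (e * A ^ S k + e * B))) with (e * (B * 2 * (A ^ k + B / A)))
    by (simpl; field; lra).
  replace eps with (e * ((B + 1) * 4 * (A ^ k + B / A + 1)))
    by (unfold e; unfold Rdiv at 1; rewrite Rmult_assoc, Rinv_l; lra).
  apply Rmult_le_compat_l; [lra|nra]. }
set (X := M * (A / rho) ^ S k).
assert (Hq : 0 < (A / rho) ^ S k) by (apply pow_lt, Rdiv_lt_0_compat; lra).
assert (Pt : forall t, fst (Phi (Cexp (ln rho, t))) <= B * (2 * X) - B * B / 2).
{ intros t; set (z := Cexp (ln rho, t)).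
  assert (Hz : Cnorm z = rho) by (unfold z; rewrite Cnorm_Cexp; exact Hlnr).
  assert (Hza : z <> a) by (intros e'; rewrite e' in Hz; fold A in Hz; lra).
  assert (Hz0 : z <> C0) by (apply Cnorm_neq0; lra).
  rewrite (E z Hza); unfold num.
  set (T := Cmul z (Cinv (Csub z a))).
  set (Y := Cmul (g z) (Cpow (Cmul a (Cinv z)) (S k))).
  assert (HT : 1 / 2 <= fst T) by (apply Re_div_sub_ge; [exact Hza|fold A; lra]).
  assert (HT2 : Cnorm T <= 2).
  { unfold T; rewrite Cnorm_mul, Hz.
    assert (Q := Cnorm_sub_ge z a); fold A in Q.
    rewrite Cnorm_inv by (apply Cnorm_neq0; lra).
    apply Rmult_le_reg_r with (Cnorm (Csub z a)); [lra|].
    rewrite Rmult_assoc, Rinv_l; lra. }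
  assert (HY : Cnorm Y <= X).
  { unfold Y, X; rewrite Cnorm_mul, Cnorm_pow, Cnorm_mul, Cnorm_inv, Hz by exact Hz0; fold A.
    apply Rmult_le_compat_r; [unfold Rdiv in Hq; lra|apply HM, Hz]. }
  replace (fst (Cmul (Cconj (g a)) (Cmul T (Csub Y (g a)))))
    with (fst (Cmul (Cconj (g a)) (Cmul T Y))
      - (fst (g a) * fst (g a) + snd (g a) * snd (g a)) * fst T)
    by (simpl; ring).
  rewrite <- Cnorm_sqr; fold B.
  assert (Q := Rabs_fst_le (Cmul (Cconj (g a)) (Cmul T Y))).
  rewrite 2!Cnorm_mul, Cnorm_conj in Q; fold B in Q.
  assert (Q2 : B * (Cnorm T * Cnorm Y) <= B * (2 * X)).
  { apply Rmult_le_compat_l; [exact HB|].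
    apply Rmult_le_compat; try apply Cnorm_ge0; assumption. }
  assert (Q3 := Rle_abs (fst (Cmul (Cconj (g a)) (Cmul T Y)))).
  assert (B * B * (1 / 2) <= B * B * fst T)
    by (apply Rmult_le_compat_l; [apply Rmult_le_pos|]; assumption).
  lra. }
assert (Up : circle_int Phi (ln rho) <= 2 * PI * (B * (2 * X) - B * B / 2)).
{ replace (2 * PI * (B * (2 * X) - B * B / 2))
    with (RInt (fun _ => B * (2 * X) - B * B / 2) 0 (2 * PI)).
  2:{ rewrite RInt_const; unfold scal; simpl; unfold mult; simpl; ring. }
  unfold circle_int; apply RInt_le; [lra| | |intros; apply Pt].
  - apply ex_RInt_circle; intros z Hz; rewrite Hlnr in Hz.
    apply HC; [apply Cnorm_neq0; lra|lra].
  - apply (ex_RInt_const (V := R_NormedModule)). }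
change (B <= 4 * M * (A / rho) ^ S k); rewrite Rmult_assoc; fold X.
destruct (Rle_lt_dec B (4 * X)) as [h|h]; [exact h|exfalso].
assert (HX : 0 <= X).
{ assert (0 <= M).
  { eapply Rle_trans; [|apply (HM (rho, 0)); rewrite Cnorm_real; apply Rabs_pos_eq; lra].
    apply Cnorm_ge0. }
  unfold X; apply Rmult_le_pos; lra. }
set (e := B * B / 2 - B * (2 * X)).
assert (He : 0 < e) by (unfold e; nra).
specialize (Zero (e / 2) ltac:(lra)); apply Rabs_le_between in Zero.
assert (2 * PI * (B * (2 * X) - B * B / 2) = - (2 * PI * e)) by (unfold e; ring).
nra.
Qed.

End Schwarz.

Theorem schwarz_order (g : Cx -> Cx) (rho M : R) (k : nat) (a : Cx) :
  0 < rho -> (forall z, Cnorm z <= rho -> cdiff g z) ->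
  (forall z, Cnorm z = rho -> Cnorm (g z) <= M) ->
  (forall eps, 0 < eps -> exists d, 0 < d /\
     forall z, Cnorm z < d -> Cnorm (g z) <= eps * Cnorm z ^ k) ->
  Cnorm a <= rho / 2 -> Cnorm (g a) <= 4 * M * (Cnorm a / rho) ^ S k.
Proof.
intros Hrho Hg HM Ho Ha.
destruct (Cx_eq_dec a C0) as [->|n]; [|apply schwarz_nonzero; assumption].
rewrite Cnorm_C0; replace (4 * M * (0 / rho) ^ S k) with 0 by (simpl; field; lra).
apply Rle_plus_epsilon; intros eps He; rewrite Rplus_0_l.
destruct (Ho eps He) as (d & Hd & K).
specialize (K C0 ltac:(rewrite Cnorm_C0; exact Hd)); rewrite Cnorm_C0 in K.
assert (0 ^ k <= 1) by (destruct k; simpl; lra).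
nra.
Qed.

(** * Vectors and matrices *)

Lemma Rsum_S n f : Rsum (S n) f = f Fin.F1 + Rsum n (fun i => f (Fin.FS i)).
Proof. reflexivity. Qed.

Lemma Csum_S n f : Csum (S n) f = Cadd (f Fin.F1) (Csum n (fun i => f (Fin.FS i))).
Proof. reflexivity. Qed.

Lemma Rsum_le n f g : (forall i, f i <= g i) -> Rsum n f <= Rsum n g.
Proof.
induction n as [|n IH]; intros H; [apply Rle_refl|].
rewrite 2!Rsum_S; apply Rplus_le_compat; auto.
Qed.

Lemma Rsum_const n c : Rsum n (fun _ => c) = INR n * c.
Proof.
induction n as [|n IH]; [simpl; unfold Rsum; simpl; ring|].
rewrite Rsum_S, IH, S_INR; ring.
Qed.

Lemma Rsum_add n f g : Rsum n (fun i => f i + g i) = Rsum n f + Rsum n g.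
Proof.
induction n as [|n IH]; [unfold Rsum; simpl; ring|].
rewrite 3!Rsum_S, IH; ring.
Qed.

Lemma Rsum_scal n c f : Rsum n (fun i => c * f i) = c * Rsum n f.
Proof.
induction n as [|n IH]; [unfold Rsum; simpl; ring|].
rewrite 2!Rsum_S, IH; ring.
Qed.

Lemma Rsum_ge0 n f : (forall i, 0 <= f i) -> 0 <= Rsum n f.
Proof.
intros H; replace 0 with (Rsum n (fun _ => 0)) by (rewrite Rsum_const; ring).
apply Rsum_le, H.
Qed.

Lemma Rsum_term n f i : (forall i, 0 <= f i) -> f i <= Rsum n f.
Proof.
intros H; induction i as [n|n i IH]; rewrite Rsum_S.
- assert (0 <= Rsum n (fun i => f (Fin.FS i))) by (apply Rsum_ge0; auto); lra.
- specialize (IH (fun i => f (Fin.FS i)) (fun i => H _)); specialize (H Fin.F1); simpl in IH; lra.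
Qed.

Lemma Csum_ext n f g : (forall i, f i = g i) -> Csum n f = Csum n g.
Proof. intros H; f_equal; apply functional_extensionality, H. Qed.

Lemma Csum_add n f g : Csum n (fun i => Cadd (f i) (g i)) = Cadd (Csum n f) (Csum n g).
Proof.
induction n as [|n IH]; [unfold Csum; simpl; ring|].
rewrite 3!Csum_S, IH; ring.
Qed.

Lemma Csum_scal n c f : Csum n (fun i => Cmul c (f i)) = Cmul c (Csum n f).
Proof.
induction n as [|n IH]; [unfold Csum; simpl; ring|].
rewrite 2!Csum_S, IH; ring.
Qed.

Lemma Csum_0 n : Csum n (fun _ => C0) = C0.
Proof.
induction n as [|n IH]; [reflexivity|].
rewrite Csum_S, IH; ring.
Qed.

Lemma Csum_exchange n m (f : Fin.t n -> Fin.t m -> Cx) :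
  Csum n (fun i => Csum m (f i)) = Csum m (fun j => Csum n (fun i => f i j)).
Proof.
induction n as [|n IH].
- symmetry; apply (Csum_0 m).
- rewrite Csum_S, IH, <- Csum_add; reflexivity.
Qed.

Lemma Cnorm_Csum n f : Cnorm (Csum n f) <= Rsum n (fun i => Cnorm (f i)).
Proof.
induction n as [|n IH]; [unfold Csum; simpl; rewrite Cnorm_C0; apply Rle_refl|].
rewrite Csum_S, Rsum_S; eapply Rle_trans; [apply Cnorm_add|].
apply Rplus_le_compat_l, IH.
Qed.

Definition Fin_eqb {n} (i j : Fin.t n) : bool := if Fin.eq_dec i j then true else false.

Lemma Csum_delta n (i : Fin.t n) f :
  Csum n (fun j => if Fin_eqb i j then f j else C0) = f i.
Proof.
unfold Fin_eqb; induction i as [n|n i IH]; rewrite Csum_S.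
- destruct (Fin.eq_dec Fin.F1 Fin.F1) as [_|n0]; [|exfalso; auto].
  rewrite (Csum_ext _ _ (fun _ => C0)), Csum_0; [ring|].
  intros j; destruct (Fin.eq_dec Fin.F1 (Fin.FS j)) as [e|_]; [inversion e|reflexivity].
- destruct (Fin.eq_dec (Fin.FS i) Fin.F1) as [e|_]; [inversion e|].
  rewrite (Csum_ext _ _ (fun j => if (if Fin.eq_dec i j then true else false)
    then f (Fin.FS j) else C0)).
  + rewrite (IH (fun j => f (Fin.FS j))); ring.
  + intros j; destruct (Fin.eq_dec i j) as [->|ne];
      destruct (Fin.eq_dec (Fin.FS _) (Fin.FS j)) as [e|ne']; try reflexivity.
    * exfalso; auto.
    * apply Fin.FS_inj in e; contradiction.
Qed.

(** The [l1] norm, since [has_cderiv] measures increments by this sum. *)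
Definition nrm {n} (z : Cn n) : R := Rsum n (fun i => Cnorm (z i)).
Definition Cnsub {n} (z w : Cn n) : Cn n := fun i => Csub (z i) (w i).
Definition Cnscal {n} (c : Cx) (z : Cn n) : Cn n := fun i => Cmul c (z i).

Lemma Cn_ext {n} (z w : Cn n) : (forall i, z i = w i) -> z = w.
Proof. apply functional_extensionality. Qed.

Ltac cn_ring := apply Cn_ext; let i := fresh "i" in intro i;
  unfold Cnadd, Cnsub, Cnscal, Cn0; simpl; ring.

Lemma nrm_ge0 {n} (z : Cn n) : 0 <= nrm z.
Proof. apply Rsum_ge0; intros; apply Cnorm_ge0. Qed.

Lemma Cnorm_le_nrm {n} (z : Cn n) i : Cnorm (z i) <= nrm z.
Proof. apply (Rsum_term n (fun i => Cnorm (z i))); intros; apply Cnorm_ge0. Qed.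

Lemma nrm_le_INR {n} (z : Cn n) c : (forall i, Cnorm (z i) <= c) -> nrm z <= INR n * c.
Proof. intros H; rewrite <- Rsum_const; apply Rsum_le, H. Qed.

Lemma nrm_add {n} (z w : Cn n) : nrm (Cnadd z w) <= nrm z + nrm w.
Proof.
unfold nrm; rewrite <- Rsum_add; apply Rsum_le; intros i; apply Cnorm_add.
Qed.

Lemma nrm_scal {n} c (z : Cn n) : nrm (Cnscal c z) = Cnorm c * nrm z.
Proof.
unfold nrm; rewrite <- Rsum_scal; f_equal; apply functional_extensionality.
intros i; apply Cnorm_mul.
Qed.

Lemma nrm_Cn0 n : nrm (Cn0 n) = 0.
Proof. unfold nrm, Cn0; rewrite Cnorm_C0, Rsum_const; ring. Qed.

Lemma nrm_eq0 {n} (z : Cn n) : nrm z <= 0 -> z = Cn0 n.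
Proof.
intros H; apply Cn_ext; intros i; apply Cnorm_eq0.
assert (Q := Cnorm_le_nrm z i); assert (Q' := Cnorm_ge0 (z i)); lra.
Qed.

Lemma nrm_sub {n} (z w : Cn n) : nrm (Cnsub z w) <= nrm z + nrm w.
Proof.
unfold nrm; rewrite <- Rsum_add; apply Rsum_le; intros i; apply Cnorm_sub.
Qed.

Lemma nrm_sub_sym {n} (z w : Cn n) : nrm (Cnsub z w) = nrm (Cnsub w z).
Proof.
unfold nrm; f_equal; apply functional_extensionality; intros i; apply Cnorm_sub_sym.
Qed.

Lemma nrm_le_sub {n} (z w : Cn n) : nrm z <= nrm w + nrm (Cnsub z w).
Proof.
replace z with (Cnadd w (Cnsub z w)) at 1 by cn_ring; apply nrm_add.
Qed.

Lemma near0_of_nrm {n} r (z : Cn n) : nrm z < r -> near0 r z.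
Proof. intros H i; eapply Rle_lt_trans; [apply Cnorm_le_nrm|exact H]. Qed.

(** The [l1] norm is at most [n] times the largest coordinate; the denominator [n + 1] also covers
    dimension 0. *)
Lemma nrm_of_near0 {n} r (z : Cn n) : 0 < r -> near0 (r / (INR n + 1)) z -> nrm z < r.
Proof.
intros Hr H; assert (Hn := pos_INR n).
apply Rle_lt_trans with (INR n * (r / (INR n + 1))).
- apply nrm_le_INR; intros i; left; apply H.
- replace (INR n * (r / (INR n + 1))) with (r - r / (INR n + 1)) by (field; lra).
  assert (0 < r / (INR n + 1)) by (apply Rdiv_lt_0_compat; lra); lra.
Qed.

Lemma matvec_add {n} (M : Mat n) v w : matvec M (Cnadd v w) = Cnadd (matvec M v) (matvec M w).
Proof.
apply Cn_ext; intros j; unfold matvec, Cnadd; rewrite <- Csum_add.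
apply Csum_ext; intros; ring.
Qed.

Lemma matvec_scal {n} (M : Mat n) c v : matvec M (Cnscal c v) = Cnscal c (matvec M v).
Proof.
apply Cn_ext; intros j; unfold matvec, Cnscal; rewrite <- Csum_scal.
apply Csum_ext; intros; ring.
Qed.

Lemma Cnsub_alt {n} (v w : Cn n) : Cnsub v w = Cnadd v (Cnscal (Copp C1) w).
Proof. cn_ring. Qed.

Lemma matvec_sub {n} (M : Mat n) v w : matvec M (Cnsub v w) = Cnsub (matvec M v) (matvec M w).
Proof. rewrite 2!Cnsub_alt, matvec_add, matvec_scal; reflexivity. Qed.

Lemma matvec_0 {n} (M : Mat n) : matvec M (Cn0 n) = Cn0 n.
Proof.
replace (Cn0 n) with (Cnscal C0 (Cn0 n)) by cn_ring.
rewrite matvec_scal; cn_ring.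
Qed.

Definition mat_norm {n} (M : Mat n) : R := Rsum n (fun j => Rsum n (fun k => Cnorm (M j k))).

Lemma mat_norm_ge0 {n} (M : Mat n) : 0 <= mat_norm M.
Proof. apply Rsum_ge0; intros; apply Rsum_ge0; intros; apply Cnorm_ge0. Qed.

Lemma nrm_matvec {n} (M : Mat n) v : nrm (matvec M v) <= mat_norm M * nrm v.
Proof.
unfold mat_norm; rewrite Rmult_comm, <- Rsum_scal; apply Rsum_le; intros j.
eapply Rle_trans; [apply Cnorm_Csum|].
rewrite <- Rsum_scal; apply Rsum_le; intros k.
rewrite Cnorm_mul, Rmult_comm; apply Rmult_le_compat_r; [apply Cnorm_ge0|apply Cnorm_le_nrm].
Qed.

Definition matmul {n} (M N : Mat n) : Mat n :=
  fun i j => Csum n (fun k => Cmul (M i k) (N k j)).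
Definition matadd {n} (M N : Mat n) : Mat n := fun i j => Cadd (M i j) (N i j).
Definition matscal {n} (c : Cx) (M : Mat n) : Mat n := fun i j => Cmul c (M i j).
Definition matid (n : nat) : Mat n := fun i j => if Fin_eqb i j then C1 else C0.

Lemma matvec_matmul {n} (M N : Mat n) v : matvec (matmul M N) v = matvec M (matvec N v).
Proof.
apply Cn_ext; intros i; unfold matvec, matmul.
transitivity (Csum n (fun k => Csum n (fun j => Cmul (Cmul (M i k) (N k j)) (v j)))).
- rewrite Csum_exchange; apply Csum_ext; intros j.
  transitivity (Cmul (v j) (Csum n (fun k => Cmul (M i k) (N k j)))); [ring|].
  rewrite <- Csum_scal; apply Csum_ext; intros; ring.
- apply Csum_ext; intros k; rewrite <- Csum_scal; apply Csum_ext; intros; ring.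
Qed.

Lemma matvec_matadd {n} (M N : Mat n) v : matvec (matadd M N) v = Cnadd (matvec M v) (matvec N v).
Proof.
apply Cn_ext; intros i; unfold matvec, matadd, Cnadd; rewrite <- Csum_add.
apply Csum_ext; intros; ring.
Qed.

Lemma matvec_matscal {n} c (M : Mat n) v : matvec (matscal c M) v = Cnscal c (matvec M v).
Proof.
apply Cn_ext; intros i; unfold matvec, matscal, Cnscal; rewrite <- Csum_scal.
apply Csum_ext; intros; ring.
Qed.

Lemma matvec_matid {n} (v : Cn n) : matvec (matid n) v = v.
Proof.
apply Cn_ext; intros i; unfold matvec, matid.
rewrite <- (Csum_delta n i v); apply Csum_ext; intros j.
destruct (Fin_eqb i j); ring.
Qed.

Fixpoint matpow {n} (A : Mat n) (k : nat) : Mat n :=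
  match k with O => matid n | S k' => matmul A (matpow A k') end.

Lemma matvec_matpow_S {n} (A : Mat n) k v :
  matvec (matpow A (S k)) v = matvec A (matvec (matpow A k) v).
Proof. apply matvec_matmul. Qed.

Lemma matvec_matpow_add {n} (A : Mat n) j k v :
  matvec (matpow A (j + k)) v = matvec (matpow A j) (matvec (matpow A k) v).
Proof.
induction j as [|j IH]; [simpl; rewrite matvec_matid; reflexivity|].
change (S j + k)%nat with (S (j + k)); rewrite 2!matvec_matpow_S, IH; reflexivity.
Qed.

(** * Holomorphic maps in several variables *)

Definition hol {n} (r : R) (F : Map n) : Prop :=
  forall z, nrm z < r -> exists M, has_cderiv F z M.

Lemma holo_near0_hol {n} (F : Map n) : holo_near0 F <-> exists r, 0 < r /\ hol r F.
Proof.
split; intros (r & Hr & H).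
- exists r; split; [exact Hr|]; intros z Hz; apply H, near0_of_nrm, Hz.
- exists (r / (INR n + 1)); split; [apply Rdiv_lt_0_compat; [|pose proof (pos_INR n)]; lra|].
  intros z Hz; apply H, nrm_of_near0; assumption.
Qed.

Lemma germ_eq_nrm {n} (F G : Map n) :
  germ_eq F G <-> exists r, 0 < r /\ forall z, nrm z < r -> F z = G z.
Proof.
split; intros (r & Hr & H).
- exists r; split; [exact Hr|]; intros z Hz; apply Cn_ext, H, near0_of_nrm, Hz.
- exists (r / (INR n + 1)); split; [apply Rdiv_lt_0_compat; [|pose proof (pos_INR n)]; lra|].
  intros z Hz i; rewrite H; [reflexivity|apply nrm_of_near0; assumption].
Qed.

Lemma has_cderiv_nrm {n} (F : Map n) z M :
  has_cderiv F z M <-> forall eps, 0 < eps -> exists d, 0 < d /\ forall h, nrm h < d ->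
    nrm (Cnsub (Cnsub (F (Cnadd z h)) (F z)) (matvec M h)) <= eps * nrm h.
Proof.
assert (Hn := pos_INR n); split; intros H eps He.
- destruct (H (eps / (INR n + 1))) as (d & Hd & K); [apply Rdiv_lt_0_compat; lra|].
  exists d; split; [exact Hd|]; intros h Hh; specialize (K h (near0_of_nrm _ _ Hh)).
  fold (nrm h) in K.
  eapply Rle_trans; [apply nrm_le_INR, K|].
  assert (Q := nrm_ge0 h).
  replace (INR n * (eps / (INR n + 1) * nrm h))
    with (eps * nrm h - eps * nrm h / (INR n + 1)) by (field; lra).
  assert (0 <= eps * nrm h / (INR n + 1)) by (apply Rdiv_le_0_compat; nra).
  lra.
- destruct (H eps He) as (d & Hd & K).
  exists (d / (INR n + 1)); split; [apply Rdiv_lt_0_compat; lra|].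
  intros h Hh j; eapply Rle_trans; [|apply (K h), nrm_of_near0; assumption].
  apply (Cnorm_le_nrm (Cnsub (Cnsub (F (Cnadd z h)) (F z)) (matvec M h)) j).
Qed.

Lemma cdiff_slice {n} (F : Map n) z v t j M :
  has_cderiv F (Cnadd z (Cnscal t v)) M ->
  cdiff (fun s => F (Cnadd z (Cnscal s v)) j) t.
Proof.
intros H; apply cdiff_of_derivative with (matvec M v j); intros eps He.
assert (Hv := nrm_ge0 v).
destruct (proj1 (has_cderiv_nrm _ _ _) H (eps / (nrm v + 1))) as (d & Hd & K).
{ apply Rdiv_lt_0_compat; lra. }
exists (d / (nrm v + 1)); split; [apply Rdiv_lt_0_compat; lra|]; intros h Hh.
assert (Hb : Cnorm h * (nrm v + 1) < d).
{ apply (Rmult_lt_compat_r (nrm v + 1)) in Hh; [|lra].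
  unfold Rdiv in Hh; rewrite Rmult_assoc, Rinv_l, Rmult_1_r in Hh; lra. }
assert (Hc := Cnorm_ge0 h).
specialize (K (Cnscal h v)); rewrite nrm_scal in K; specialize (K ltac:(nra)).
replace (Cnadd (Cnadd z (Cnscal t v)) (Cnscal h v)) with (Cnadd z (Cnscal (Cadd t h) v)) in K
  by cn_ring.
rewrite matvec_scal in K.
eapply Rle_trans; [|eapply Rle_trans; [apply K|]].
- eapply Rle_trans; [|apply (Cnorm_le_nrm _ j)].
  unfold Cnsub, Cnscal; right; f_equal; ring.
- replace (eps / (nrm v + 1) * (Cnorm h * nrm v))
    with (eps * Cnorm h - eps * Cnorm h / (nrm v + 1)) by (field; lra).
  assert (0 <= eps * Cnorm h / (nrm v + 1)) by (apply Rdiv_le_0_compat; nra); lra.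
Qed.

(** * Orders of vanishing and Cauchy-type estimates *)

Definition little_o {n} (k : nat) (u : Map n) : Prop :=
  forall eps, 0 < eps -> exists d, 0 < d /\
    forall z, nrm z < d -> nrm (u z) <= eps * nrm z ^ k.

Definition big_O {n} (k : nat) (u : Map n) : Prop :=
  exists C r, 0 <= C /\ 0 < r /\ forall z, nrm z < r -> nrm (u z) <= C * nrm z ^ k.

Lemma little_o_at_0 {n} k (u : Map n) : little_o k u -> u (Cn0 n) = Cn0 n.
Proof.
intros H; apply nrm_eq0, Rle_plus_epsilon; intros eps He; rewrite Rplus_0_l.
destruct (H eps He) as (d & Hd & K).
specialize (K (Cn0 n)); rewrite nrm_Cn0 in K; specialize (K Hd).
assert (0 ^ k <= 1) by (destruct k; simpl; lra); nra.
Qed.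

(** Restriction to the complex line through [z] reduces this to [schwarz_order], applied at [t = 1]
    to each coordinate of [u (t z)]. The radius [R0] and the bound [M] stay the same for all [k],
    which [flat_holo_eq0] exploits. *)
Lemma little_o_gain {n} (u : Map n) R0 M k :
  0 < R0 -> hol R0 u -> (forall z, nrm z < R0 -> nrm (u z) <= M) -> little_o k u ->
  forall z, nrm z <= R0 / 4 -> nrm (u z) <= INR n * (4 * M * (2 * nrm z / R0) ^ S k).
Proof.
intros HR Hu HM Ho z Hz.
destruct (Rle_lt_dec (nrm z) 0) as [h|h].
- apply nrm_eq0 in h; subst z.
  rewrite (little_o_at_0 _ _ Ho), nrm_Cn0.
  replace (2 * 0 / R0) with 0 by (field; lra).
  simpl; rewrite Rmult_0_l, 2!Rmult_0_r; apply Rle_refl.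
- apply nrm_le_INR; intros j.
  (* The disc [|t| <= rho] is sent into the ball of radius [R0 / 2], and [|z| <= R0 / 4] makes
     [rho >= 2], as the Schwarz bound at [t = 1] demands. *)
  set (rho := R0 / (2 * nrm z)).
  assert (Hrho : rho * nrm z = R0 / 2) by (unfold rho; field; lra).
  assert (Hrho0 : 0 < rho) by (apply Rdiv_lt_0_compat; lra).
  assert (Ez : z = Cnadd (Cn0 n) (Cnscal C1 z)) by cn_ring.
  rewrite Ez at 1.
  replace (2 * nrm z / R0) with (Cnorm C1 / rho) by (rewrite Cnorm_C1; unfold rho; field; lra).
  assert (En : forall t, nrm (Cnadd (Cn0 n) (Cnscal t z)) = Cnorm t * nrm z).
  { intros t; replace (Cnadd (Cn0 n) (Cnscal t z)) with (Cnscal t z) by cn_ring; apply nrm_scal. }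
  apply (schwarz_order (fun t => u (Cnadd (Cn0 n) (Cnscal t z)) j)); [exact Hrho0| | | |].
  + intros t Ht; destruct (Hu (Cnadd (Cn0 n) (Cnscal t z))) as [N HN].
    { rewrite En; nra. }
    exact (cdiff_slice u (Cn0 n) z t j N HN).
  + intros t Ht; eapply Rle_trans; [apply Cnorm_le_nrm|]; apply HM; rewrite En, Ht; lra.
  + intros eps He.
    destruct (Ho (eps / nrm z ^ k)) as (d & Hd & K).
    { apply Rdiv_lt_0_compat; [lra|apply pow_lt; lra]. }
    exists (d / nrm z); split; [apply Rdiv_lt_0_compat; lra|]; intros t Ht.
    apply (Rmult_lt_compat_r (nrm z)) in Ht; [|lra].
    unfold Rdiv in Ht; rewrite Rmult_assoc, Rinv_l, Rmult_1_r in Ht by lra.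
    eapply Rle_trans; [apply Cnorm_le_nrm|].
    eapply Rle_trans; [apply K; rewrite En; lra|].
    rewrite En, Rpow_mult_distr; right.
    assert (0 < nrm z ^ k) by (apply pow_lt; lra); field; lra.
  + rewrite Cnorm_C1; apply Rmult_le_reg_r with (nrm z); [exact h|].
    unfold Rdiv; rewrite Rmult_assoc, (Rmult_comm (/ 2)), <- Rmult_assoc, Hrho; lra.
Qed.

(** The Schwarz bound of order 0 for [u - u z] on the complex line through [z] and [w] replaces
    Cauchy's estimate of the derivative. The disc of radius [4 rho / |w - z|] is sent into the ball
    of radius [5 rho] and, since [|w - z| <= 2 rho], has radius at least 2; subtracting [u z]
    doubles [M]. *)
Lemma hol_lipschitz {n} (u : Map n) R0 rho M :
  0 < rho -> 5 * rho < R0 -> hol R0 u -> (forall z, nrm z <= 5 * rho -> nrm (u z) <= M) ->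
  forall z w, nrm z <= rho -> nrm w <= rho ->
    nrm (Cnsub (u w) (u z)) <= 2 * INR n * M / rho * nrm (Cnsub w z).
Proof.
intros Hrho HR Hu HM z w Hz Hw; set (v := Cnsub w z).
assert (Hv : nrm v <= 2 * rho) by (unfold v; pose proof (nrm_sub w z); lra).
assert (HM0 : 0 <= M) by (apply Rle_trans with (nrm (u z)); [apply nrm_ge0|apply HM; lra]).
destruct (Rle_lt_dec (nrm v) 0) as [h|h].
- apply nrm_eq0 in h.
  assert (E : w = z).
  { replace w with (Cnadd z v) by (unfold v; cn_ring); rewrite h; cn_ring. }
  rewrite E, h, nrm_Cn0; replace (Cnsub (u z) (u z)) with (Cn0 n) by cn_ring.
  rewrite nrm_Cn0; lra.
- replace (2 * INR n * M / rho * nrm v)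
    with (INR n * (4 * (2 * M) * (Cnorm C1 / (4 * rho / nrm v)) ^ 1))
    by (rewrite Cnorm_C1; field; lra).
  apply nrm_le_INR; intros j.
  set (T := 4 * rho / nrm v).
  assert (HT : T * nrm v = 4 * rho) by (unfold T; field; lra).
  assert (HT0 : 0 < T) by (apply Rdiv_lt_0_compat; lra).
  assert (En : forall t, Cnorm t <= T -> nrm (Cnadd z (Cnscal t v)) <= 5 * rho).
  { intros t Ht; eapply Rle_trans; [apply nrm_add|]; rewrite nrm_scal; nra. }
  assert (D : forall t, Cnorm t <= T ->
    cdiff (fun t => Csub (u (Cnadd z (Cnscal t v)) j) (u z j)) t).
  { intros t Ht; destruct (Hu (Cnadd z (Cnscal t v))) as [N HN].
    { specialize (En t Ht); lra. }
    apply cdiff_add; [exact (cdiff_slice u z v t j N HN)|apply cdiff_const]. }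
  assert (E0 : Cnadd z (Cnscal C0 v) = z) by cn_ring.
  replace (Cnsub (u w) (u z) j) with ((fun t => Csub (u (Cnadd z (Cnscal t v)) j) (u z j)) C1).
  2:{ cbv beta; replace (Cnadd z (Cnscal C1 v)) with w by (unfold v; cn_ring); reflexivity. }
  apply (schwarz_order (fun t => Csub (u (Cnadd z (Cnscal t v)) j) (u z j)) T (2 * M) 0 C1);
    [exact HT0|exact D| | |].
  + intros t Ht; eapply Rle_trans; [apply Cnorm_sub|].
    assert (Q1 := Cnorm_le_nrm (u (Cnadd z (Cnscal t v))) j); assert (Q2 := Cnorm_le_nrm (u z) j).
    assert (Q3 := HM _ (En t ltac:(lra))); assert (Q4 := HM z ltac:(lra)); lra.
  + intros eps He.
    destruct (cdiff_ccont _ _ (D C0 ltac:(rewrite Cnorm_C0; lra)) eps He) as (d & Hd & K).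
    exists d; split; [exact Hd|]; intros t Ht.
    specialize (K t ltac:(replace (Csub t C0) with t by ring; exact Ht)).
    cbv beta in K; rewrite E0 in K; rewrite pow_O, Rmult_1_r; left.
    replace (Csub (u (Cnadd z (Cnscal t v)) j) (u z j))
      with (Csub (Csub (u (Cnadd z (Cnscal t v)) j) (u z j)) (Csub (u z j) (u z j))) by ring.
    exact K.
  + rewrite Cnorm_C1; apply Rmult_le_reg_r with (nrm v); [exact h|].
    unfold Rdiv; rewrite Rmult_assoc, (Rmult_comm (/ 2)), <- Rmult_assoc, HT; lra.
Qed.

(** Differentiation lowers the order of vanishing by one; here this becomes a Lipschitz constant
    [O(rho^k)], obtained from the bound [C (5 rho)^(k+1)] on the ball five times larger. The gains
    of an order under composition rest on it. *)
Lemma big_O_lipschitz {n} (u : Map n) k :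
  holo_near0 u -> big_O (S k) u ->
  exists C r, 0 <= C /\ 0 < r /\ forall rho z w, rho < r -> nrm z <= rho -> nrm w <= rho ->
    nrm (Cnsub (u w) (u z)) <= C * rho ^ k * nrm (Cnsub w z).
Proof.
intros Hu (C & r & HC & Hr & HO); apply holo_near0_hol in Hu; destruct Hu as (R0 & HR & Hu).
assert (Hn := pos_INR n).
exists (2 * INR n * (C * 5 ^ S k)), (Rmin R0 r / 6).
assert (0 < 5 ^ S k) by (apply pow_lt; lra).
assert (0 < Rmin R0 r) by (apply Rmin_pos; assumption).
pose proof (Rmin_l R0 r); pose proof (Rmin_r R0 r).
split; [apply Rmult_le_pos; [lra|apply Rmult_le_pos; lra]|split; [lra|]].
intros rho z w Hrho Hz Hw; assert (Pz := nrm_ge0 z); assert (Pw := nrm_ge0 w).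
destruct (Rle_lt_dec rho 0) as [h|h].
- assert (E : z = w) by (rewrite (nrm_eq0 z), (nrm_eq0 w) by lra; reflexivity).
  subst w; replace (Cnsub (u z) (u z)) with (Cn0 n) by cn_ring.
  replace (Cnsub z z) with (Cn0 n) by cn_ring; rewrite nrm_Cn0; lra.
- eapply Rle_trans; [apply (hol_lipschitz u R0 rho (C * (5 * rho) ^ S k));
    try assumption; try lra|].
  + intros y Hy; assert (Py := nrm_ge0 y); eapply Rle_trans; [apply HO; lra|].
    apply Rmult_le_compat_l; [exact HC|apply pow_incr; lra].
  + right; rewrite Rpow_mult_distr.
    change (rho ^ S k) with (rho * rho ^ k); field; lra.
Qed.

(** Substitute for Taylor's formula: the order of vanishing of a holomorphic germ is an integer or
    infinite. *)
Lemma big_O_of_little_o {n} (u : Map n) k : holo_near0 u -> little_o k u -> big_O (S k) u.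
Proof.
intros Hu Ho; apply holo_near0_hol in Hu; destruct Hu as (R0 & HR & Hu).
destruct (Ho 1 Rlt_0_1) as (d & Hd & K).
set (R1 := Rmin 1 (Rmin R0 d)).
assert (HR1 : 0 < R1) by (repeat apply Rmin_pos; lra).
assert (M1 : R1 <= 1) by apply Rmin_l.
assert (M2 : R1 <= R0) by (eapply Rle_trans; [apply Rmin_r|apply Rmin_l]).
assert (M3 : R1 <= d) by (eapply Rle_trans; [apply Rmin_r|apply Rmin_r]).
assert (Hn := pos_INR n).
exists (INR n * (4 * 1 * (2 / R1) ^ S k)), (R1 / 4); split; [|split; [lra|]].
- apply Rmult_le_pos; [lra|apply Rmult_le_pos; [lra|]].
  apply pow_le; left; apply Rdiv_lt_0_compat; lra.
- intros z Hz; eapply Rle_trans; [apply (little_o_gain u R1 1 k); try assumption; try lra|].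
  + intros y Hy; apply Hu; lra.
  + intros y Hy; assert (Py := nrm_ge0 y); eapply Rle_trans; [apply K; lra|].
    rewrite Rmult_1_l, <- (pow1 k); apply pow_incr; lra.
  + right; replace (2 * nrm z / R1) with (2 / R1 * nrm z) by (field; lra).
    rewrite Rpow_mult_distr; ring.
Qed.

Lemma little_o_of_big_O {n} (u : Map n) k : big_O (S k) u -> little_o k u.
Proof.
intros (C & r & HC & Hr & H) eps He.
exists (Rmin r (eps / (C + 1))).
split; [apply Rmin_pos; [lra|apply Rdiv_lt_0_compat; lra]|]; intros z Hz.
assert (M1 := Rmin_l r (eps / (C + 1))); assert (M2 := Rmin_r r (eps / (C + 1))).
eapply Rle_trans; [apply H; lra|].
simpl; rewrite <- Rmult_assoc; apply Rmult_le_compat_r; [apply pow_le, nrm_ge0|].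
assert (Q : nrm z * (C + 1) < eps).
{ apply Rlt_le_trans with (eps / (C + 1) * (C + 1)).
  - apply Rmult_lt_compat_r; lra.
  - right; field; lra. }
assert (Pz := nrm_ge0 z); nra.
Qed.

(** On [|z| < R1 / 4] the bound of [little_o_gain] is a fixed constant times [(1/2)^(k+1)], for
    every [k]. *)
Lemma flat_holo_eq0 {n} (u : Map n) :
  holo_near0 u -> (forall k, big_O k u) ->
  exists r, 0 < r /\ forall z, nrm z < r -> u z = Cn0 n.
Proof.
intros Hu Ho; apply holo_near0_hol in Hu; destruct Hu as (R0 & HR & Hu).
destruct (Ho 0%nat) as (C & r & HC & Hr & K).
set (R1 := Rmin R0 r).
assert (HR1 : 0 < R1) by (apply Rmin_pos; lra).
assert (M2 : R1 <= R0) by apply Rmin_l; assert (M3 : R1 <= r) by apply Rmin_r.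
assert (Hn := pos_INR n).
exists (R1 / 4); split; [lra|]; intros z Hz.
assert (B : forall k, nrm (u z) <= INR n * (4 * C) * (/ 2) ^ S k).
{ intros k; eapply Rle_trans; [apply (little_o_gain u R1 C k); try assumption; try lra|].
  - intros y Hy; apply Hu; lra.
  - intros y Hy; specialize (K y ltac:(lra)); rewrite pow_O in K; lra.
  - apply little_o_of_big_O, Ho.
  - rewrite (Rmult_assoc (INR n)); apply Rmult_le_compat_l; [exact Hn|].
    apply Rmult_le_compat_l; [lra|]; apply pow_incr; assert (Pz := nrm_ge0 z); split.
    + apply Rdiv_le_0_compat; lra.
    + apply Rmult_le_reg_r with R1; [exact HR1|].
      unfold Rdiv; rewrite Rmult_assoc, Rinv_l; lra. }
apply nrm_eq0, Rle_plus_epsilon; intros eps He; rewrite Rplus_0_l.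
set (D := INR n * (4 * C)) in *.
assert (HD : 0 <= D) by (apply Rmult_le_pos; lra).
destruct (pow_lt_1_zero (/ 2) ltac:(rewrite Rabs_pos_eq; lra) (eps / (D + 1))) as [N HN].
{ apply Rdiv_lt_0_compat; lra. }
specialize (HN (S N) ltac:(lia)); rewrite Rabs_pos_eq in HN by (apply pow_le; lra).
eapply Rle_trans; [apply (B N)|].
apply Rle_trans with (D * (eps / (D + 1))); [apply Rmult_le_compat_l; lra|].
replace (D * (eps / (D + 1))) with (eps - eps / (D + 1)) by (field; lra).
assert (0 < eps / (D + 1)) by (apply Rdiv_lt_0_compat; lra); lra.
Qed.

Lemma Zprime_nat (p : nat) : prime (Z.of_nat p) ->
  (2 <= p)%nat /\ forall d k : nat, p = (k * d)%nat -> d = 1%nat \/ d = p.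
Proof.
intros Hp; split; [apply prime_ge_2 in Hp; lia|].
intros d k E; destruct (prime_divisors _ Hp (Z.of_nat d)) as [H|[H|[H|H]]]; try lia.
exists (Z.of_nat k); lia.
Qed.

Lemma Cmul_INR_0 z : Cmul (INR 0, 0) z = C0.
Proof. apply Cx_eq; simpl; ring. Qed.

Lemma Cmul_INR_S k z : Cmul (INR (S k), 0) z = Cadd z (Cmul (INR k, 0) z).
Proof. rewrite S_INR; apply Cx_eq; simpl; ring. Qed.

Lemma Cmul_INR_inv k z : Cmul (/ INR (S k), 0) (Cmul (INR (S k), 0) z) = z.
Proof.
assert (H : INR (S k) <> 0) by (apply not_0_INR; discriminate).
apply Cx_eq; unfold Cmul; cbn [fst snd]; field; exact H.
Qed.

Lemma Cmul_opp_C1 z : Cmul (Copp C1) z = Copp z.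
Proof. ring. Qed.

(** * Linear algebra and a Nakayama lemma *)

Module Algebra.

Import HB.structures.
Import mathcomp.boot.all_boot mathcomp.algebra.all_algebra.
Import mathcomp.field.all_field.
Import mathcomp.classical.boolp mathcomp.reals_stdlib.Rstruct mathcomp.real_closed.complex.
Set Implicit Arguments. Unset Strict Implicit. Unset Printing Implicit Defensive.
Import GRing.Theory Num.Theory.
Local Open Scope nat_scope.
Local Open Scope ring_scope.

(** Frobenius in [F_p[X]] gives the identity modulo [p], and [h] collects the quotients by [p] of
    the coefficients of the difference. *)
Lemma exp_1subX_prime_power (p e : nat) : prime p ->
  exists h : {poly int}, (1 - 'X) ^+ (p ^ e) = 1 - 'X^(p ^ e) + p%:Z *: h.
Proof.
move=> pr_p; set P := (1 - 'X) ^+ (p ^ e) - (1 - 'X^(p ^ e)) : {poly int}.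
have chF : p \in [pchar 'F_p] by apply: pchar_Fp.
have chP : p \in [pchar {poly 'F_p}] by rewrite pchar_lalg.
have P0 : map_poly (intr : int -> 'F_p) P = 0.
  rewrite /P !(rmorphB, rmorphXn, rmorph1) /= map_polyX.
  have -> : (1 - 'X : {poly 'F_p}) ^+ (p ^ e) = 1 - 'X^(p ^ e).
    have qn : [pchar {poly 'F_p}].-nat (p ^ e)%N by rewrite pnatX pnatE // chP.
    by rewrite exprDn_pchar // exprNn_pchar // expr1n.
  by rewrite subrr.
exists (\poly_(i < size P) (P`_i %/ p%:Z)%Z).
apply/eqP; rewrite -subr_eq0 opprD addrA subr_eq0; apply/eqP/polyP => i.
rewrite coefZ coef_poly -/P; case: ltnP => [_|/(nth_default 0) ->]; last by rewrite mulr0.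
rewrite mulrC divzK // (dvdz_pcharf chF) -(coef_map (intr : int -> 'F_p)) P0 coef0.
by [].
Qed.

Lemma coprime_Xn_sub_1 (p e : nat) (d : {poly int}) : prime p -> d.[1] = 1 ->
  forall x : algC, x ^+ (p ^ e) = 1 -> ~~ root (map_poly intr d) x.
Proof.
move=> pr_p d1 x xq; apply/negP => /rootP dx0.
have Ax : x \in Aint.
  by apply: (@Aint_unity_root (p ^ e)); rewrite ?expn_gt0 ?prime_gt0 //; apply/unity_rootP.
have Apoly (g : {poly int}) : (map_poly intr g).[x] \in Aint.
  rewrite horner_poly; apply: rpred_sum => i _.
  by rewrite rpredM ?rpredX // Aint_int.
(* Since [d - 1] vanishes at 1, it equals [g (X - 1)]; at a root [x] of [d] this makes [g x] the
   inverse of [1 - x]. *)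
have /factor_theorem [g Dg] : root (d - 1) 1 by rewrite /root !hornerE d1 subrr.
have [h Dh] := exp_1subX_prime_power e pr_p.
have E1 : (1 - x) * (map_poly intr g).[x] = 1.
  move: dx0; have -> : d = g * ('X - 1%:P) + 1 by rewrite -Dg subrK.
  rewrite rmorphD rmorphM /= map_polyXsubC !rmorph1 !hornerE /=.
  by move/eqP; rewrite addr_eq0 => /eqP H; rewrite -[1 - x]opprB mulNr mulrC H opprK.
have E2 : (1 - x) ^+ (p ^ e) = p%:R * (map_poly intr h).[x].
  have := congr1 (fun P : {poly int} => (map_poly (intr : int -> algC) P).[x]) Dh.
  rewrite rmorphXn !rmorphD !rmorphN !rmorph1 /= map_polyX map_polyXn map_polyZ !hornerE.
  by rewrite xq subrr add0r.
have E3 : p%:R^-1 = (map_poly intr h).[x] * (map_poly intr g).[x] ^+ (p ^ e) :> algC.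
  have p0 : p%:R != 0 :> algC by rewrite pnatr_eq0 -lt0n prime_gt0.
  apply: (mulfI p0); rewrite mulfV // mulrA -E2 -exprMn E1 expr1n //.
(* A rational algebraic integer is an integer, and [1 / p] is not one. *)
have : (p%:R^-1 : algC) \in Num.int.
  apply: Cint_rat_Aint; first by rewrite rpredV rpred_nat.
  by rewrite E3 rpredM ?rpredX.
rewrite -[p%:R]/(p%:Z%:~R) => /intrP [k Hk].
have : (p%:Z * k)%:~R = 1 :> algC.
  by rewrite intrM -Hk mulfV // pnatr_eq0 -lt0n prime_gt0.
move/eqP; rewrite -[1]/(1%:~R) eqr_int => /eqP H.
have := prime_gt1 pr_p.
have /(congr1 absz) := H; rewrite abszM /= => /eqP; rewrite muln_eq1 => /andP[/eqP -> _].
by [].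
Qed.

(** Coprimality over [rat] is tested on roots in [algC]; [N] is the product of the denominators of
    the two rational cofactors. *)
Lemma bezout_int (p e : nat) (d : {poly int}) : prime p -> d.[1] = 1 ->
  exists (a b : {poly int}) (N : int), N != 0 /\ a * d + b * ('X^(p ^ e) - 1) = N%:P.
Proof.
move=> pr_p d1.
set f := (map_poly (intr : int -> rat)); set g := 'X^(p ^ e) - 1 : {poly int}.
have : coprimep (f d) (f g).
  rewrite -(coprimep_map (ratr : rat -> algC)) /f -!map_poly_comp.
  have E (P : {poly int}) : map_poly ((ratr : rat -> algC) \o intr) P = map_poly intr P.
    by apply: eq_map_poly => z /=; rewrite ratr_int.
  rewrite !E coprimep_sym; apply: Pdiv.ClosedField.root_coprimep => x rg.
  have xq : x ^+ (p ^ e) = 1.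
    move: rg; rewrite /g rmorphB rmorph1 /= map_polyXn /root !hornerE.
    by rewrite subr_eq0 => /eqP.
  exact: coprime_Xn_sub_1 pr_p d1 _ xq.
move/Bezout_eq1_coprimepP => [[u v] /= uv1].
have [[a [na na0 Ea]] [b [nb nb0 Eb]]] := (rat_poly_scale u, rat_poly_scale v).
exists (nb *: a), (na *: b), (na * nb); split; first by rewrite mulf_neq0.
have inj : injective f by apply: map_inj_poly => //; exact: intr_inj.
apply: inj; rewrite /f rmorphD !rmorphM /= !map_polyZ map_polyC /=.
rewrite -/f; move: uv1; rewrite Ea Eb -!scalerAl.
have na0' : na%:~R != 0 :> rat by rewrite intr_eq0.
have nb0' : nb%:~R != 0 :> rat by rewrite intr_eq0.
move/(congr1 (fun P => (na * nb)%:~R *: P)).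
rewrite scalerDr !scalerA intrM alg_polyC => H.
rewrite [f nb%:P]map_polyC -polyCM /= -H.
by rewrite [_ * _ / na%:~R]mulrAC mulfV // mul1r -[_ / nb%:~R]mulrA mulfV // mulr1.
Qed.

(** * The action of [Z[X]] and a Nakayama lemma *)

Section PolynomialAction.
Variables (W : zmodType) (s : {additive W -> W}).

(** Makes [W] a [Z[X]]-module in which ['X] acts as [s]. *)
Definition pact (p : {poly int}) (x : W) : W := \sum_(i < size p) iter i s x *~ p`_i.

Lemma pact_widen N (p : {poly int}) x : (size p <= N)%N ->
  pact p x = \sum_(i < N) iter i s x *~ p`_i.
Proof.
move=> leN; rewrite /pact (big_ord_widen N (fun i => iter i s x *~ p`_i)) // big_mkcond /=.
by apply: eq_bigr => i _; case: ltnP => // /(nth_default 0) ->; rewrite mulr0z.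
Qed.

Lemma pactD p q x : pact (p + q) x = pact p x + pact q x.
Proof.
set N := maxn (size p) (size q).
rewrite (@pact_widen N (p + q)) ?size_polyD // (@pact_widen N p) ?leq_maxl //.
rewrite (@pact_widen N q) ?leq_maxr // -big_split /=.
by apply: eq_bigr => i _; rewrite coefD mulrzDr.
Qed.

Lemma pactCM c p x : pact (c%:P * p) x = pact p x *~ c.
Proof.
rewrite (@pact_widen (size p)); last by rewrite mul_polyC size_scale_leq.
rewrite /pact mulrz_suml; apply: eq_bigr => i _.
by rewrite coefCM mulrC mulrzA.
Qed.

Lemma pact1 x : pact 1 x = x.
Proof. by rewrite /pact size_poly1 big_ord1 coef1 /= mulr1z. Qed.

Lemma pactC c x : pact c%:P x = x *~ c.
Proof. by rewrite -[c%:P]mulr1 pactCM pact1. Qed.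

Lemma pactN p x : pact (- p) x = - pact p x.
Proof. by rewrite -mulN1r -polyCN pactCM mulrNz mulr1z. Qed.

Lemma pactMX p x : pact (p * 'X) x = s (pact p x).
Proof.
rewrite (@pact_widen (size p).+1); last first.
  by have [->|p0] := eqVneq p 0; rewrite ?mul0r ?size_poly0 // size_mulX.
rewrite big_ord_recl coefMX /= mulr0z add0r /pact raddf_sum.
by apply: eq_bigr => i _; rewrite coefMX /= raddfMz.
Qed.

Lemma pactXn n x : pact 'X^n x = iter n s x.
Proof.
elim: n => [|n IH]; first by rewrite expr0 pact1.
by rewrite exprSr pactMX IH.
Qed.

Lemma iter_additiveD n x y : iter n s (x + y) = iter n s x + iter n s y.
Proof. by elim: n => //= n ->; rewrite raddfD. Qed.

Lemma pactDr p x y : pact p (x + y) = pact p x + pact p y.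
Proof.
rewrite /pact -big_split /=; apply: eq_bigr => i _.
by rewrite iter_additiveD mulrzDl.
Qed.

Lemma pact0r p : pact p 0 = 0.
Proof. by apply: (addrI (pact p 0)); rewrite -pactDr !addr0. Qed.

Lemma pact_sum (J : Type) (r : seq J) p (F : J -> W) :
  pact p (\sum_(j <- r) F j) = \sum_(j <- r) pact p (F j).
Proof. exact: (big_morph (pact p) (pactDr p) (pact0r p)). Qed.

Lemma pactM p q x : pact (p * q) x = pact p (pact q x).
Proof.
elim/poly_ind: p => [|p c IH]; first by rewrite mul0r -polyC0 !pactC !mulr0z.
by rewrite mulrDl !pactD pactCM pactC mulrAC !pactMX IH.
Qed.

(** [I] is the submodule of negligible elements, kept as a predicate so that no quotient is formed;
    closure under division by nonzero integers absorbs the [N] of [bezout_int]. *)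
Variable I : W -> Prop.
Hypotheses (I0 : I 0) (ID : forall x y, I x -> I y -> I (x + y)) (IN : forall x, I x -> I (- x)).
Hypothesis Is : forall x, I x -> I (s x).
Hypothesis Itors : forall x (N : int), N != 0 -> I (x *~ N) -> I x.

Lemma I_sum (J : Type) (r : seq J) (F : J -> W) :
  (forall j, I (F j)) -> I (\sum_(j <- r) F j).
Proof. by move=> H; apply: big_ind. Qed.

Lemma I_pact p x : I x -> I (pact p x).
Proof.
elim/poly_ind: p x => [|p c IH] x Ix; first by rewrite -polyC0 pactC mulr0z.
rewrite pactD pactMX pactC; apply: ID; first by apply: Is; apply: IH.
case: c => n; last rewrite NegzE mulrNz; last apply: IN; rewrite -pmulrn.
  by elim: n => [|n IHn]; rewrite ?mulr0n // mulrS; apply: ID.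
by elim: n.+1 => [|k IHn]; rewrite ?mulr0n // mulrS; apply: ID.
Qed.

(* The determinant [d] of [1 - (1 - X) B] kills every [u i] modulo [I] and satisfies [d(1) = 1],
   hence is invertible together with [X^(p^e) - 1] up to a nonzero integer. *)
Lemma unipotent_nakayama (p e m : nat) (u : 'I_m -> W) :
  prime p -> (forall i, iter (p ^ e) s (u i) = u i) ->
  (forall i, exists b : 'I_m -> {poly int},
     let c := \sum_j pact (b j) (u j) in I (u i - (c - s c))) ->
  forall i, I (u i).
Proof.
move=> pr_p su /fin_all_exists[b Hb].
pose M : 'M[{poly int}]_m := 1%:M - (1 - 'X) *: \matrix_(i, j) b i j.
have HM i : I (\sum_j pact (M i j) (u j)).
  suff -> : \sum_j pact (M i j) (u j) =
    u i - (\sum_j pact (b i j) (u j) - s (\sum_j pact (b i j) (u j))) by apply: Hb.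
  rewrite raddf_sum -sumrB -[X in _ = X - _](_ : \sum_j pact (1%:M i j) (u j) = u i).
    rewrite -sumrB; apply: eq_bigr => j _.
    by rewrite !mxE pactD pactN mulrBl mul1r pactD pactN mulrC pactMX.
  rewrite (bigD1 i) //= mxE eqxx pact1 big1 ?addr0 // => j ji.
  by rewrite mxE eq_sym (negbTE ji) ?mulr0n -polyC0 pactC mulr0z.
pose d := \det M.
have Hd k : I (pact d (u k)).
  (* Cramer's rule: the adjugate of [M] combines the relations [HM] into the action of [d] on
     [u k]. *)
  have -> : pact d (u k) = \sum_i pact (\adj M k i) (\sum_j pact (M i j) (u j)).
    transitivity (\sum_j pact ((\adj M *m M) k j) (u j)).
      rewrite mul_adj_mx (bigD1 k) //= mxE eqxx mulr1n big1 ?addr0 // => j jk.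
      by rewrite mxE eq_sym (negbTE jk) mulr0n -polyC0 pactC mulr0z.
    under [RHS]eq_bigr => i _ do rewrite pact_sum.
    rewrite exchange_big /=; apply: eq_bigr => j _.
    rewrite mxE (big_morph (fun q => pact q (u j)) (id1 := 0) (op1 := +%R)).
    - by apply: eq_bigr => i _; rewrite pactM.
    - by move=> q r; rewrite pactD.
    - by rewrite -polyC0 pactC mulr0z.
  by apply: I_sum => i; apply: I_pact; apply: HM.
(* At [X = 1] the matrix [M] becomes the identity. *)
have d1 : d.[1] = 1.
  rewrite /d -[_.[1]]/(horner_eval 1 (\det M)) -det_map_mx.
  suff -> : map_mx (horner_eval 1) M = 1%:M by rewrite det1.
  apply/matrixP => i j; rewrite !mxE /horner_eval !hornerE.
  by case: (i == j); rewrite ?hornerE.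
have [a [b' [N [N0 E]]]] := bezout_int e pr_p d1.
move=> i; apply: (Itors N0); rewrite -pactC -E pactD !pactM.
apply: ID; first by apply: I_pact; apply: Hd.
by rewrite pactD pactXn su pactN pact1 subrr pact0r.
Qed.

End PolynomialAction.

(** The minimal polynomial divides [X^m - 1], whose roots are distinct because [m] is invertible in
    [F]. *)
Lemma finite_order_diagonalizable (F : closedFieldType) n (A : 'M[F]_n) m :
  m%:R != 0 :> F -> A ^+ m = 1 ->
  exists P D, P \in unitmx /\ P *m A = diag_mx D *m P.
Proof.
case: n A => [|n] A m0 Am.
  exists 1%:M, 0; split; first exact: unitmx1.
  by apply/matrixP => -[].
suff /diagonalizableP [P uP /diagonalizable_forPex[D /(simmxP uP) E]] :
  exists2 rs, uniq rs & mxminpoly A %| \prod_(x <- rs) ('X - x%:P) by exists P, D.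
have m_gt0 : (0 < m)%N by case: m m0 {Am} => //; rewrite eqxx.
have [rs] := closed_field_poly_normal ('X^m - 1 : {poly F}).
have -> : lead_coef ('X^m - 1 : {poly F}) = 1.
  by apply/eqP; rewrite -[_ == _]/(_ \is monic) -polyC1 monicXnsubC.
rewrite scale1r => E; exists rs.
  by rewrite -separable_prod_XsubC -E separable_Xn_sub_1.
rewrite -E; apply: mxminpoly_min.
by rewrite rmorphB rmorph1 rmorphXn /= horner_mx_X Am subrr.
Qed.

(** * Dictionary between [Mat n] and matrices over [K] *)

Definition K : closedFieldType := complex Rdefinitions.R.
Definition toK (z : Cx) : K := Complex z.1 z.2.
Definition ofK (z : K) : Cx := let: Complex a b := z in (a, b).

Lemma toKK : cancel toK ofK. Proof. by case. Qed.
Lemma ofKK : cancel ofK toK. Proof. by case. Qed.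
Lemma toKD z w : toK (Cadd z w) = toK z + toK w. Proof. by []. Qed.
Lemma toKM z w : toK (Cmul z w) = toK z * toK w. Proof. by []. Qed.
Lemma toK0 : toK Defs.C0 = 0. Proof. by []. Qed.

Fixpoint ord_of_fin n (i : Fin.t n) : 'I_n :=
  match i with
  | Fin.F1 _ => ord0
  | Fin.FS _ j => lift ord0 (ord_of_fin j)
  end.

Fixpoint fin_of_ord n : 'I_n -> Fin.t n :=
  match n with
  | 0 => fun i => False_rect _ (notF (ltn_ord i))
  | m.+1 => fun i => if unlift ord0 i is Some j then Fin.FS (fin_of_ord j) else Fin.F1
  end.

Lemma fin_of_ordK n : cancel (@fin_of_ord n) (@ord_of_fin n).
Proof.
elim: n => [[]//|n IH] i /=.
by case: unliftP => [j ->|->] //=; rewrite IH.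
Qed.

Lemma ord_of_finK n : cancel (@ord_of_fin n) (@fin_of_ord n).
Proof.
by move=> i; elim: i => [m|m j IH] /=; rewrite ?unlift_none // liftK IH.
Qed.

Lemma toK_Csum n (f : Fin.t n -> Cx) :
  toK (Csum n f) = \sum_(i < n) toK (f (fin_of_ord i)).
Proof.
elim: n f => [|n IH] f; first by rewrite big_ord0.
rewrite Csum_S toKD IH big_ord_recl /= unlift_none; congr (_ + _).
by apply: eq_bigr => i _; rewrite liftK.
Qed.

Definition mx_of n (M : Mat n) : 'M[K]_n := \matrix_(i, j) toK (M (fin_of_ord i) (fin_of_ord j)).
Definition of_mx n (M : 'M[K]_n) : Mat n := fun i j => ofK (M (ord_of_fin i) (ord_of_fin j)).
Definition cv_of n (v : Cn n) : 'cV[K]_n := \col_i toK (v (fin_of_ord i)).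

Lemma of_mxK n : cancel (@of_mx n) (@mx_of n).
Proof. by move=> M; apply/matrixP => i j; rewrite mxE /of_mx !fin_of_ordK ofKK. Qed.

Lemma cv_of_inj n : injective (@cv_of n).
Proof.
move=> v w /matrixP E; apply: Cn_ext => i.
have := E (ord_of_fin i) 0; rewrite !mxE ord_of_finK => H.
by rewrite -[LHS]toKK H toKK.
Qed.

Lemma cv_of_matvec n (M : Mat n) v : cv_of (matvec M v) = mx_of M *m cv_of v.
Proof.
apply/matrixP => i j; rewrite !mxE toK_Csum; apply: eq_bigr => k _.
by rewrite toKM !mxE.
Qed.

Lemma mx_of_ext n (M N : 'M[K]_n) : (forall v, M *m cv_of v = N *m cv_of v) -> M = N.
Proof.
move=> H; apply/matrixP => i j.
have E (w : 'cV[K]_n) : cv_of (fun i => ofK (w (ord_of_fin i) 0)) = w.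
  by apply/matrixP => a b; rewrite mxE fin_of_ordK ofKK ord1.
have := congr1 (fun w : 'cV_n => w i 0)
  (H (fun k => ofK ((delta_mx j 0 : 'cV[K]_n) (ord_of_fin k) 0))).
by rewrite !E -!colE !mxE.
Qed.

Lemma mx_of_matpow n (A : Mat n) k : mx_of (matpow A k) = mx_of A ^+ k.
Proof.
apply: mx_of_ext => v; rewrite -cv_of_matvec; elim: k v => [|k IH] v.
  by rewrite expr0 /= matvec_matid mul1mx.
by rewrite matvec_matpow_S cv_of_matvec IH exprS -mulmxE mulmxA.
Qed.

Lemma mat_diagonalize n (A : Mat n) (m : nat) : (0 < m)%coq_nat ->
  (forall v, matvec (matpow A m) v = v) ->
  exists (P Q : Mat n) (xi : Fin.t n -> Cx),
    (forall v, matvec P (matvec Q v) = v) /\ (forall v, matvec Q (matvec P v) = v) /\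
    (forall v, matvec P (matvec A v) = diag_map xi (matvec P v)).
Proof.
move=> /ssrnat.ltP m_gt0 Am.
have Am1 : mx_of A ^+ m = 1.
  rewrite -mx_of_matpow; apply: mx_of_ext => v.
  by rewrite -cv_of_matvec Am mul1mx.
have m0 : m%:R != 0 :> K by rewrite pnatr_eq0 -lt0n.
have [P [D [uP E]]] := finite_order_diagonalizable m0 Am1.
exists (of_mx P), (of_mx (invmx P)), (fun i => ofK (D 0 (ord_of_fin i))).
split; [|split] => v; apply: cv_of_inj; rewrite ?cv_of_matvec ?of_mxK.
- by rewrite mulKVmx.
- by rewrite mulKmx.
- rewrite mulmxA E -mulmxA -[P]of_mxK -cv_of_matvec of_mxK.
  apply/matrixP => i j; rewrite mul_diag_mx !mxE toKM; congr (_ * _).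
  by rewrite fin_of_ordK ofKK.
Qed.

Lemma mat_injective_inverse n (M : Mat n) :
  (forall v, matvec M v = Cn0 n -> v = Cn0 n) ->
  exists N : Mat n, (forall v, matvec M (matvec N v) = v) /\ (forall v, matvec N (matvec M v) = v).
Proof.
move=> injM.
have uM : mx_of M \in unitmx.
  (* [kermx] consists of row vectors, so invertibility is tested on the transpose. *)
  rewrite -unitmx_tr -row_free_unit -kermx_eq0; apply/eqP/row_matrixP => i.
  rewrite row0; set w := row i _.
  have wM : w *m (mx_of M)^T = 0 by apply/sub_kermxP; rewrite row_sub.
  clearbody w.
  pose v : Cn n := fun k => ofK (w 0 (ord_of_fin k)).
  have Ev : cv_of v = w^T by apply/matrixP => a b; rewrite !mxE /v fin_of_ordK ofKK ord1.
  have Mv : matvec M v = Cn0 n.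
    apply: cv_of_inj; rewrite cv_of_matvec Ev -[mx_of M]trmxK -trmx_mul wM.
    by apply/matrixP => a b; rewrite !mxE.
  apply: trmx_inj; rewrite -Ev (injM v Mv); apply/matrixP => a b; rewrite !mxE.
  by rewrite toK0.
exists (of_mx (invmx (mx_of M))); split=> v; apply: cv_of_inj; rewrite !cv_of_matvec of_mxK.
- by rewrite mulKVmx.
- by rewrite mulKmx.
Qed.

Lemma prime_of_Zprime p : Znumtheory.prime (BinInt.Z.of_nat p) -> prime p.
Proof.
move=> /Zprime_nat [/ssrnat.leP p_gt1 H]; apply/primeP; split=> // d /dvdnP [k Ep].
by case: (H d k Ep) => ->; rewrite eqxx ?orbT.
Qed.

(** Carries the additive group structure of all maps [C^n -> C^n], with exact equality: germs and
    orders of vanishing enter only through the submodule [I]. *)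
Definition mapW (n : nat) : Type := Map n.

Section MapModule.
Variable n : nat.

HB.instance Definition _ := gen_eqMixin (mapW n).
HB.instance Definition _ := gen_choiceMixin (mapW n).

Definition mapW_zero : mapW n := fun _ => Cn0 n.
Definition mapW_add (f g : mapW n) : mapW n := fun z => Cnadd (f z) (g z).
Definition mapW_opp (f : mapW n) : mapW n := fun z i => Copp (f z i).

Lemma mapW_eq (f g : mapW n) : (forall z i, f z i = g z i) -> f = g.
Proof. by move=> H; apply: funext => z; apply: Cn_ext => i; apply: H. Qed.

Lemma mapW_addA : associative mapW_add.
Proof.
move=> f g h; apply: mapW_eq => z i; rewrite /mapW_add /Cnadd.
exact: (Ring_theory.Radd_assoc Cx_ring_theory).
Qed.

Lemma mapW_addC : commutative mapW_add.
Proof.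
move=> f g; apply: mapW_eq => z i; rewrite /mapW_add /Cnadd.
exact: (Ring_theory.Radd_comm Cx_ring_theory).
Qed.

Lemma mapW_add0 : left_id mapW_zero mapW_add.
Proof. by move=> f; apply: mapW_eq => z i; exact: (Ring_theory.Radd_0_l Cx_ring_theory). Qed.

Lemma mapW_addN : left_inverse mapW_zero mapW_opp mapW_add.
Proof.
move=> f; apply: mapW_eq => z i; rewrite /mapW_add /Cnadd (Ring_theory.Radd_comm Cx_ring_theory).
exact: (Ring_theory.Ropp_def Cx_ring_theory).
Qed.

HB.instance Definition _ :=
  GRing.isZmodule.Build (mapW n) mapW_addA mapW_addC mapW_add0 mapW_addN.

End MapModule.

Section Span.
Variables (n : nat) (s : Map n -> Map n) (us : list (Map n)).

(** The [Z[s]]-submodule [L]. That complex multiples are absent is essential: it makes the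
    coefficients found in [span_nakayama] integer polynomials. *)
Inductive span : Map n -> Prop :=
| span_gen u : List.In u us -> span u
| span_zero : span (fun _ => Cn0 n)
| span_add f g : span f -> span g -> span (fun z => Cnadd (f z) (g z))
| span_opp f : span f -> span (fun z i => Copp (f z i))
| span_act f : span f -> span (s f).

End Span.

(** An instance of [unipotent_nakayama]. Closure of [I] under complex multiples yields both
    opposites and division by nonzero integers. *)
Lemma span_nakayama n (s : Map n -> Map n) (us : list (Map n)) (I : Map n -> Prop) (p e : nat) :
  Znumtheory.prime (BinInt.Z.of_nat p) ->
  (forall f g, s (fun z => Cnsub (f z) (g z)) = (fun z => Cnsub (s f z) (s g z))) ->
  (forall u, List.In u us -> Nat.iter (Nat.pow p e) s u = u) ->
  I (fun _ => Cn0 n) ->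
  (forall f g, I f -> I g -> I (fun z => Cnadd (f z) (g z))) ->
  (forall f c, I f -> I (fun z => Cnscal c (f z))) ->
  (forall f, I f -> I (s f)) ->
  (forall u, List.In u us -> exists c, span s us c /\
     I (fun z => Cnsub (u z) (Cnsub (c z) (s c z)))) ->
  forall u, List.In u us -> I u.
Proof.
move=> /prime_of_Zprime pr_p sB su I0 ID IZ Is H.
have sA : GRing.zmod_morphism (s : mapW n -> mapW n) by exact: sB.
pose sW : {additive mapW n -> mapW n} :=
  HB.pack (s : mapW n -> mapW n) (GRing.isZmodMorphism.Build _ _ _ sA).
set m := List.length us.
pose u (i : 'I_m) : mapW n := List.nth i us (fun _ => Cn0 n).
have uin i : List.In (u i) us by apply: List.nth_In; apply/ssrnat.ltP.
have inu f : List.In f us -> exists i, f = u i.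
  move=> /(@List.In_nth _ _ _ (fun _ => Cn0 n)) [k [/ssrnat.ltP lk <-]].
  by exists (Ordinal lk).
have IN f : I f -> I (- (f : mapW n)).
  move=> /(IZ _ (Copp Defs.C1)); congr I; apply: mapW_eq => z i.
  exact: Cmul_opp_C1.
have powE : (p ^ e)%N = Nat.pow p e by elim: e {su} => //= e <-; rewrite expnS.
have spanE f : span s us f -> exists b : 'I_m -> {poly int},
    f = \sum_j pact sW (b j) (u j) :> mapW n.
  elim=> {f} [f /inu [i ->]||f g _ [b Eb] _ [c Ec]|f _ [b Eb]|f _ [b Eb]].
  - exists (fun j => (j == i)%:R); rewrite (bigD1 i) //= eqxx pact1 big1 ?addr0 // => j /negbTE ->.
    by rewrite mulr0n -polyC0 pactC mulr0z.
  - by exists (fun _ => 0); rewrite big1 // => j _; rewrite -polyC0 pactC mulr0z.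
  - exists (fun j => b j + c j); rewrite (_ : (fun z => _) = (f : mapW n) + g) // Eb Ec.
    by rewrite -big_split; apply: eq_bigr => j _; rewrite pactD.
  - exists (fun j => - b j); rewrite (_ : (fun z => _) = - (f : mapW n)) // Eb.
    by rewrite -sumrN; apply: eq_bigr => j _; rewrite pactN.
  - exists (fun j => b j * 'X); rewrite Eb -[s _]/(sW _) raddf_sum.
    by apply: eq_bigr => j _; rewrite pactMX.
have mulrnE (f : mapW n) k :
  f *+ k = (fun z => Cnscal (Raxioms.INR k, Rdefinitions.IZR BinNums.Z0) (f z)).
  elim: k => [|k IH]; apply: mapW_eq => z i.
    by rewrite mulr0n /Cnscal Cmul_INR_0.
  by rewrite mulrS -[LHS]/(Cadd (f z i) ((f *+ k) z i)) IH /Cnscal Cmul_INR_S.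
have Itorsn (f : mapW n) k : I (f *+ k.+1) -> I f.
  rewrite mulrnE => /(IZ _ (Rdefinitions.Rinv (Raxioms.INR k.+1), Rdefinitions.IZR BinNums.Z0)).
  congr I; apply: mapW_eq => z i; rewrite /Cnscal.
  exact: Cmul_INR_inv.
have Itors (f : mapW n) (N : int) : N != 0 -> I (f *~ N) -> I f.
  case: N => [[|k]|k] // _; first by rewrite -pmulrn; apply: Itorsn.
  by rewrite NegzE mulrNz -pmulrn => /IN; rewrite opprK; apply: Itorsn.
move=> f /inu [i ->].
apply: (@unipotent_nakayama (mapW n) sW I I0 ID IN Is Itors p e m u pr_p) => {}i.
  have := su _ (uin i); rewrite -powE => Ei; rewrite -[RHS]Ei.
  by elim: (p ^ e)%N => //= k ->.
have [c [/spanE [b Eb] Ic]] := H _ (uin i).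
by exists b; rewrite -Eb.
Qed.

End Algebra.
Import Algebra.

(** * Calculus of holomorphic germs *)

Lemma has_cderiv_add {n} (F G : Map n) z M N :
  has_cderiv F z M -> has_cderiv G z N ->
  has_cderiv (fun w => Cnadd (F w) (G w)) z (matadd M N).
Proof.
rewrite 3!has_cderiv_nrm; intros HF HG eps He.
destruct (HF (eps / 2)) as (d1 & Hd1 & K1); [lra|].
destruct (HG (eps / 2)) as (d2 & Hd2 & K2); [lra|].
exists (Rmin d1 d2); split; [apply Rmin_pos; lra|]; intros h Hh.
pose proof (Rmin_l d1 d2); pose proof (Rmin_r d1 d2).
specialize (K1 h ltac:(lra)); specialize (K2 h ltac:(lra)).
rewrite matvec_matadd.
match goal with |- nrm ?x <= _ => replace x with
  (Cnadd (Cnsub (Cnsub (F (Cnadd z h)) (F z)) (matvec M h))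
         (Cnsub (Cnsub (G (Cnadd z h)) (G z)) (matvec N h))) by cn_ring end.
eapply Rle_trans; [apply nrm_add|]; lra.
Qed.

Lemma has_cderiv_matvec_comp {n} (F : Map n) z M N :
  has_cderiv F z N -> has_cderiv (fun w => matvec M (F w)) z (matmul M N).
Proof.
rewrite 2!has_cderiv_nrm; intros HF eps He; assert (Hm := mat_norm_ge0 M).
destruct (HF (eps / (mat_norm M + 1))) as (d & Hd & K); [apply Rdiv_lt_0_compat; lra|].
exists d; split; [exact Hd|]; intros h Hh; specialize (K h Hh).
rewrite matvec_matmul, <- 2!matvec_sub.
eapply Rle_trans; [apply nrm_matvec|].
apply Rle_trans with (mat_norm M * (eps / (mat_norm M + 1) * nrm h)).
- apply Rmult_le_compat_l; assumption.
- assert (Q := nrm_ge0 h).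
  replace (mat_norm M * (eps / (mat_norm M + 1) * nrm h))
    with (eps * nrm h - eps * nrm h / (mat_norm M + 1)) by (field; lra).
  assert (0 <= eps * nrm h / (mat_norm M + 1)) by (apply Rdiv_le_0_compat; nra); lra.
Qed.

Lemma has_cderiv_comp_matvec {n} (F : Map n) z M N :
  has_cderiv F (matvec M z) N -> has_cderiv (fun w => F (matvec M w)) z (matmul N M).
Proof.
rewrite 2!has_cderiv_nrm; intros HF eps He; assert (Hm := mat_norm_ge0 M).
destruct (HF (eps / (mat_norm M + 1))) as (d & Hd & K); [apply Rdiv_lt_0_compat; lra|].
exists (d / (mat_norm M + 1)); split; [apply Rdiv_lt_0_compat; lra|]; intros h Hh.
assert (Q := nrm_ge0 h); assert (B := nrm_matvec M h).
assert (Hb : nrm h * (mat_norm M + 1) < d).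
{ apply (Rmult_lt_compat_r (mat_norm M + 1)) in Hh; [|lra].
  unfold Rdiv in Hh; rewrite Rmult_assoc, Rinv_l, Rmult_1_r in Hh; lra. }
specialize (K (matvec M h) ltac:(nra)).
rewrite matvec_matmul, matvec_add.
eapply Rle_trans; [exact K|].
apply Rle_trans with (eps / (mat_norm M + 1) * (mat_norm M * nrm h)).
- apply Rmult_le_compat_l; [left; apply Rdiv_lt_0_compat; lra|exact B].
- replace (eps / (mat_norm M + 1) * (mat_norm M * nrm h))
    with (eps * nrm h - eps * nrm h / (mat_norm M + 1)) by (field; lra).
  assert (0 <= eps * nrm h / (mat_norm M + 1)) by (apply Rdiv_le_0_compat; nra); lra.
Qed.

Lemma has_cderiv_matvec {n} (M : Mat n) z : has_cderiv (matvec M) z M.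
Proof.
apply has_cderiv_nrm; intros eps He; exists 1; split; [lra|]; intros h _.
replace (Cnsub (Cnsub (matvec M (Cnadd z h)) (matvec M z)) (matvec M h)) with (Cn0 n)
  by (rewrite matvec_add; cn_ring).
rewrite nrm_Cn0; apply Rmult_le_pos; [lra|apply nrm_ge0].
Qed.

Lemma holo_add {n} (F G : Map n) :
  holo_near0 F -> holo_near0 G -> holo_near0 (fun z => Cnadd (F z) (G z)).
Proof.
rewrite 3!holo_near0_hol; intros (r & Hr & HF) (s & Hs & HG).
exists (Rmin r s); split; [apply Rmin_pos; lra|]; intros z Hz.
pose proof (Rmin_l r s); pose proof (Rmin_r r s).
destruct (HF z) as [M HM]; [lra|]; destruct (HG z) as [N HN]; [lra|].
exists (matadd M N); apply has_cderiv_add; assumption.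
Qed.

Lemma holo_matvec_comp {n} M (F : Map n) : holo_near0 F -> holo_near0 (fun z => matvec M (F z)).
Proof.
intros (r & Hr & HF); exists r; split; [exact Hr|]; intros z Hz.
destruct (HF z Hz) as [N HN]; exists (matmul M N); apply has_cderiv_matvec_comp, HN.
Qed.

Lemma holo_comp_matvec {n} M (F : Map n) : holo_near0 F -> holo_near0 (fun z => F (matvec M z)).
Proof.
rewrite 2!holo_near0_hol; intros (r & Hr & HF); assert (Hm := mat_norm_ge0 M).
exists (r / (mat_norm M + 1)); split; [apply Rdiv_lt_0_compat; lra|]; intros z Hz.
assert (Q := nrm_ge0 z); assert (B := nrm_matvec M z).
assert (Hb : nrm z * (mat_norm M + 1) < r).
{ apply (Rmult_lt_compat_r (mat_norm M + 1)) in Hz; [|lra].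
  unfold Rdiv in Hz; rewrite Rmult_assoc, Rinv_l, Rmult_1_r in Hz; lra. }
destruct (HF (matvec M z)) as [N HN]; [nra|].
exists (matmul N M); apply has_cderiv_comp_matvec, HN.
Qed.

Lemma holo_matvec {n} (M : Mat n) : holo_near0 (matvec M).
Proof. exists 1; split; [lra|]; intros z _; exists M; apply has_cderiv_matvec. Qed.

Lemma holo_scal {n} c (F : Map n) : holo_near0 F -> holo_near0 (fun z => Cnscal c (F z)).
Proof.
intros HF; replace (fun z => Cnscal c (F z)) with (fun z => matvec (matscal c (matid n)) (F z)).
- apply holo_matvec_comp, HF.
- apply functional_extensionality; intros z; rewrite matvec_matscal, matvec_matid; reflexivity.
Qed.

Lemma holo_sub {n} (F G : Map n) :
  holo_near0 F -> holo_near0 G -> holo_near0 (fun z => Cnsub (F z) (G z)).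
Proof.
intros HF HG; replace (fun z => Cnsub (F z) (G z))
  with (fun z => Cnadd (F z) (Cnscal (Copp C1) (G z))).
- apply holo_add; [exact HF|apply holo_scal, HG].
- apply functional_extensionality; intros z; symmetry; apply Cnsub_alt.
Qed.

Lemma holo_germ_ext {n} (F G : Map n) : germ_eq F G -> holo_near0 F -> holo_near0 G.
Proof.
rewrite germ_eq_nrm, 2!holo_near0_hol; intros (r & Hr & E) (s & Hs & HF).
exists (Rmin r s); split; [apply Rmin_pos; lra|]; intros z Hz.
pose proof (Rmin_l r s); pose proof (Rmin_r r s).
destruct (HF z) as [M HM]; [lra|]; exists M.
rewrite has_cderiv_nrm in HM |- *; intros eps He; destruct (HM eps He) as (d & Hd & K).
exists (Rmin d (r - nrm z)); split; [apply Rmin_pos; lra|]; intros h Hh.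
pose proof (Rmin_l d (r - nrm z)); pose proof (Rmin_r d (r - nrm z)).
rewrite <- 2!E; [apply K; lra|lra|].
eapply Rle_lt_trans; [apply nrm_add|lra].
Qed.

(** * Germs modulo [O(|z|^k)] *)

Lemma big_O_add {n} k (u v : Map n) :
  big_O k u -> big_O k v -> big_O k (fun z => Cnadd (u z) (v z)).
Proof.
intros (C & r & HC & Hr & H) (D & s & HD & Hs & K).
exists (C + D), (Rmin r s); split; [lra|split; [apply Rmin_pos; lra|]]; intros z Hz.
pose proof (Rmin_l r s); pose proof (Rmin_r r s).
specialize (H z ltac:(lra)); specialize (K z ltac:(lra)).
eapply Rle_trans; [apply nrm_add|lra].
Qed.

Lemma big_O_matvec {n} k M (u : Map n) : big_O k u -> big_O k (fun z => matvec M (u z)).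
Proof.
intros (C & r & HC & Hr & H); assert (Hm := mat_norm_ge0 M).
exists (mat_norm M * C), r; split; [apply Rmult_le_pos; lra|split; [lra|]]; intros z Hz.
specialize (H z Hz); eapply Rle_trans; [apply nrm_matvec|].
rewrite Rmult_assoc; apply Rmult_le_compat_l; assumption.
Qed.

Lemma big_O_scal {n} k c (u : Map n) : big_O k u -> big_O k (fun z => Cnscal c (u z)).
Proof.
intros (C & r & HC & Hr & H); assert (Hm := Cnorm_ge0 c).
exists (Cnorm c * C), r; split; [apply Rmult_le_pos; lra|split; [lra|]]; intros z Hz.
specialize (H z Hz); rewrite nrm_scal, Rmult_assoc; apply Rmult_le_compat_l; assumption.
Qed.

Lemma big_O_sub {n} k (u v : Map n) :
  big_O k u -> big_O k v -> big_O k (fun z => Cnsub (u z) (v z)).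
Proof.
intros Hu Hv; replace (fun z => Cnsub (u z) (v z))
  with (fun z => Cnadd (u z) (Cnscal (Copp C1) (v z))).
- apply big_O_add; [exact Hu|apply big_O_scal, Hv].
- apply functional_extensionality; intros z; symmetry; apply Cnsub_alt.
Qed.

Lemma big_O_zero n k : big_O k (fun _ => Cn0 n).
Proof.
exists 0, 1; split; [lra|split; [lra|]]; intros z _; rewrite nrm_Cn0; lra.
Qed.

Lemma big_O_linear n (M : Mat n) : big_O 1 (matvec M).
Proof.
exists (mat_norm M), 1; split; [apply mat_norm_ge0|split; [lra|]].
intros z _; rewrite pow_1; apply nrm_matvec.
Qed.

Lemma big_O_small {n} (x : Map n) : big_O 1 x ->
  exists C, 0 < C /\ forall r, 0 < r -> exists s, 0 < s /\
    forall z, nrm z < s -> nrm (x z) <= C * nrm z /\ nrm (x z) < r.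
Proof.
intros (C & r0 & HC & Hr0 & H); exists (C + 1); split; [lra|]; intros r Hr.
exists (Rmin r0 (r / (C + 1))); split.
{ apply Rmin_pos; [lra|apply Rdiv_lt_0_compat; lra]. }
intros z Hz; pose proof (Rmin_l r0 (r / (C + 1))); pose proof (Rmin_r r0 (r / (C + 1))).
specialize (H z ltac:(lra)); rewrite pow_1 in H; assert (Q := nrm_ge0 z).
assert (Hb : nrm z * (C + 1) < r).
{ apply Rlt_le_trans with (r / (C + 1) * (C + 1)); [apply Rmult_lt_compat_r; lra|].
  right; field; lra. }
split; nra.
Qed.

Lemma big_O_comp {n} k (u x : Map n) : big_O k u -> big_O 1 x -> big_O k (fun z => u (x z)).
Proof.
intros (C & r & HC & Hr & H) Hx.
destruct (big_O_small x Hx) as (D & HD & Hs); destruct (Hs r Hr) as (s & Hs0 & K).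
exists (C * D ^ k), s; split; [apply Rmult_le_pos; [lra|apply pow_le; lra]|split; [lra|]].
intros z Hz; destruct (K z Hz) as [K1 K2]; eapply Rle_trans; [apply H, K2|].
rewrite Rmult_assoc, <- Rpow_mult_distr; apply Rmult_le_compat_l; [exact HC|].
apply pow_incr; split; [apply nrm_ge0|exact K1].
Qed.

Lemma big_O_S {n} k (u : Map n) : big_O (S k) u -> big_O k u.
Proof.
intros (C & r & HC & Hr & H); exists C, (Rmin r 1); split; [lra|split; [apply Rmin_pos; lra|]].
intros z Hz; pose proof (Rmin_l r 1); pose proof (Rmin_r r 1).
eapply Rle_trans; [apply H; lra|]; apply Rmult_le_compat_l; [exact HC|].
simpl; assert (Q := nrm_ge0 z); assert (0 <= nrm z ^ k) by (apply pow_le; lra); nra.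
Qed.

Lemma big_O_le {n} j k (u : Map n) : (j <= k)%nat -> big_O k u -> big_O j u.
Proof.
intros H; induction H as [|k H IH]; [auto|]; intros Hu; apply IH, big_O_S, Hu.
Qed.

Definition eqO {n} (k : nat) (F G : Map n) : Prop := big_O k (fun z => Cnsub (F z) (G z)).

Lemma big_O_ext {n} k (u v : Map n) : (forall z, u z = v z) -> big_O k u -> big_O k v.
Proof. intros E; replace v with u; [auto|apply functional_extensionality, E]. Qed.

Lemma eqO_refl {n} k (F : Map n) : eqO k F F.
Proof. apply (big_O_ext k (fun _ => Cn0 n)); [intros; cn_ring|apply big_O_zero]. Qed.

Lemma eqO_sym {n} k (F G : Map n) : eqO k F G -> eqO k G F.
Proof.
intros H; apply (big_O_ext k (fun z => Cnscal (Copp C1) (Cnsub (F z) (G z)))).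
- intros; cn_ring.
- apply big_O_scal, H.
Qed.

Lemma eqO_trans {n} k (F G H : Map n) : eqO k F G -> eqO k G H -> eqO k F H.
Proof.
intros H1 H2; apply (big_O_ext k (fun z => Cnadd (Cnsub (F z) (G z)) (Cnsub (G z) (H z)))).
- intros; cn_ring.
- apply big_O_add; assumption.
Qed.

Lemma eqO_add {n} k (F G F' G' : Map n) : eqO k F F' -> eqO k G G' ->
  eqO k (fun z => Cnadd (F z) (G z)) (fun z => Cnadd (F' z) (G' z)).
Proof.
intros H1 H2; apply (big_O_ext k (fun z => Cnadd (Cnsub (F z) (F' z)) (Cnsub (G z) (G' z)))).
- intros; cn_ring.
- apply big_O_add; assumption.
Qed.

Lemma eqO_scal {n} k c (F G : Map n) : eqO k F G ->
  eqO k (fun z => Cnscal c (F z)) (fun z => Cnscal c (G z)).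
Proof.
intros H; apply (big_O_ext k (fun z => Cnscal c (Cnsub (F z) (G z)))).
- intros; cn_ring.
- apply big_O_scal, H.
Qed.

Lemma eqO_matvec {n} k M (F G : Map n) : eqO k F G ->
  eqO k (fun z => matvec M (F z)) (fun z => matvec M (G z)).
Proof.
intros H; apply (big_O_ext k (fun z => matvec M (Cnsub (F z) (G z)))).
- intros; apply matvec_sub.
- apply big_O_matvec, H.
Qed.

Lemma eqO_comp_r {n} k (F G x : Map n) : eqO k F G -> big_O 1 x ->
  eqO k (fun z => F (x z)) (fun z => G (x z)).
Proof. intros H Hx; exact (big_O_comp k _ x H Hx). Qed.

Lemma eqO_le {n} j k (F G : Map n) : (j <= k)%nat -> eqO k F G -> eqO j F G.
Proof. apply big_O_le. Qed.

Lemma eqO_germ {n} k (F G : Map n) : germ_eq F G -> eqO k F G.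
Proof.
rewrite germ_eq_nrm; intros (r & Hr & E); exists 0, r; split; [lra|split; [exact Hr|]].
intros z Hz; rewrite (E z Hz); replace (Cnsub (G z) (G z)) with (Cn0 n) by cn_ring.
rewrite nrm_Cn0; lra.
Qed.

Lemma big_O_eqO {n} k (F G : Map n) : eqO k F G -> big_O k G -> big_O k F.
Proof.
intros H HG; apply (big_O_ext k (fun z => Cnadd (Cnsub (F z) (G z)) (G z))).
- intros; cn_ring.
- apply big_O_add; assumption.
Qed.

Lemma germ_sym {n} (F G : Map n) : germ_eq F G -> germ_eq G F.
Proof. intros (r & Hr & E); exists r; split; [exact Hr|]; intros; symmetry; auto. Qed.

Lemma germ_refl {n} (F : Map n) : germ_eq F F.
Proof. exists 1; split; [lra|reflexivity]. Qed.

Lemma germ_trans {n} (F G H : Map n) : germ_eq F G -> germ_eq G H -> germ_eq F H.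
Proof.
intros (r & Hr & E) (s & Hs & K); exists (Rmin r s); split; [apply Rmin_pos; lra|].
intros z Hz i; rewrite E, K; [reflexivity| |]; intros j;
  (eapply Rlt_le_trans; [apply Hz|]); [apply Rmin_r|apply Rmin_l].
Qed.

Lemma germ_comp_r {n} (F G x : Map n) : germ_eq F G -> big_O 1 x ->
  germ_eq (mcomp F x) (mcomp G x).
Proof.
rewrite 2!germ_eq_nrm; intros (r & Hr & E) Hx.
destruct (big_O_small x Hx) as (D & HD & Hs); destruct (Hs r Hr) as (s & Hs0 & K).
exists s; split; [exact Hs0|]; intros z Hz; apply E, K, Hz.
Qed.

Lemma germ_comp_l {n} (F x y : Map n) : germ_eq x y -> germ_eq (mcomp F x) (mcomp F y).
Proof.
rewrite 2!germ_eq_nrm; intros (r & Hr & E); exists r; split; [exact Hr|].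
intros z Hz; unfold mcomp; rewrite (E z Hz); reflexivity.
Qed.

Lemma holo_big_O_1 {n} (F : Map n) : holo_near0 F -> F (Cn0 n) = Cn0 n -> big_O 1 F.
Proof.
rewrite holo_near0_hol; intros (r & Hr & HF) F0.
destruct (HF (Cn0 n)) as [M HM]; [rewrite nrm_Cn0; exact Hr|].
destruct (proj1 (has_cderiv_nrm _ _ _) HM 1 Rlt_0_1) as (d & Hd & K).
exists (mat_norm M + 1), d; split; [pose proof (mat_norm_ge0 M); lra|split; [exact Hd|]].
intros z Hz; specialize (K z Hz); rewrite F0 in K.
replace (Cnadd (Cn0 n) z) with z in K by cn_ring.
replace (Cnsub (Cnsub (F z) (Cn0 n)) (matvec M z)) with (Cnsub (F z) (matvec M z)) in K by cn_ring.
assert (Q := nrm_le_sub (F z) (matvec M z)); assert (B := nrm_matvec M z).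
rewrite pow_1; lra.
Qed.

(** Differentiability at 0 gives only [o(|z|)], which [big_O_of_little_o] improves to [O(|z|^2)];
    this starts the induction on the order. *)
Lemma linear_part_eqO {n} (F : Map n) A :
  holo_near0 F -> F (Cn0 n) = Cn0 n -> linear_part F A -> eqO 2 F (matvec A).
Proof.
intros HF F0 HA; apply big_O_of_little_o; [apply holo_sub; [exact HF|apply holo_matvec]|].
intros eps He; destruct (proj1 (has_cderiv_nrm _ _ _) HA eps He) as (d & Hd & K).
exists d; split; [exact Hd|]; intros z Hz; specialize (K z Hz); rewrite F0 in K.
replace (Cnadd (Cn0 n) z) with z in K by cn_ring.
replace (Cnsub (Cnsub (F z) (Cn0 n)) (matvec A z)) with (Cnsub (F z) (matvec A z)) in K by cn_ring.
rewrite pow_1; exact K.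
Qed.

(** Along [t v] the map is linear in [t] and the bound quadratic; [t] is small enough for [t v] to
    lie in the ball and for the bound to drop below [t |M v|]. *)
Lemma big_O_2_linear_eq0 {n} (M : Mat n) : big_O 2 (matvec M) -> forall v, matvec M v = Cn0 n.
Proof.
intros (C & r & HC & Hr & H) v; apply nrm_eq0.
destruct (Rle_lt_dec (nrm (matvec M v)) 0) as [h|h]; [exact h|exfalso].
assert (Hv := nrm_ge0 v); set (X := nrm (matvec M v)) in *.
set (D := C * nrm v ^ 2 + 1).
assert (HD : 0 < D).
{ unfold D; assert (0 <= nrm v ^ 2) by (apply pow_le; lra); nra. }
set (t := Rmin (r / (nrm v + 1) / 2) (X / D / 2)).
assert (Ht : 0 < t).
{ assert (0 < r / (nrm v + 1)) by (apply Rdiv_lt_0_compat; lra).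
  assert (0 < X / D) by (apply Rdiv_lt_0_compat; lra).
  apply Rmin_pos; lra. }
assert (T1 : t * (nrm v + 1) < r).
{ apply Rle_lt_trans with (r / (nrm v + 1) / 2 * (nrm v + 1)).
  - apply Rmult_le_compat_r; [lra|apply Rmin_l].
  - replace (r / (nrm v + 1) / 2 * (nrm v + 1)) with (r / 2) by (field; lra); lra. }
assert (T2 : t * D <= X / 2).
{ apply Rle_trans with (X / D / 2 * D).
  - apply Rmult_le_compat_r; [lra|apply Rmin_r].
  - right; field; lra. }
specialize (H (Cnscal (t, 0) v)); rewrite matvec_scal, 2!nrm_scal, Cnorm_real in H.
rewrite (Rabs_pos_eq t) in H by lra; specialize (H ltac:(nra)); fold X in H.
replace (C * (t * nrm v) ^ 2) with (t * (t * (C * nrm v ^ 2))) in H by ring.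
assert (X <= t * (C * nrm v ^ 2)) by (apply Rmult_le_reg_l with t; lra).
unfold D in T2; lra.
Qed.

(** * Compositions to first order *)

Section Perturbation.
Variable n : nat.
Implicit Types x y d : Map n.

Lemma eqO_comp_l k y x x' : holo_near0 y -> y (Cn0 n) = Cn0 n ->
  big_O 1 x -> big_O 1 x' -> eqO k x x' -> eqO k (fun z => y (x z)) (fun z => y (x' z)).
Proof.
intros Hy y0 Hx Hx' (C & r & HC & Hr & H).
destruct (big_O_lipschitz y 0 Hy (holo_big_O_1 y Hy y0)) as (D & s & HD & Hs & L).
destruct (big_O_small x Hx) as (D1 & HD1 & S1); destruct (S1 (s / 2)) as (s1 & Hs1 & K1); [lra|].
destruct (big_O_small x' Hx') as (D2 & HD2 & S2); destruct (S2 (s / 2)) as (s2 & Hs2 & K2); [lra|].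
exists (D * C), (Rmin r (Rmin s1 s2)); split; [apply Rmult_le_pos; lra|].
split; [repeat apply Rmin_pos; lra|]; intros z Hz.
assert (M1 := Rmin_l r (Rmin s1 s2)); assert (M2 := Rmin_r r (Rmin s1 s2)).
assert (M3 := Rmin_l s1 s2); assert (M4 := Rmin_r s1 s2).
specialize (H z ltac:(lra)); destruct (K1 z ltac:(lra)); destruct (K2 z ltac:(lra)).
eapply Rle_trans; [apply (L (s / 2)); lra|].
rewrite pow_O, Rmult_1_r, Rmult_assoc; apply Rmult_le_compat_l; assumption.
Qed.

(** The nonlinear part of [y] is [O(|z|^2)], hence Lipschitz with constant [O(|z|)] on balls of
    radius proportional to [|z|]; this factor gains one order on [x' - x]. *)
Lemma eqO_perturb k y B x x' : holo_near0 y -> eqO 2 y (matvec B) ->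
  big_O 1 x -> big_O 1 x' -> eqO k x' x ->
  eqO (S k) (fun z => y (x' z)) (fun z => Cnadd (y (x z)) (matvec B (Cnsub (x' z) (x z)))).
Proof.
intros Hy HB Hx Hx' (C & r & HC & Hr & H).
set (u := fun z => Cnsub (y z) (matvec B z)).
assert (Hu : holo_near0 u) by (apply holo_sub; [exact Hy|apply holo_matvec]).
destruct (big_O_lipschitz u 1 Hu HB) as (D & s & HD & Hs & L).
destruct (big_O_small x Hx) as (D1 & HD1 & S1); destruct (S1 s Hs) as (s1 & Hs1 & K1).
destruct (big_O_small x' Hx') as (D2 & HD2 & S2); destruct (S2 s Hs) as (s2 & Hs2 & K2).
set (E := D1 + D2).
exists (D * E * C), (Rmin (s / E) (Rmin r (Rmin s1 s2))).
assert (HE : 0 < E) by (unfold E; lra).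
assert (HsE : 0 < s / E) by (apply Rdiv_lt_0_compat; lra).
split; [repeat apply Rmult_le_pos; lra|split; [repeat apply Rmin_pos; lra|]]; intros z Hz.
assert (M0 := Rmin_l (s / E) (Rmin r (Rmin s1 s2))).
assert (M0' := Rmin_r (s / E) (Rmin r (Rmin s1 s2))).
assert (M1 := Rmin_l r (Rmin s1 s2)); assert (M2 := Rmin_r r (Rmin s1 s2)).
assert (M3 := Rmin_l s1 s2); assert (M4 := Rmin_r s1 s2).
specialize (H z ltac:(lra)); destruct (K1 z ltac:(lra)) as [A1 A2].
destruct (K2 z ltac:(lra)) as [B1 B2]; assert (Q := nrm_ge0 z).
replace (Cnsub (y (x' z)) (Cnadd (y (x z)) (matvec B (Cnsub (x' z) (x z)))))
  with (Cnsub (u (x' z)) (u (x z))) by (unfold u; rewrite matvec_sub; cn_ring).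
assert (HsEz : E * nrm z < s).
{ replace s with (E * (s / E)) by (field; lra); apply Rmult_lt_compat_l; lra. }
eapply Rle_trans; [apply (L (E * nrm z) (x z) (x' z)); [exact HsEz| |]; unfold E; nra|].
rewrite pow_1; simpl.
replace (D * E * C * (nrm z * nrm z ^ k)) with (D * (E * nrm z) * (C * nrm z ^ k)) by ring.
apply Rmult_le_compat_l; [apply Rmult_le_pos; nra|exact H].
Qed.

(** On a ball of radius proportional to [|z|] the germ [d] is Lipschitz with constant [O(|z|^k)],
    and [y] differs from its linear part by [O(|z|^2)]. *)
Lemma eqO_linearize_r k d y B : holo_near0 d -> big_O (S k) d -> big_O 1 y ->
  eqO 2 y (matvec B) -> eqO (S (S k)) (fun z => d (y z)) (fun z => d (matvec B z)).
Proof.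
intros Hd HO Hy (C & r & HC & Hr & H).
destruct (big_O_lipschitz d k Hd HO) as (D & s & HD & Hs & L).
destruct (big_O_small y Hy) as (D1 & HD1 & S1); destruct (S1 s Hs) as (s1 & Hs1 & K1).
assert (Hm := mat_norm_ge0 B).
set (E := D1 + mat_norm B).
exists (D * E ^ k * C), (Rmin (s / E) (Rmin r s1)).
assert (HE : 0 < E) by (unfold E; lra).
assert (HsE : 0 < s / E) by (apply Rdiv_lt_0_compat; lra).
assert (HEk : 0 <= E ^ k) by (apply pow_le; lra).
split; [repeat apply Rmult_le_pos; lra|split; [repeat apply Rmin_pos; lra|]]; intros z Hz.
assert (M0 := Rmin_l (s / E) (Rmin r s1)); assert (M0' := Rmin_r (s / E) (Rmin r s1)).
assert (M1 := Rmin_l r s1); assert (M2 := Rmin_r r s1).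
specialize (H z ltac:(lra)); destruct (K1 z ltac:(lra)) as [A1 A2].
assert (Q := nrm_ge0 z); assert (B1 := nrm_matvec B z).
assert (HsEz : E * nrm z < s).
{ replace s with (E * (s / E)) by (field; lra); apply Rmult_lt_compat_l; lra. }
eapply Rle_trans; [apply (L (E * nrm z) (matvec B z) (y z)); [exact HsEz| |]; unfold E; nra|].
rewrite Rpow_mult_distr.
replace (D * E ^ k * C * nrm z ^ S (S k)) with (D * (E ^ k * nrm z ^ k) * (C * nrm z ^ 2))
  by (simpl; ring).
apply Rmult_le_compat_l; [|exact H].
apply Rmult_le_pos; [exact HD|apply Rmult_le_pos; [exact HEk|apply pow_le, Q]].
Qed.

End Perturbation.

(** * Generators agree to all orders *)

Lemma germ_diff_0 {n} (x : Map n) : germ_diff x -> x (Cn0 n) = Cn0 n.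
Proof. intros (H & _); apply Cn_ext, H. Qed.

Lemma germ_diff_holo {n} (x : Map n) : germ_diff x -> holo_near0 x.
Proof. intros (_ & H & _); exact H. Qed.

Lemma germ_diff_big_O {n} (x : Map n) : germ_diff x -> big_O 1 x.
Proof.
intros H; apply holo_big_O_1; [apply germ_diff_holo, H|apply germ_diff_0, H].
Qed.

(** [subgroup] provides right inverses only; comparison with the inverse germ contained in
    [germ_diff] makes them two-sided. *)
Lemma right_inverse_left {n} (x y : Map n) :
  germ_diff x -> germ_diff y -> germ_eq (mcomp x y) (idmap n) -> germ_eq (mcomp y x) (idmap n).
Proof.
intros Hx Hy Hxy; destruct (Hx) as (_ & _ & g & g0 & Hg & Hxg & Hgx).
assert (E : germ_eq y g).
{ apply germ_trans with (mcomp g (mcomp x y)).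
  - apply germ_sym; exact (germ_comp_r _ _ y Hgx (germ_diff_big_O _ Hy)).
  - exact (germ_comp_l g _ _ Hxy). }
apply germ_trans with (mcomp g x); [|exact Hgx].
apply germ_comp_r; [exact E|apply germ_diff_big_O, Hx].
Qed.

Lemma eqO_ext {n} k (F F' G G' : Map n) :
  (forall z, F z = F' z) -> (forall z, G z = G' z) -> eqO k F G -> eqO k F' G'.
Proof.
intros E1 E2; replace F' with F; [replace G' with G; [auto|]|];
  apply functional_extensionality; assumption.
Qed.

(** * From agreement to one order to agreement to the next *)

Section Step.
Variables (n : nat) (G : Map n -> Prop) (gens : list (Map n)) (A : Mat n) (p e k : nat) (f : Map n).
Hypothesis HG : subgroup G.
Hypothesis Hgen : generated_by G gens.
Hypothesis Hconj : forall fi fj, In fi gens -> In fj gens ->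
  exists h, G h /\ germ_eq (mcomp fi h) (mcomp h fj).
Hypothesis Hp : prime (Z.of_nat p).
Hypothesis Aq : forall v, matvec (matpow A (p ^ e)) v = v.
Hypothesis Hf : In f gens.
Hypothesis HA : forall g, In g gens -> eqO 2 g (matvec A).
Hypothesis IH : forall g, In g gens -> eqO (S (S k)) g f.

Let q := (p ^ e)%nat.
Let Ap (j : nat) (z : Cn n) : Cn n := matvec (matpow A j) z.
(** As [A^q = 1], the power [q - 1] is the inverse of [A]; all inverses of [A^j] below are powers of
    [A]. *)
Let Ai (z : Cn n) : Cn n := Ap (q - 1) z.
Let s (u : Map n) : Map n := fun z => matvec A (u (Ai z)).
Let u_of (g : Map n) : Map n := fun z => Cnsub (g (Ai z)) (f (Ai z)).
Let us : list (Map n) := map u_of gens.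

Lemma q_pos : (1 <= q)%nat.
Proof.
unfold q; apply prime_ge_2 in Hp.
assert (p ^ e <> 0)%nat by (apply Nat.pow_nonzero; lia); lia.
Qed.

Lemma Ap_add i j z : Ap (i + j) z = Ap i (Ap j z).
Proof. apply matvec_matpow_add. Qed.

Lemma Ap_1 z : Ap 1 z = matvec A z.
Proof. unfold Ap; rewrite matvec_matpow_S; simpl; rewrite matvec_matid; reflexivity. Qed.

Lemma Ap_0 z : Ap 0 z = z.
Proof. apply matvec_matid. Qed.

Lemma Ap_S j z : Ap (S j) z = matvec A (Ap j z).
Proof. apply matvec_matpow_S. Qed.

Lemma Ap_mul_q j z : Ap (j * q) z = z.
Proof.
induction j as [|j IHj]; [apply Ap_0|].
change (S j * q)%nat with (q + j * q)%nat; rewrite Ap_add, IHj; apply Aq.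
Qed.

Lemma Ap_inv j z : Ap j (Ap (j * (q - 1)) z) = z.
Proof.
rewrite <- Ap_add; replace (j + j * (q - 1))%nat with (j * q)%nat by (pose proof q_pos; nia).
apply Ap_mul_q.
Qed.

Lemma Ap_inv' j z : Ap (j * (q - 1)) (Ap j z) = z.
Proof. rewrite <- Ap_add, Nat.add_comm, Ap_add; apply Ap_inv. Qed.

Lemma Ai_A z : Ai (matvec A z) = z.
Proof.
rewrite <- Ap_1; unfold Ai; replace (q - 1)%nat with (1 * (q - 1))%nat by lia; apply Ap_inv'.
Qed.

(** This is [s^i d = A^i d A^-i] with the inverse moved to the other side. *)
Lemma iter_s i d z : Nat.iter i s d (Ap i z) = Ap i (d z).
Proof.
revert z; induction i as [|i IHi]; intros z; [simpl; rewrite 2!Ap_0; reflexivity|].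
change (Nat.iter (S i) s d) with (s (Nat.iter i s d)); unfold s at 1.
rewrite Ap_S, Ai_A, IHi, Ap_S; reflexivity.
Qed.

Lemma s_A d z : s d (matvec A z) = matvec A (d z).
Proof. unfold s; rewrite Ai_A; reflexivity. Qed.

Lemma G_diff x : G x -> germ_diff x.
Proof. destruct HG as (H & _); apply H. Qed.

Lemma G_gen g : In g gens -> G g.
Proof. intros Hg; apply Hgen; intros H _ K; apply K, Hg. Qed.

Lemma Ap_O j : big_O 1 (Ap j).
Proof. apply big_O_linear. Qed.

(** What the perturbation estimates require of the elements of [L]. *)
Definition tame (u : Map n) : Prop := holo_near0 u /\ big_O (S (S k)) u.

Lemma tame_sub u v : tame u -> tame v -> tame (fun z => Cnsub (u z) (v z)).
Proof. intros [H1 H2] [H3 H4]; split; [apply holo_sub|apply big_O_sub]; assumption. Qed.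

Lemma tame_s u : tame u -> tame (s u).
Proof.
intros [H1 H2]; split.
- apply (holo_matvec_comp A (fun z => u (Ai z))), (holo_comp_matvec (matpow A (q - 1)) u), H1.
- apply (big_O_matvec _ A (fun z => u (Ai z))), (big_O_comp _ u Ai); [exact H2|apply Ap_O].
Qed.

Lemma tame_comp_Ap u j : tame u -> tame (fun z => u (Ap j z)).
Proof.
intros [H1 H2]; split.
- apply (holo_comp_matvec (matpow A j) u), H1.
- apply (big_O_comp _ u (Ap j)); [exact H2|apply Ap_O].
Qed.

Lemma tame_span u : span s us u -> tame u.
Proof.
intros H; induction H as [u Hu| |u v _ I1 _ I2|u _ I|u _ I].
- apply in_map_iff in Hu; destruct Hu as (g & <- & Hg).
  apply (tame_comp_Ap (fun z => Cnsub (g z) (f z)) (q - 1)); split; [|apply IH, Hg].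
  apply holo_sub; apply germ_diff_holo, G_diff, G_gen; assumption.
- split; [|apply big_O_zero].
  apply holo_germ_ext with (matvec (matscal C0 (matid n))); [|apply holo_matvec].
  exists 1; split; [lra|]; intros z _ i; rewrite matvec_matscal, matvec_matid.
  unfold Cnscal, Cn0; ring.
- destruct I1, I2; split; [apply holo_add|apply big_O_add]; assumption.
- destruct I as [H1 H2].
  replace (fun z i => Copp (u z i)) with (fun z => Cnscal (Copp C1) (u z)).
  + split; [apply holo_scal|apply big_O_scal]; assumption.
  + apply functional_extensionality; intros z; cn_ring.
- apply tame_s, I.
Qed.

(** Membership in [(1 - s) L], exact and not modulo higher order; all error terms are confined to
    [twisted]. *)
Definition cob (d : Map n) : Prop :=
  exists c, span s us c /\ forall z, d z = Cnsub (c z) (s c z).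

Lemma tame_cob d : cob d -> tame d.
Proof.
intros (c & Hc & E); replace d with (fun z => Cnsub (c z) (s c z)).
- apply tame_sub; [|apply tame_s]; apply tame_span, Hc.
- apply functional_extensionality; intros z; symmetry; apply E.
Qed.

Lemma cob_add d d' : cob d -> cob d' -> cob (fun z => Cnadd (d z) (d' z)).
Proof.
intros (c & Hc & E) (c' & Hc' & E'); exists (fun z => Cnadd (c z) (c' z)).
split; [apply span_add; assumption|]; intros z; rewrite E, E'.
unfold s; rewrite matvec_add; cn_ring.
Qed.

Lemma cob_opp d : cob d -> cob (fun z => Cnscal (Copp C1) (d z)).
Proof.
intros (c & Hc & E); exists (fun z i => Copp (c z i)); split; [apply span_opp, Hc|].
intros z; rewrite E; unfold s.
replace (fun i => Copp (c (Ai z) i)) with (Cnscal (Copp C1) (c (Ai z))) by cn_ring.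
rewrite matvec_scal; cn_ring.
Qed.

(** [s] commutes with [1 - s] and preserves [L]. *)
Lemma cob_iter i d : cob d -> cob (Nat.iter i s d).
Proof.
intros Hd; induction i as [|i (c & Hc & E)]; [exact Hd|].
exists (s c); split; [apply span_act, Hc|]; intros z.
change (Nat.iter (S i) s d) with (s (Nat.iter i s d)); unfold s at 1.
rewrite E, matvec_sub; reflexivity.
Qed.

(* Modulo [O(|z|^(k+3))] the commutator of [x] with [f] is [id + d] with [d] in the image of
   [1 - s]; such [x] form a subgroup. *)
Definition twisted (x : Map n) : Prop :=
  G x /\ exists j d, eqO 2 x (Ap j) /\ cob d /\
    eqO (S (S (S k))) (fun z => x (f z)) (fun z => Cnadd (f (x z)) (d (Ap (S j) z))).

Lemma twisted_germ x y : twisted x -> germ_eq x y -> twisted y.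
Proof.
intros (Gx & j & d & H1 & H2 & H3) Exy.
assert (Gy : G y) by (destruct HG as (_ & K & _); apply (K x); assumption).
split; [exact Gy|]; exists j, d; split; [|split; [exact H2|]].
- apply eqO_trans with x; [apply eqO_germ, germ_sym, Exy|exact H1].
- apply eqO_trans with (fun z => x (f z)).
  + apply (eqO_comp_r _ y x f); [apply eqO_germ, germ_sym, Exy|].
    apply germ_diff_big_O, G_diff, G_gen, Hf.
  + eapply eqO_trans; [exact H3|].
    apply eqO_add; [|apply eqO_refl]; apply eqO_germ; exact (germ_comp_l f x y Exy).
Qed.

Lemma twisted_id : twisted (idmap n).
Proof.
split; [destruct HG as (_ & _ & K & _); exact K|].
exists 0%nat, (fun _ => Cn0 n); split; [|split].
- apply (eqO_ext 2 (idmap n) _ (idmap n)); [reflexivity| |apply eqO_refl].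
  intros z; symmetry; apply Ap_0.
- exists (fun _ => Cn0 n); split; [apply span_zero|]; intros z; unfold s; rewrite matvec_0; cn_ring.
- apply (eqO_ext _ f _ f); [reflexivity| |apply eqO_refl]; intros z; unfold idmap; cn_ring.
Qed.

(** Cocycle rule [d_xy = d_x + s^i d_y], where [x] has linear part [A^i]. Modulo higher order, [x y
    f = x (f y + d_y A^(j+1)) = x f y + A^i d_y A^(j+1) = f x y + (d_x + s^i d_y) A^(i+j+1)]. The
    second equality is [eqO_perturb]; the third uses the cocycle of [x] and [eqO_linearize_r]. *)
Lemma twisted_comp x y : twisted x -> twisted y -> twisted (mcomp x y).
Proof.
intros (Gx & i & dx & X1 & X2 & X3) (Gy & j & dy & Y1 & Y2 & Y3).
assert (Dx := G_diff x Gx); assert (Dy := G_diff y Gy).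
assert (Df := G_diff f (G_gen f Hf)).
assert (Ox := germ_diff_big_O x Dx); assert (Oy := germ_diff_big_O y Dy).
assert (Of := germ_diff_big_O f Df).
assert (Ofy : big_O 1 (fun z => f (y z))) by (apply (big_O_comp 1 f y); assumption).
assert (Oyf : big_O 1 (fun z => y (f z))) by (apply (big_O_comp 1 y f); assumption).
destruct (tame_comp_Ap dy (S j) (tame_cob dy Y2)) as [T1 T2].
destruct (tame_comp_Ap dx (S i) (tame_cob dx X2)) as [T3 T4].
split; [destruct HG as (_ & _ & _ & K & _); apply K; assumption|].
exists (i + j)%nat, (fun z => Cnadd (dx z) (Nat.iter i s dy z)); split; [|split].
- apply eqO_trans with (fun z => Ap i (y z)); [exact (eqO_comp_r 2 x (Ap i) y X1 Oy)|].
  apply (eqO_ext 2 (fun z => Ap i (y z)) _ (fun z => Ap i (Ap j z)));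
    [reflexivity|intros z; symmetry; apply Ap_add|].
  apply eqO_matvec, Y1.
- apply cob_add; [exact X2|apply cob_iter, Y2].
- set (w := fun z => Cnadd (f (y z)) (dy (Ap (S j) z))).
  assert (Ow : big_O 1 w).
  { apply big_O_add; [exact Ofy|apply big_O_le with (S (S k)); [lia|exact T2]]. }
  apply eqO_trans with (fun z => x (w z)).
  { apply (eqO_comp_l n _ x (fun z => y (f z)) w); auto;
      [apply germ_diff_holo, Dx|apply germ_diff_0, Dx]. }
  apply eqO_trans with (fun z => Cnadd (x (f (y z))) (Ap i (dy (Ap (S j) z)))).
  { apply (eqO_ext _ (fun z => x (w z)) _
      (fun z => Cnadd (x (f (y z))) (matvec (matpow A i) (Cnsub (w z) (f (y z))))));
      [reflexivity| |].
    - intros z; replace (Cnsub (w z) (f (y z))) with (dy (Ap (S j) z)) by (unfold w; cn_ring).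
      reflexivity.
    - apply (eqO_perturb n _ x (matpow A i) (fun z => f (y z)) w); auto;
        [apply germ_diff_holo, Dx|].
      apply (big_O_ext _ (fun z => dy (Ap (S j) z))); [|exact T2].
      intros z; unfold w; cn_ring. }
  apply (eqO_ext _ (fun z => Cnadd (x (f (y z))) (Ap i (dy (Ap (S j) z)))) _
    (fun z => Cnadd (Cnadd (f (x (y z))) (dx (Ap (S i) (Ap j z)))) (Ap i (dy (Ap (S j) z)))));
    [reflexivity| |].
  + intros z; unfold mcomp.
    replace (Ap (S (i + j)) z) with (Ap i (Ap (S j) z))
      by (rewrite <- Ap_add; f_equal; lia).
    rewrite iter_s.
    replace (Ap (S i) (Ap j z)) with (Ap i (Ap (S j) z))
      by (rewrite <- 2!Ap_add; f_equal; lia).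
    cn_ring.
  + apply eqO_add; [|apply eqO_refl].
    eapply eqO_trans; [exact (eqO_comp_r _ _ _ y X3 Oy)|]; cbv beta.
    apply eqO_add; [apply eqO_refl|].
    exact (eqO_linearize_r n (S k) (fun z => dx (Ap (S i) z)) y (matpow A j) T3 T4 Oy Y1).
Qed.

(** The cocycle rule forces [d_y = - s^(-j) d_x] for the inverse [y] of [x], and [s^(-j)] is
    realized as the power [j (q - 1)] of [s]. The auxiliary [w = f + d A] represents [x f y] modulo
    higher order; applying [y] to it gives [f y]. *)
Lemma twisted_inv x : twisted x -> exists y, twisted y /\ germ_eq (mcomp x y) (idmap n).
Proof.
intros (Gx & j & d & X1 & X2 & X3).
destruct HG as (_ & _ & _ & _ & Ginv).
destruct (Ginv x Gx) as (y & Gy & Exy); exists y; split; [|exact Exy].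
split; [exact Gy|].
assert (Dx := G_diff x Gx); assert (Dy := G_diff y Gy).
assert (Df := G_diff f (G_gen f Hf)).
assert (Eyx := right_inverse_left x y Dx Dy Exy).
assert (Ox := germ_diff_big_O x Dx); assert (Oy := germ_diff_big_O y Dy).
assert (Of := germ_diff_big_O f Df).
destruct (tame_comp_Ap d (S j) (tame_cob d X2)) as [T1 T2].
destruct (tame_comp_Ap d 1 (tame_cob d X2)) as [T3 T4].
set (j' := (j * (q - 1))%nat).
assert (Y1 : eqO 2 y (Ap j')).
{ apply eqO_trans with (fun z => Ap j' (x (y z))).
  - apply (eqO_ext 2 (fun z => Ap j' (Ap j (y z))) _ (fun z => Ap j' (x (y z))));
      [intros z; apply Ap_inv'|reflexivity|].
    apply eqO_matvec, eqO_sym; exact (eqO_comp_r 2 x (Ap j) y X1 Oy).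
  - apply eqO_matvec, (eqO_germ 2 (mcomp x y) (idmap n)), Exy. }
exists j', (fun z => Cnscal (Copp C1) (Nat.iter j' s d z)); split; [exact Y1|split].
{ apply cob_opp, cob_iter, X2. }
set (w := fun z => Cnadd (f z) (d (Ap 1 z))).
assert (Ow : big_O 1 w).
{ apply big_O_add; [exact Of|apply big_O_le with (S (S k)); [lia|exact T4]]. }
assert (Ofy : big_O 1 (fun z => f (y z))) by (apply (big_O_comp 1 f y); assumption).
assert (W : eqO (S (S (S k))) (fun z => x (f (y z))) w).
{ eapply eqO_trans; [exact (eqO_comp_r _ _ _ y X3 Oy)|]; cbv beta; unfold w.
  apply eqO_add.
  - apply eqO_germ; exact (germ_comp_l f _ _ Exy).
  - eapply eqO_trans;
      [exact (eqO_linearize_r n (S k) (fun z => d (Ap (S j) z)) y (matpow A j') T1 T2 Oy Y1)|].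
    apply (eqO_ext _ (fun z => d (Ap 1 z)) _ (fun z => d (Ap 1 z)));
      [|reflexivity|apply eqO_refl].
    intros z; f_equal; change (S j) with (1 + j)%nat; rewrite Ap_add.
    f_equal; symmetry; apply Ap_inv. }
assert (E : eqO (S (S (S k))) (fun z => f (y z)) (fun z => Cnadd (y (f z)) (Ap j' (d (Ap 1 z))))).
{ apply eqO_trans with (fun z => y (x (f (y z)))).
  { apply eqO_sym, eqO_germ; exact (germ_comp_r _ _ (fun z => f (y z)) Eyx Ofy). }
  apply eqO_trans with (fun z => y (w z)).
  { apply (eqO_comp_l n _ y (fun z => x (f (y z))) w); auto;
      [apply germ_diff_holo, Dy|apply germ_diff_0, Dy|].
    apply (big_O_comp 1 x (fun z => f (y z))); assumption. }
  apply (eqO_ext _ (fun z => y (w z)) _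
      (fun z => Cnadd (y (f z)) (matvec (matpow A j') (Cnsub (w z) (f z)))));
      [reflexivity| |].
  - intros z; replace (Cnsub (w z) (f z)) with (d (Ap 1 z)) by (unfold w; cn_ring).
    reflexivity.
  - apply (eqO_perturb n _ y (matpow A j') f w); auto; [apply germ_diff_holo, Dy|].
    apply (big_O_ext _ (fun z => d (Ap 1 z))); [|exact T4].
    intros z; unfold w; cn_ring. }
apply (eqO_ext _ (fun z => Cnadd (Cnadd (y (f z)) (Ap j' (d (Ap 1 z))))
    (Cnscal (Copp C1) (Ap j' (d (Ap 1 z))))) _
  (fun z => Cnadd (f (y z)) (Cnscal (Copp C1) (Ap j' (d (Ap 1 z)))))).
- intros z; cn_ring.
- intros z; replace (Ap (S j') z) with (Ap j' (Ap 1 z))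
    by (rewrite <- Ap_add; f_equal; lia).
  rewrite iter_s; reflexivity.
- apply eqO_add; [apply eqO_sym, E|apply eqO_refl].
Qed.

Lemma gen_u_of g z : g z = Cnadd (f z) (u_of g (matvec A z)).
Proof. unfold u_of; rewrite Ai_A; cn_ring. Qed.

(** With [u = u_of g], modulo higher order [g f = f f + u A^2] and [f g = f f + A u A], where
    [A u A = (s u) A^2]. The cocycle of [g] is therefore [(1 - s) u]. *)
Lemma twisted_gen g : In g gens -> twisted g.
Proof.
intros Hg; split; [apply G_gen, Hg|].
assert (Dg := G_diff g (G_gen g Hg)); assert (Df := G_diff f (G_gen f Hf)).
assert (Og := germ_diff_big_O g Dg); assert (Of := germ_diff_big_O f Df).
assert (Su : span s us (u_of g)) by (apply span_gen, in_map, Hg).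
destruct (tame_comp_Ap (u_of g) 1 (tame_span _ Su)) as [T1 T2].
exists 1%nat, (fun z => Cnsub (u_of g z) (s (u_of g) z)); split; [|split].
- apply (eqO_ext 2 g _ (matvec A)); [reflexivity|intros z; symmetry; apply Ap_1|apply HA, Hg].
- exists (u_of g); split; [exact Su|reflexivity].
- assert (E1 : eqO (S (S (S k))) (fun z => g (f z))
    (fun z => Cnadd (f (f z)) (u_of g (Ap 2 z)))).
  { apply (eqO_ext _ (fun z => Cnadd (f (f z)) (u_of g (Ap 1 (f z)))) _
      (fun z => Cnadd (f (f z)) (u_of g (Ap 1 (matvec A z))))).
    - intros z; rewrite Ap_1; symmetry; apply gen_u_of.
    - intros z; rewrite <- (Ap_1 z), <- Ap_add; reflexivity.
    - apply eqO_add; [apply eqO_refl|].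
      apply (eqO_linearize_r n (S k) (fun z => u_of g (Ap 1 z)) f A T1 T2 Of), HA, Hf. }
  assert (E2 : eqO (S (S (S k))) (fun z => f (g z))
    (fun z => Cnadd (f (f z)) (matvec A (u_of g (matvec A z))))).
  { apply (eqO_ext _ (fun z => f (g z)) _
      (fun z => Cnadd (f (f z)) (matvec A (Cnsub (g z) (f z))))); [reflexivity| |].
    - intros z; replace (Cnsub (g z) (f z)) with (u_of g (matvec A z)); [reflexivity|].
      rewrite (gen_u_of g z); cn_ring.
    - apply (eqO_perturb n _ f A f g); auto; apply germ_diff_holo, Df. }
  eapply eqO_trans; [exact E1|].
  apply (eqO_ext _ (fun z => Cnadd (Cnadd (f (f z)) (matvec A (u_of g (matvec A z))))
      (Cnsub (u_of g (Ap 2 z)) (matvec A (u_of g (matvec A z))))) _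
    (fun z => Cnadd (f (g z)) (Cnsub (u_of g (Ap 2 z)) (matvec A (u_of g (matvec A z)))))).
  + intros z; cn_ring.
  + intros z; f_equal; f_equal; rewrite Ap_S, s_A, Ap_1; reflexivity.
  + apply eqO_add; [apply eqO_sym, E2|apply eqO_refl].
Qed.

Lemma twisted_all x : G x -> twisted x.
Proof.
intros Gx; apply Hgen with (H := twisted); [exact Gx| |exact twisted_gen].
split; [intros y [Gy _]; apply G_diff, Gy|].
split; [exact twisted_germ|]; split; [exact twisted_id|].
split; [exact twisted_comp|exact twisted_inv].
Qed.

(** Take [h] with [g h = h f], and let [d] be its cocycle, so that [h f = f h + d A^(j+1)]. With
    [u = u_of g], also [g h = f h + u A h], and [u A h] agrees with [u A^(j+1)]; hence [u] agrees
    with [d]. *)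
Lemma u_of_cob g : In g gens -> exists c, span s us c /\
  big_O (S (S (S k))) (fun z => Cnsub (u_of g z) (Cnsub (c z) (s c z))).
Proof.
intros Hg; destruct (Hconj g f Hg Hf) as (h & Gh & E).
destruct (twisted_all h Gh) as (_ & j & d & H1 & (c & Hc & Ed) & H3).
exists c; split; [exact Hc|].
assert (Oh := germ_diff_big_O h (G_diff h Gh)).
assert (Su : span s us (u_of g)) by (apply span_gen, in_map, Hg).
destruct (tame_comp_Ap (u_of g) 1 (tame_span _ Su)) as [T1 T2].
assert (K : eqO (S (S (S k))) (fun z => u_of g (Ap (S j) z)) (fun z => d (Ap (S j) z))).
{ apply eqO_trans with (fun z => u_of g (Ap 1 (h z))).
  { apply eqO_sym.
    apply (eqO_ext _ (fun z => u_of g (Ap 1 (h z))) _ (fun z => u_of g (Ap 1 (Ap j z))));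
      [reflexivity|intros z; rewrite <- Ap_add; reflexivity|].
    exact (eqO_linearize_r n (S k) (fun z => u_of g (Ap 1 z)) h (matpow A j) T1 T2 Oh H1). }
  apply (eqO_ext _ (fun z => Cnadd (g (h z)) (Cnscal (Copp C1) (f (h z)))) _
    (fun z => Cnadd (Cnadd (f (h z)) (d (Ap (S j) z))) (Cnscal (Copp C1) (f (h z))))).
  - intros z; rewrite Ap_1, (gen_u_of g (h z)); cn_ring.
  - intros z; cn_ring.
  - apply eqO_add; [|apply eqO_refl].
    eapply eqO_trans; [|exact H3]; exact (eqO_germ _ _ _ E). }
(* [A^(j+1)] is cancelled by composing on the right with its inverse, the power [(j + 1) (q - 1)] of
   [A]. *)
apply (big_O_ext _ (fun z => Cnsub (u_of g (Ap (S j) (Ap (S j * (q - 1)) z)))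
  (d (Ap (S j) (Ap (S j * (q - 1)) z))))).
- intros z; rewrite Ap_inv, Ed; reflexivity.
- exact (big_O_comp _ _ _ K (Ap_O (S j * (q - 1)))).
Qed.

Lemma generators_next_order g : In g gens -> eqO (S (S (S k))) g f.
Proof.
intros Hg.
assert (I : big_O (S (S (S k))) (u_of g)).
{ apply (@span_nakayama n s us (big_O (S (S (S k)))) p e Hp).
  - intros u v; apply functional_extensionality; intros z; apply matvec_sub.
  - intros u _; apply functional_extensionality; intros z.
    transitivity (Nat.iter q s u (Ap q z)); [f_equal; symmetry; apply Aq|].
    rewrite iter_s; apply Aq.
  - apply big_O_zero.
  - intros u v; apply big_O_add.
  - intros u c; apply big_O_scal.
  - intros u Hu; apply (big_O_matvec _ A (fun z => u (Ai z))).
    apply (big_O_comp _ u Ai); [exact Hu|apply Ap_O].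
  - intros u Hu; apply in_map_iff in Hu; destruct Hu as (g' & <- & Hg').
    apply u_of_cob, Hg'.
  - apply in_map, Hg. }
apply (big_O_ext _ (fun z => u_of g (matvec A z))).
- intros z; rewrite (gen_u_of g z); cn_ring.
- exact (big_O_comp _ _ _ I (big_O_linear n A)).
Qed.

End Step.

(** The common linear part gives order 2, [generators_next_order] then reaches every order, and a
    flat holomorphic germ vanishes. *)
Theorem generators_equal n (G : Map n -> Prop) gens A p e f :
  subgroup G -> generated_by G gens ->
  (forall fi fj, In fi gens -> In fj gens ->
     exists h, G h /\ germ_eq (mcomp fi h) (mcomp h fj)) ->
  prime (Z.of_nat p) -> (forall v, matvec (matpow A (p ^ e)) v = v) ->
  (forall g, In g gens -> eqO 2 g (matvec A)) ->
  In f gens -> forall g, In g gens -> germ_eq g f.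
Proof.
intros HG Hgen Hconj Hp Aq HA Hf.
assert (All : forall k g, In g gens -> eqO (S (S k)) g f).
{ intros k; induction k as [|k IH]; intros g Hg.
  - apply eqO_trans with (matvec A); [|apply eqO_sym]; apply HA; assumption.
  - apply (generators_next_order n G gens A p e k f); assumption. }
intros g Hg; apply germ_eq_nrm.
assert (Hh : forall x, In x gens -> holo_near0 x).
{ intros x Hx; apply germ_diff_holo; destruct HG as (K & _); apply K.
  exact (G_gen n G gens Hgen x Hx). }
destruct (flat_holo_eq0 (fun z => Cnsub (g z) (f z))) as (r & Hr & E).
- apply holo_sub; apply Hh; assumption.
- intros k; apply big_O_le with (S (S k)); [lia|apply All, Hg].
- exists r; split; [exact Hr|]; intros z Hz; specialize (E z Hz).
  replace (g z) with (Cnadd (f z) (Cnsub (g z) (f z))) by cn_ring.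
  rewrite E; cn_ring.
Qed.

(** * Inverting a germ tangent to the identity *)

(** The intervals centred at [x k] with radius [2 c / 2^k], the tail of the geometric series, are
    nested. *)
Lemma geometric_limit_R (x : nat -> R) c : 0 <= c ->
  (forall k, Rabs (x (S k) - x k) <= c / 2 ^ k) ->
  exists l, forall k, Rabs (x k - l) <= 2 * c / 2 ^ k.
Proof.
intros Hc H.
assert (Hp : forall k, 0 < 2 ^ k) by (intro; apply pow_lt; lra).
assert (Hh : forall k, c / 2 ^ k = 2 * (c / 2 ^ S k))
  by (intros k; specialize (Hp k); simpl; field; lra).
assert (Hw : forall k, 0 <= c / 2 ^ k) by (intros k; apply Rdiv_le_0_compat; auto).
destruct (nested_intervals (fun k => x k - 2 * (c / 2 ^ k)) (fun k => 4 * (c / 2 ^ k))) as [l Hl].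
- intros k; specialize (Hw k); lra.
- intros k; specialize (H k); apply Rabs_le_between in H; rewrite (Hh k) in *; lra.
- intros k; specialize (H k); apply Rabs_le_between in H; rewrite (Hh k) in *; lra.
- exists l; intros k; specialize (Hl k); cbv beta in Hl.
  replace (2 * c / 2 ^ k) with (2 * (c / 2 ^ k)) by (unfold Rdiv; ring).
  apply Rabs_le; lra.
Qed.

Lemma geometric_limit {n} (x : nat -> Cn n) c : 0 <= c ->
  (forall k, nrm (Cnsub (x (S k)) (x k)) <= c / 2 ^ k) ->
  exists l, forall k, nrm (Cnsub (x k) l) <= INR n * (4 * c / 2 ^ k).
Proof.
intros Hc H.
assert (L : forall i, exists l : Cx, forall k, Cnorm (Csub (x k i) l) <= 4 * c / 2 ^ k).
{ intros i.
  destruct (geometric_limit_R (fun k => fst (x k i)) c Hc) as [a Ha].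
  { intros k; eapply Rle_trans;
      [|eapply Rle_trans; [apply (Cnorm_le_nrm (Cnsub (x (S k)) (x k)) i)|apply (H k)]].
    exact (Rabs_fst_le (Cnsub (x (S k)) (x k) i)). }
  destruct (geometric_limit_R (fun k => snd (x k i)) c Hc) as [b Hb].
  { intros k; eapply Rle_trans;
      [|eapply Rle_trans; [apply (Cnorm_le_nrm (Cnsub (x (S k)) (x k)) i)|apply (H k)]].
    exact (Rabs_snd_le (Cnsub (x (S k)) (x k) i)). }
  exists (a, b); intros k; specialize (Ha k); specialize (Hb k).
  eapply Rle_trans; [apply Cnorm_le_parts|]; simpl.
  fold (fst (x k i) - a) (snd (x k i) - b).
  replace (4 * c / 2 ^ k) with (2 * c / 2 ^ k + 2 * c / 2 ^ k) by (unfold Rdiv; ring); lra. }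
destruct (functional_choice _ L) as [l Hl]; exists l; intros k.
apply nrm_le_INR; intros i; apply Hl.
Qed.

Lemma le_geometric_0 a c : (forall k, a <= c / 2 ^ k) -> a <= 0.
Proof.
intros H; apply Rnot_lt_le; intros Ha.
destruct (pow_lt_1_zero (/ 2) ltac:(rewrite Rabs_pos_eq; lra) (a / (Rabs c + 1))) as [N HN].
{ apply Rdiv_lt_0_compat; [exact Ha|pose proof (Rabs_pos c); lra]. }
specialize (HN N (le_n N)); rewrite Rabs_pos_eq in HN by (apply pow_le; lra).
specialize (H N); unfold Rdiv at 1 in H; rewrite <- pow_inv in H.
assert (Q := Rle_abs c); assert (Q' := Rabs_pos c).
assert (P : 0 < (/ 2) ^ N) by (apply pow_lt; lra).
assert (HN' : (/ 2) ^ N * (Rabs c + 1) < a).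
{ apply (Rmult_lt_compat_r (Rabs c + 1)) in HN; [|lra].
  unfold Rdiv in HN; rewrite Rmult_assoc, Rinv_l, Rmult_1_r in HN; lra. }
nra.
Qed.

Section Inverse.
Variables (n : nat) (h : Map n) (rho : R).
Let u : Map n := fun z => Cnsub (h z) z.
Hypothesis Hrho : 0 < rho.
Hypothesis h0 : h (Cn0 n) = Cn0 n.
Hypothesis Hu : forall z w, nrm z < rho -> nrm w < rho ->
  nrm (Cnsub (u w) (u z)) <= / 2 * nrm (Cnsub w z).

Lemma expanding z w : nrm z < rho -> nrm w < rho ->
  nrm (Cnsub w z) <= 2 * nrm (Cnsub (h w) (h z)).
Proof.
intros Hz Hw; assert (K := Hu z w Hz Hw).
assert (E : Cnsub w z = Cnsub (Cnsub (h w) (h z)) (Cnsub (u w) (u z))) by (unfold u; cn_ring).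
assert (Q := nrm_sub (Cnsub (h w) (h z)) (Cnsub (u w) (u z))); rewrite <- E in Q; lra.
Qed.

(** Iteration of [z -> w - u z], a contraction of ratio 1/2 whose fixed point solves [h z = w]. *)
Fixpoint newton (w : Cn n) (k : nat) : Cn n :=
  match k with O => Cn0 n | S j => Cnsub w (u (newton w j)) end.

Lemma nrm_u z : nrm z < rho -> nrm (u z) <= / 2 * nrm z.
Proof.
intros Hz; assert (K := Hu (Cn0 n) z ltac:(rewrite nrm_Cn0; lra) Hz).
replace (Cnsub z (Cn0 n)) with z in K by cn_ring.
replace (Cnsub (u z) (u (Cn0 n))) with (u z) in K; [exact K|].
unfold u; rewrite h0; cn_ring.
Qed.

Lemma newton_bound w k : 2 * nrm w < rho -> nrm (newton w k) <= 2 * nrm w.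
Proof.
intros Hw; assert (Q := nrm_ge0 w).
induction k as [|k IH]; simpl; [rewrite nrm_Cn0; lra|].
assert (K := nrm_u (newton w k) ltac:(lra)).
eapply Rle_trans; [apply nrm_sub|lra].
Qed.

Lemma newton_step w k : 2 * nrm w < rho ->
  nrm (Cnsub (newton w (S k)) (newton w k)) <= 2 * nrm w / 2 ^ k.
Proof.
intros Hw; assert (Q := nrm_ge0 w).
induction k as [|k IH].
- simpl pow; rewrite Rdiv_1_r.
  replace (Cnsub (newton w 1) (newton w 0)) with (newton w 1) by (simpl; cn_ring).
  apply newton_bound, Hw.
- set (a := newton w (S k)) in *; set (b := newton w k) in *.
  replace (Cnsub (newton w (S (S k))) a) with (Cnsub (u b) (u a))
    by (unfold a; simpl; fold b; cn_ring).
  assert (Ba := newton_bound w (S k) Hw); assert (Bb := newton_bound w k Hw).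
  fold a in Ba; fold b in Bb.
  eapply Rle_trans; [apply Hu; lra|].
  rewrite nrm_sub_sym; simpl pow.
  assert (0 < 2 ^ k) by (apply pow_lt; lra).
  replace (2 * nrm w / (2 * 2 ^ k)) with (/ 2 * (2 * nrm w / 2 ^ k)) by (field; lra); lra.
Qed.

Lemma preimage w : 2 * nrm w < rho -> exists z, nrm z <= 2 * nrm w /\ h z = w.
Proof.
intros Hw; assert (Q := nrm_ge0 w); assert (Hn := pos_INR n).
destruct (geometric_limit (newton w) (2 * nrm w)) as [z Hz]; [lra| |].
{ intros k; apply newton_step, Hw. }
assert (Bz : nrm z <= 2 * nrm w).
{ cut (nrm z - 2 * nrm w <= 0); [lra|].
  apply le_geometric_0 with (INR n * (4 * (2 * nrm w))); intros k.
  assert (K := nrm_le_sub z (newton w k)); rewrite nrm_sub_sym in K.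
  specialize (Hz k); assert (B := newton_bound w k Hw).
  replace (INR n * (4 * (2 * nrm w)) / 2 ^ k)
    with (INR n * (4 * (2 * nrm w) / 2 ^ k)) by (unfold Rdiv; ring); lra. }
exists z; split; [exact Bz|].
assert (E : nrm (Cnsub (h z) w) <= 0).
{ apply le_geometric_0 with (2 * (INR n * (4 * (2 * nrm w)))); intros k.
  assert (B := newton_bound w k Hw).
  assert (K := Hu z (newton w k) ltac:(lra) ltac:(lra)).
  (* The defect [h z - w] is controlled by the distances of [z] to two consecutive iterates. *)
  assert (E : Cnsub (h z) w =
    Cnadd (Cnsub z (newton w (S k))) (Cnsub (u z) (u (newton w k)))).
  { simpl; unfold u; cn_ring. }
  rewrite E; eapply Rle_trans; [apply nrm_add|].
  rewrite nrm_sub_sym, (nrm_sub_sym (u z)).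
  assert (Z1 := Hz k); assert (Z2 := Hz (S k)).
  assert (P2 : 0 < 2 ^ k) by (apply pow_lt; lra).
  assert (E2 : INR n * (4 * (2 * nrm w) / 2 ^ S k) = / 2 * (INR n * (4 * (2 * nrm w) / 2 ^ k)))
    by (simpl; field; lra).
  rewrite E2 in Z2.
  replace (2 * (INR n * (4 * (2 * nrm w))) / 2 ^ k)
    with (2 * (INR n * (4 * (2 * nrm w) / 2 ^ k))) by (unfold Rdiv; ring).
  assert (0 <= INR n * (4 * (2 * nrm w) / 2 ^ k)).
  { apply Rmult_le_pos; [exact Hn|apply Rdiv_le_0_compat; lra]. }
  lra. }
apply nrm_eq0 in E.
replace (h z) with (Cnadd w (Cnsub (h z) w)) by cn_ring; rewrite E; cn_ring.
Qed.

(** If [M v = 0], then for small [t] the values of [h] at [z] and [z + t v] differ by at most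
    [|t v| / 4], against the lower bound [|t v| / 2] from [expanding]. *)
Lemma derivative_injective z M : nrm z < rho -> has_cderiv h z M ->
  forall v, matvec M v = Cn0 n -> v = Cn0 n.
Proof.
intros Hz HM v Hv; apply nrm_eq0.
destruct (Rle_lt_dec (nrm v) 0) as [l|l]; [exact l|exfalso].
destruct (proj1 (has_cderiv_nrm _ _ _) HM (/ 4)) as (d & Hd & K); [lra|].
set (t := Rmin d (rho - nrm z) / (2 * nrm v)).
assert (M1 := Rmin_l d (rho - nrm z)); assert (M2 := Rmin_r d (rho - nrm z)).
assert (M0 : 0 < Rmin d (rho - nrm z)) by (apply Rmin_pos; lra).
assert (Ht : 0 < t) by (apply Rdiv_lt_0_compat; lra).
assert (Et : t * nrm v = Rmin d (rho - nrm z) / 2) by (unfold t; field; lra).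
specialize (K (Cnscal (t, 0) v)); rewrite nrm_scal, Cnorm_real, (Rabs_pos_eq t) in K by lra.
specialize (K ltac:(lra)); rewrite matvec_scal, Hv in K.
replace (Cnscal (t, 0) (Cn0 n)) with (Cn0 n) in K by cn_ring.
set (w := Cnadd z (Cnscal (t, 0) v)) in K.
replace (Cnsub (Cnsub (h w) (h z)) (Cn0 n)) with (Cnsub (h w) (h z)) in K by cn_ring.
assert (Ew : Cnsub w z = Cnscal (t, 0) v) by (unfold w; cn_ring).
assert (Nw : nrm (Cnsub w z) = t * nrm v)
  by (rewrite Ew, nrm_scal, Cnorm_real, Rabs_pos_eq; lra).
assert (Hw : nrm w < rho) by (pose proof (nrm_le_sub w z); lra).
assert (X := expanding z w Hz Hw); lra.
Qed.

(** For the increment [eta] of [g] and [N = M^-1], one has [eta - N k = - N (k - M eta)]. The bound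
    [|eta| <= 2 |k|] from [expanding] turns an error small against [eta] into one small against [k],
    and accounts for the 2 in [e]. *)
Lemma inverse_derivative (g : Map n) r w M : 0 < r -> nrm w < r ->
  (forall y, nrm y < r -> nrm (g y) < rho /\ h (g y) = y) ->
  has_cderiv h (g w) M -> exists N, has_cderiv g w N.
Proof.
intros Hr Hw Hg HM; destruct (Hg w Hw) as [Gw Ew].
destruct (mat_injective_inverse (derivative_injective _ _ Gw HM)) as (N & _ & NM).
exists N; apply has_cderiv_nrm; intros eps He; assert (HN := mat_norm_ge0 N).
set (e := eps / (2 * (mat_norm N + 1))).
assert (He' : 0 < e) by (apply Rdiv_lt_0_compat; lra).
destruct (proj1 (has_cderiv_nrm _ _ _) HM e He') as (d & Hd & K).
exists (Rmin (d / 2) (r - nrm w)); split; [apply Rmin_pos; lra|]; intros k Hk.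
assert (M1 := Rmin_l (d / 2) (r - nrm w)); assert (M2 := Rmin_r (d / 2) (r - nrm w)).
assert (Hwk : nrm (Cnadd w k) < r) by (eapply Rle_lt_trans; [apply nrm_add|lra]).
destruct (Hg _ Hwk) as [Gk Ek].
set (eta := Cnsub (g (Cnadd w k)) (g w)).
assert (Beta : nrm eta <= 2 * nrm k).
{ assert (X := expanding _ _ Gw Gk); rewrite Ek, Ew in X.
  replace (Cnsub (Cnadd w k) w) with k in X by cn_ring; exact X. }
specialize (K eta ltac:(lra)).
replace (Cnadd (g w) eta) with (g (Cnadd w k)) in K by (unfold eta; cn_ring).
rewrite Ek, Ew in K; replace (Cnsub (Cnadd w k) w) with k in K by cn_ring.
replace (Cnsub eta (matvec N k))
  with (Cnscal (Copp C1) (matvec N (Cnsub k (matvec M eta))))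
  by (rewrite matvec_sub, NM; cn_ring).
rewrite nrm_scal, Cnorm_opp, Cnorm_C1, Rmult_1_l.
eapply Rle_trans; [apply nrm_matvec|].
assert (Q := nrm_ge0 k); assert (Q' := nrm_ge0 eta).
apply Rle_trans with (mat_norm N * (e * (2 * nrm k))).
- apply Rmult_le_compat_l; [exact HN|]; eapply Rle_trans; [exact K|].
  apply Rmult_le_compat_l; lra.
- replace (mat_norm N * (e * (2 * nrm k))) with (eps * nrm k - eps * nrm k / (mat_norm N + 1))
    by (unfold e; field; lra).
  assert (0 <= eps * nrm k / (mat_norm N + 1)) by (apply Rdiv_le_0_compat; nra); lra.
Qed.

End Inverse.

Theorem tangent_id_inverse n (h : Map n) :
  holo_near0 h -> h (Cn0 n) = Cn0 n -> eqO 2 h (idmap n) ->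
  exists rho g, 0 < rho /\
    (forall z w, nrm z < rho -> nrm w < rho -> h z = h w -> z = w) /\
    g (Cn0 n) = Cn0 n /\ holo_near0 g /\
    germ_eq (mcomp h g) (idmap n) /\ germ_eq (mcomp g h) (idmap n).
Proof.
intros Hh h0 HO.
set (u := fun z => Cnsub (h z) z).
assert (Hu : holo_near0 u).
{ apply holo_sub; [exact Hh|].
  apply holo_germ_ext with (matvec (matid n)); [|apply holo_matvec].
  exists 1; split; [lra|]; intros z _ i; rewrite matvec_matid; reflexivity. }
destruct (big_O_lipschitz u 1 Hu HO) as (C & r & HC & Hr & L).
destruct (proj1 (holo_near0_hol h) Hh) as (R0 & HR0 & Hhol).
(* [R0] bounds the domain of holomorphy, [r] that of the Lipschitz estimate, and the last term makes
   [C rho <= 1/2]. *)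
set (rho := Rmin R0 (Rmin (r / 2) (/ (2 * (C + 1))))).
assert (HC1 : 0 < / (2 * (C + 1))) by (apply Rinv_0_lt_compat; lra).
assert (Hrho : 0 < rho) by (repeat apply Rmin_pos; lra).
assert (M0 : rho <= R0) by apply Rmin_l.
assert (M1 : rho <= r / 2) by (eapply Rle_trans; [apply Rmin_r|apply Rmin_l]).
assert (M2 : rho <= / (2 * (C + 1))) by (eapply Rle_trans; [apply Rmin_r|apply Rmin_r]).
assert (HCr : C * rho <= / 2).
{ apply Rle_trans with ((C + 1) * / (2 * (C + 1))); [apply Rmult_le_compat; lra|].
  right; field; lra. }
assert (Lu : forall z w, nrm z < rho -> nrm w < rho ->
  nrm (Cnsub (u w) (u z)) <= / 2 * nrm (Cnsub w z)).
{ intros z w Hz Hw; eapply Rle_trans; [apply (L rho); lra|].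
  rewrite pow_1; apply Rmult_le_compat_r; [apply nrm_ge0|exact HCr]. }
assert (Inj : forall z w, nrm z < rho -> nrm w < rho -> h z = h w -> z = w).
{ intros z w Hz Hw E; assert (X := expanding n h rho Lu w z Hw Hz).
  rewrite E in X; replace (Cnsub (h w) (h w)) with (Cn0 n) in X by cn_ring.
  rewrite nrm_Cn0 in X; assert (Y := nrm_eq0 (Cnsub z w) ltac:(lra)).
  replace z with (Cnadd w (Cnsub z w)) by cn_ring; rewrite Y; cn_ring. }
assert (Pre : forall w, exists z, nrm w < rho / 2 -> nrm z <= 2 * nrm w /\ h z = w).
{ intros w; destruct (Rlt_dec (nrm w) (rho / 2)) as [l|l].
  - destruct (preimage n h rho Hrho h0 Lu w) as [z Hz]; [lra|]; exists z; auto.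
  - exists (Cn0 n); intros; contradiction. }
destruct (functional_choice _ Pre) as [g Hg].
assert (Hg' : forall y, nrm y < rho / 2 -> nrm (g y) < rho /\ h (g y) = y).
{ intros y Hy; destruct (Hg y Hy); split; [lra|assumption]. }
exists rho, g; split; [exact Hrho|]; split; [exact Inj|].
assert (g0 : g (Cn0 n) = Cn0 n).
{ apply nrm_eq0; destruct (Hg (Cn0 n)) as [B _]; [rewrite nrm_Cn0; lra|].
  rewrite nrm_Cn0 in B; lra. }
split; [exact g0|]; split; [|split].
- apply holo_near0_hol; exists (rho / 2); split; [lra|]; intros w Hw.
  destruct (Hg' w Hw) as [Gw _]; destruct (Hhol (g w)) as [M HM]; [lra|].
  apply (inverse_derivative n h rho Lu g (rho / 2) w M); auto; lra.
- apply germ_eq_nrm; exists (rho / 2); split; [lra|]; intros w Hw; apply Hg', Hw.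
- apply germ_eq_nrm.
  destruct (big_O_small h (holo_big_O_1 h Hh h0)) as (D & HD & Hs).
  destruct (Hs (rho / 2)) as (s & Hs0 & K); [lra|].
  exists (Rmin s rho); split; [apply Rmin_pos; lra|]; intros z Hz.
  pose proof (Rmin_l s rho); pose proof (Rmin_r s rho).
  destruct (K z ltac:(lra)) as [_ K2]; destruct (Hg' _ K2) as [G1 G2].
  apply Inj; [exact G1|unfold idmap; lra|exact G2].
Qed.

(** * Linearization *)

Lemma map_pow_S {n} (f : Map n) k z : map_pow f (S k) z = f (map_pow f k z).
Proof. reflexivity. Qed.

Lemma map_pow_add {n} (f : Map n) j k z : map_pow f (j + k) z = map_pow f j (map_pow f k z).
Proof.
induction j as [|j IH]; [reflexivity|].
change (S j + k)%nat with (S (j + k)); rewrite 2!map_pow_S, IH; reflexivity.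
Qed.

Lemma map_pow_Sr {n} (f : Map n) k z : map_pow f (S k) z = map_pow f k (f z).
Proof. replace (S k) with (k + 1)%nat by lia; apply map_pow_add. Qed.

Lemma subgroup_map_pow {n} (G : Map n -> Prop) f k : subgroup G -> G f -> G (map_pow f k).
Proof.
intros (_ & _ & G1 & Gm & _) Gf; induction k as [|k IH]; [exact G1|].
exact (Gm f _ Gf IH).
Qed.

Lemma map_pow_period {n} (f : Map n) m k : big_O 1 (map_pow f k) ->
  germ_eq (map_pow f m) (idmap n) -> germ_eq (map_pow f (m + k)) (map_pow f k).
Proof.
intros Hk Hm.
apply germ_trans with (mcomp (map_pow f m) (map_pow f k)).
- replace (map_pow f (m + k)) with (mcomp (map_pow f m) (map_pow f k)); [apply germ_refl|].
  apply functional_extensionality; intros z; symmetry; apply map_pow_add.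
- exact (germ_comp_r _ _ _ Hm Hk).
Qed.

Lemma map_pow_mul_period {n} (f : Map n) m j : (forall k, big_O 1 (map_pow f k)) ->
  germ_eq (map_pow f m) (idmap n) -> germ_eq (map_pow f (j * m)) (idmap n).
Proof.
intros HO Hm; induction j as [|j IH]; [apply germ_refl|].
apply germ_trans with (map_pow f (j * m)); [|exact IH].
apply map_pow_period; [apply HO|exact Hm].
Qed.

(** * The cyclic group generated by one germ *)

Section CyclicGroup.
Variables (n : nat) (G : Map n -> Prop) (gens : list (Map n)) (f : Map n) (m : nat).
Hypothesis HG : subgroup G.
Hypothesis Hgen : generated_by G gens.
Hypothesis Hf : In f gens.
Hypothesis Heq : forall g, In g gens -> germ_eq g f.
Hypothesis Hm0 : (0 < m)%nat.
Hypothesis Hm : germ_eq (map_pow f m) (idmap n).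

Lemma cyclic_gen : G f.
Proof. apply Hgen; intros H _ K; apply K, Hf. Qed.

Lemma cyclic_pow_O k : big_O 1 (map_pow f k).
Proof.
apply germ_diff_big_O; destruct HG as (K & _); apply K.
apply subgroup_map_pow; [exact HG|apply cyclic_gen].
Qed.

(** The powers of [f] form a subgroup because [f^(k (m - 1))] inverts [f^k]. Membership in [G] is
    carried along in the induction to supply [germ_diff], which [subgroup] demands. *)
Lemma cyclic_elements x : G x <-> exists k, germ_eq x (map_pow f k).
Proof.
destruct HG as (Gd & Ge & G1 & Gm & Gi); split.
- intros Gx.
  apply (Hgen x) with (H := fun x => G x /\ exists k, germ_eq x (map_pow f k)) in Gx.
  + apply Gx.
  + split; [intros y [Gy _]; apply Gd, Gy|].
    split.
    { intros y y' [Gy [k Hk]] E; split; [apply (Ge y); assumption|].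
      exists k; apply germ_trans with y; [apply germ_sym, E|exact Hk]. }
    split; [split; [exact G1|exists 0%nat; apply germ_refl]|].
    split.
    { intros y y' [Gy [k Hk]] [Gy' [k' Hk']]; split; [apply Gm; assumption|].
      exists (k + k')%nat.
      apply germ_trans with (mcomp y (map_pow f k')); [apply germ_comp_l, Hk'|].
      apply germ_trans with (mcomp (map_pow f k) (map_pow f k')).
      - apply germ_comp_r; [exact Hk|apply cyclic_pow_O].
      - replace (map_pow f (k + k')) with (mcomp (map_pow f k) (map_pow f k')).
        + apply germ_refl.
        + apply functional_extensionality; intros z; symmetry; apply map_pow_add. }
    { intros y [Gy [k Hk]]; exists (map_pow f (k * (m - 1))); split.
      - split; [apply subgroup_map_pow; [exact HG|apply cyclic_gen]|eexists; apply germ_refl].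
      - apply germ_trans with (mcomp (map_pow f k) (map_pow f (k * (m - 1)))).
        + apply germ_comp_r; [exact Hk|apply cyclic_pow_O].
        + replace (mcomp (map_pow f k) (map_pow f (k * (m - 1)))) with (map_pow f (k * m)).
          * apply map_pow_mul_period; [apply cyclic_pow_O|exact Hm].
          * apply functional_extensionality; intros z; unfold mcomp.
            rewrite <- map_pow_add; f_equal; nia. }
  + intros g Hg; split; [apply Hgen; intros S _ K; apply K, Hg|].
    exists 1%nat; exact (Heq g Hg).
- intros [k Hk]; apply (Ge (map_pow f k)); [|apply germ_sym, Hk].
  apply subgroup_map_pow; [exact HG|apply cyclic_gen].
Qed.

Lemma cyclic_finite : finite_cyclic G.
Proof.
exists f, m; split; [apply cyclic_gen|split; [exact Hm0|]]; intros x.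
rewrite cyclic_elements; split; [|intros (k & _ & Hk); exists k; exact Hk].
intros [k Hk]; exists (k mod m)%nat; split; [apply Nat.mod_upper_bound; lia|].
apply germ_trans with (map_pow f k); [exact Hk|].
rewrite (Nat.div_mod_eq k m) at 1; rewrite Nat.mul_comm.
apply map_pow_period; [apply cyclic_pow_O|].
apply map_pow_mul_period; [apply cyclic_pow_O|exact Hm].
Qed.

End CyclicGroup.

(** * Averaging over the powers of [f] *)

Section Average.
Variables (n : nat) (G : Map n -> Prop) (f : Map n) (A : Mat n) (m : nat).
Hypothesis HG : subgroup G.
Hypothesis Gf : G f.
Hypothesis HfA : eqO 2 f (matvec A).
Hypothesis Hm0 : (0 < m)%nat.
Hypothesis Hm : germ_eq (map_pow f m) (idmap n).
Hypothesis Am : forall v, matvec (matpow A m) v = v.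

Lemma average_pow_diff k : germ_diff (map_pow f k).
Proof. destruct HG as (K & _); apply K, subgroup_map_pow; assumption. Qed.

Lemma matpow_mul_period j v : matvec (matpow A (j * m)) v = v.
Proof.
induction j as [|j IH]; [apply matvec_matid|].
change (S j * m)%nat with (m + j * m)%nat; rewrite matvec_matpow_add, IH; apply Am.
Qed.

(** The power [k (m - 1)] of [A] is [A^-k], as [A^m = 1]. *)
Definition twist (k : nat) : Map n := fun z => matvec (matpow A (k * (m - 1))) (map_pow f k z).

Fixpoint average (k : nat) : Map n :=
  match k with
  | O => fun _ => Cn0 n
  | S j => fun z => Cnadd (average j z) (twist j z)
  end.

Lemma map_pow_eqO k : eqO 2 (map_pow f k) (matvec (matpow A k)).
Proof.
induction k as [|k IH].
- apply (eqO_ext 2 (idmap n) _ (idmap n)); [reflexivity| |apply eqO_refl].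
  intros z; symmetry; apply matvec_matid.
- apply eqO_trans with (fun z => matvec A (map_pow f k z)).
  + apply (eqO_comp_r 2 f (matvec A)); [exact HfA|apply germ_diff_big_O, average_pow_diff].
  + apply (eqO_ext 2 (fun z => matvec A (map_pow f k z)) _
      (fun z => matvec A (matvec (matpow A k) z))); [reflexivity| |apply eqO_matvec, IH].
    intros z; symmetry; apply matvec_matpow_S.
Qed.

Lemma twist_eqO k : eqO 2 (twist k) (idmap n).
Proof.
apply (eqO_ext 2 (twist k) _
  (fun z => matvec (matpow A (k * (m - 1))) (matvec (matpow A k) z))); [reflexivity| |].
- intros z; rewrite <- matvec_matpow_add.
  replace (k * (m - 1) + k)%nat with (k * m)%nat by nia; apply matpow_mul_period.
- apply eqO_matvec, map_pow_eqO.
Qed.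

Lemma average_eqO k : eqO 2 (average k) (fun z => Cnscal (INR k, 0) z).
Proof.
induction k as [|k IH].
- apply (eqO_ext 2 (fun _ => Cn0 n) _ (fun _ => Cn0 n)); [reflexivity| |apply eqO_refl].
  intros z; apply Cn_ext; intros i; unfold Cnscal; rewrite Cmul_INR_0; reflexivity.
- apply (eqO_ext 2 (average (S k)) _ (fun z => Cnadd (Cnscal (INR k, 0) z) (idmap n z)));
    [reflexivity| |].
  + intros z; apply Cn_ext; intros i; unfold Cnscal, Cnadd, idmap; rewrite Cmul_INR_S; ring.
  + apply eqO_add; [exact IH|apply twist_eqO].
Qed.

Lemma average_holo k : holo_near0 (average k).
Proof.
induction k as [|k IH].
- apply holo_germ_ext with (matvec (matscal C0 (matid n))); [|apply holo_matvec].
  exists 1; split; [lra|]; intros z _ i; rewrite matvec_matscal, matvec_matid.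
  unfold Cnscal; simpl; unfold Cn0; ring.
- apply holo_add; [exact IH|apply holo_matvec_comp, germ_diff_holo, average_pow_diff].
Qed.

Lemma average_0 k : average k (Cn0 n) = Cn0 n.
Proof.
induction k as [|k IH]; [reflexivity|]; simpl; rewrite IH; unfold twist.
rewrite (germ_diff_0 _ (average_pow_diff k)), matvec_0; cn_ring.
Qed.

(** Since [twist j] composed with [f] is [A] composed with [twist (j + 1)], the sum is shifted by
    one place; the term that drops out, [twist 0], is the identity. *)
Lemma average_f k z : average k (f z) = matvec A (Cnsub (average (S k) z) z).
Proof.
induction k as [|k IH].
- simpl; unfold twist; simpl; rewrite matvec_matid; unfold map_pow, idmap; simpl.
  replace (Cnsub (Cnadd (Cn0 n) z) z) with (Cn0 n) by cn_ring; rewrite matvec_0; reflexivity.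
- change (average (S k) (f z)) with (Cnadd (average k (f z)) (twist k (f z))); rewrite IH.
  replace (twist k (f z)) with (matvec A (twist (S k) z)).
  + rewrite <- matvec_add; f_equal.
    change (average (S (S k)) z) with (Cnadd (average (S k) z) (twist (S k) z)); cn_ring.
  + unfold twist; rewrite map_pow_Sr, <- matvec_matpow_S.
    replace (S (S k * (m - 1)))%nat with (k * (m - 1) + 1 * m)%nat by nia.
    rewrite matvec_matpow_add, matpow_mul_period; reflexivity.
Qed.

(** After the shift the sum has gained [twist m] and lost [twist 0], both the identity as germs. *)
Lemma average_conj : germ_eq (mcomp (average m) f) (fun z => matvec A (average m z)).
Proof.
apply germ_eq_nrm; apply germ_eq_nrm in Hm; destruct Hm as (r & Hr & E).
exists r; split; [exact Hr|]; intros z Hz; unfold mcomp; rewrite average_f; f_equal.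
change (average (S m) z) with (Cnadd (average m z) (twist m z)).
unfold twist; rewrite (E z Hz), Nat.mul_comm, matpow_mul_period; unfold idmap; cn_ring.
Qed.

(** Division by [m] makes the sum tangent to the identity, as [tangent_id_inverse] requires. *)
Definition linearizer : Map n := fun z => Cnscal (/ INR m, 0) (average m z).

Lemma linearizer_eqO : eqO 2 linearizer (idmap n).
Proof.
apply (eqO_ext 2 linearizer _ (fun z => Cnscal (/ INR m, 0) (Cnscal (INR m, 0) z)));
  [reflexivity| |apply eqO_scal, average_eqO].
intros z; apply Cn_ext; intros i; unfold Cnscal, idmap.
destruct m as [|k]; [lia|]; apply Cmul_INR_inv.
Qed.

Lemma linearizer_holo : holo_near0 linearizer.
Proof. apply holo_scal, average_holo. Qed.

Lemma linearizer_0 : linearizer (Cn0 n) = Cn0 n.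
Proof. unfold linearizer; rewrite average_0; cn_ring. Qed.

Lemma linearizer_conj k :
  germ_eq (mcomp linearizer (map_pow f k)) (fun z => matvec (matpow A k) (linearizer z)).
Proof.
induction k as [|k IH].
- apply germ_eq_nrm; exists 1; split; [lra|]; intros z _; symmetry; apply matvec_matid.
- apply germ_trans with (fun z => matvec A (linearizer (map_pow f k z))).
  + assert (E : germ_eq (mcomp linearizer f) (fun z => matvec A (linearizer z))).
    { apply germ_eq_nrm; destruct (proj1 (germ_eq_nrm _ _) average_conj) as (r & Hr & E).
      exists r; split; [exact Hr|]; intros z Hz; unfold mcomp, linearizer.
      rewrite matvec_scal; f_equal; exact (E z Hz). }
    exact (germ_comp_r _ _ (map_pow f k) E (germ_diff_big_O _ (average_pow_diff k))).
  + apply germ_eq_nrm; destruct (proj1 (germ_eq_nrm _ _) IH) as (r & Hr & E).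
    exists r; split; [exact Hr|]; intros z Hz; rewrite matvec_matpow_S; f_equal.
    exact (E z Hz).
Qed.

End Average.

Lemma compose_list_eqO {n} (A : Mat n) l : (forall g, In g l -> eqO 2 g (matvec A)) ->
  eqO 2 (compose_list l) (matvec (matpow A (length l))).
Proof.
induction l as [|g l IH]; intros H.
- apply (eqO_ext 2 (idmap n) _ (idmap n)); [reflexivity| |apply eqO_refl].
  intros z; symmetry; apply matvec_matid.
- assert (Hl := IH (fun x Hx => H x (or_intror Hx))).
  assert (HO : big_O 1 (compose_list l)).
  { apply big_O_eqO with (matvec (matpow A (length l))); [|apply big_O_linear].
    apply eqO_le with 2%nat; [lia|exact Hl]. }
  apply eqO_trans with (fun z => matvec A (compose_list l z)).
  + apply (eqO_comp_r 2 g (matvec A)); [apply H; left; reflexivity|exact HO].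
  + apply (eqO_ext 2 (fun z => matvec A (compose_list l z)) _
      (fun z => matvec A (matvec (matpow A (length l)) z))); [reflexivity| |].
    * intros z; symmetry; apply matvec_matpow_S.
    * apply eqO_matvec, Hl.
Qed.

Lemma compose_list_germ {n} (f : Map n) l :
  (forall k, big_O 1 (map_pow f k)) -> (forall g, In g l -> germ_eq g f) ->
  germ_eq (compose_list l) (map_pow f (length l)).
Proof.
intros HO; induction l as [|g l IH]; intros H; [apply germ_refl|].
apply germ_trans with (mcomp g (map_pow f (length l))).
- apply germ_comp_l, IH; intros x Hx; apply H; right; exact Hx.
- apply germ_comp_r; [apply H; left; reflexivity|apply HO].
Qed.

Lemma eqO_linear {n} (M N : Mat n) : eqO 2 (matvec M) (matvec N) ->
  forall v, matvec M v = matvec N v.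
Proof.
intros H v.
assert (K : matvec (matadd M (matscal (Copp C1) N)) v = Cn0 n).
{ apply big_O_2_linear_eq0.
  apply (big_O_ext 2 (fun z => Cnsub (matvec M z) (matvec N z))); [|exact H].
  intros z; rewrite matvec_matadd, matvec_matscal; cn_ring. }
rewrite matvec_matadd, matvec_matscal, <- Cnsub_alt in K.
replace (matvec M v) with (Cnadd (matvec N v) (Cnsub (matvec M v) (matvec N v))) by cn_ring.
rewrite K; cn_ring.
Qed.

Lemma fin_bound n (Q : Fin.t n -> nat -> Prop) :
  (forall j r r', (r <= r')%nat -> Q j r -> Q j r') -> (forall j, exists r, Q j r) ->
  exists e, forall j, Q j e.
Proof.
induction n as [|n IH]; intros Hmon H.
- exists 0%nat; intros j; inversion j.
- destruct (IH (fun j => Q (Fin.FS j))) as [e He].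
  { intros j; apply Hmon. }
  { intros j; apply H. }
  destruct (H Fin.F1) as [r Hr]; exists (Nat.max r e); intros j.
  apply (Fin.caseS' j (fun j => Q j (Nat.max r e))).
  + apply (Hmon _ r); [lia|exact Hr].
  + intros i; apply (Hmon _ e); [lia|apply He].
Qed.

Lemma Cpow_add z j k : Cpow z (j + k) = Cmul (Cpow z j) (Cpow z k).
Proof. induction j as [|j IH]; simpl; [ring|rewrite IH; ring]. Qed.

Lemma Cpow_mul_1 z j k : Cpow z k = C1 -> Cpow z (j * k) = C1.
Proof.
intros H; induction j as [|j IH]; [reflexivity|].
simpl; rewrite Cpow_add, H, IH; ring.
Qed.

Lemma map_pow_diag {n} (xi : Fin.t n -> Cx) k z i :
  map_pow (diag_map xi) k z i = Cmul (Cpow (xi i) k) (z i).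
Proof.
induction k as [|k IH]; [simpl; unfold map_pow, idmap; simpl; ring|].
rewrite map_pow_S; unfold diag_map at 1; rewrite IH; simpl; ring.
Qed.

(** * Diagonal form of the linear part *)

Section Diagonal.
Variables (n : nat) (A P Q : Mat n) (xi : Fin.t n -> Cx).
Hypothesis PQ : forall v, matvec P (matvec Q v) = v.
Hypothesis QP : forall v, matvec Q (matvec P v) = v.
Hypothesis PA : forall v, matvec P (matvec A v) = diag_map xi (matvec P v).

(** The [j]-th column of [Q] is an eigenvector; this brings the hypothesis on eigenvalues to bear on
    [xi]. *)
Lemma diagonal_eigenvalue j : eigenvalue A (xi j).
Proof.
set (e := fun i => if Fin_eqb i j then C1 else C0).
assert (Ej : e j = C1).
{ unfold e, Fin_eqb; destruct (Fin.eq_dec j j) as [_|ne]; [reflexivity|exfalso; auto]. }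
exists (matvec Q e); split.
- apply Classical_Pred_Type.not_all_not_ex; intros H.
  assert (K : matvec Q e = Cn0 n).
  { apply Cn_ext; intros i; destruct (Cx_eq_dec (matvec Q e i) C0) as [h|h]; [exact h|].
    exfalso; exact (H i h). }
  apply C1_neq_C0; rewrite <- Ej, <- (PQ e), K, matvec_0; reflexivity.
- intros i; rewrite <- (QP (matvec A (matvec Q e))), PA, PQ.
  replace (diag_map xi e) with (Cnscal (xi j) e); [rewrite matvec_scal; reflexivity|].
  apply Cn_ext; intros i'; unfold diag_map, Cnscal, e, Fin_eqb.
  destruct (Fin.eq_dec i' j) as [->|_]; ring.
Qed.

Lemma diagonal_pow k v :
  matvec P (matvec (matpow A k) v) = map_pow (diag_map xi) k (matvec P v).
Proof.
induction k as [|k IH]; [simpl; rewrite matvec_matid; reflexivity|].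
rewrite matvec_matpow_S, PA, IH; reflexivity.
Qed.

Lemma diagonal_period k : (forall j, Cpow (xi j) k = C1) ->
  forall v, matvec (matpow A k) v = v.
Proof.
intros H v; rewrite <- (QP (matvec (matpow A k) v)), diagonal_pow.
rewrite <- (QP v) at 2; f_equal; apply Cn_ext; intros i.
rewrite map_pow_diag, H; ring.
Qed.

End Diagonal.

(* Far from the origin the conjugacy takes a value that it avoids near [0]: an arbitrary (even
   discontinuous) map [x] is then determined near [0] by [h o x]. *)
Lemma conjugacy_extension n (h : Map n) (P Q : Mat n) :
  (forall v, matvec P (matvec Q v) = v) -> (forall v, matvec Q (matvec P v) = v) ->
  holo_near0 h -> h (Cn0 n) = Cn0 n -> eqO 2 h (idmap n) ->
  exists H : Map n, germ_diff H /\ germ_eq H (fun z => matvec P (h z)) /\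
    forall x y : Map n, big_O 1 y -> germ_eq (mcomp H x) (mcomp H y) -> germ_eq x y.
Proof.
intros PQ QP Hh h0 HO.
destruct (tangent_id_inverse n h Hh h0 HO) as (rho & g & Hrho & Inj & g0 & Hg & Hhg & Hgh).
(* [b] has norm [n], whereas [P h] has norm below 1 close to the origin. *)
set (b := (fun _ => C1) : Cn n).
set (H := fun z => if Rlt_dec (nrm z) rho then matvec P (h z) else b).
assert (EH : forall z, nrm z < rho -> H z = matvec P (h z)).
{ intros z Hz; unfold H; destruct (Rlt_dec (nrm z) rho); [reflexivity|contradiction]. }
assert (GH : germ_eq H (fun z => matvec P (h z))).
{ apply germ_eq_nrm; exists rho; split; [exact Hrho|exact EH]. }
assert (HPh : holo_near0 (fun z => matvec P (h z))) by apply holo_matvec_comp, Hh.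
assert (H0 : H (Cn0 n) = Cn0 n) by (rewrite EH, h0, matvec_0; [reflexivity|rewrite nrm_Cn0; lra]).
assert (Og : big_O 1 g) by (apply holo_big_O_1; assumption).
assert (OgQ : big_O 1 (fun z => g (matvec Q z))).
{ apply (big_O_comp 1 g (matvec Q)); [exact Og|apply big_O_linear]. }
exists H; split; [|split; [exact GH|]].
- split; [intros i; rewrite H0; reflexivity|].
  split; [apply holo_germ_ext with (fun z => matvec P (h z)); [apply germ_sym, GH|exact HPh]|].
  exists (fun z => g (matvec Q z)); split; [intros i; rewrite matvec_0, g0; reflexivity|].
  split; [apply holo_comp_matvec, Hg|split].
  + apply germ_trans with (fun z => matvec P (h (g (matvec Q z)))).
    { exact (germ_comp_r _ _ (fun z => g (matvec Q z)) GH OgQ). }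
    apply germ_trans with (fun z => matvec P (matvec Q z)).
    * apply (germ_comp_l (matvec P) (fun z => h (g (matvec Q z))) (matvec Q)).
      exact (germ_comp_r _ _ (matvec Q) Hhg (big_O_linear n Q)).
    * apply germ_eq_nrm; exists 1; split; [lra|]; intros z _; apply PQ.
  + apply germ_trans with (fun z => g (matvec Q (matvec P (h z)))).
    { exact (germ_comp_l (fun z => g (matvec Q z)) _ _ GH). }
    apply germ_trans with (mcomp g h); [|exact Hgh].
    apply germ_eq_nrm; exists 1; split; [lra|]; intros z _; rewrite QP; reflexivity.
- intros x y Oy E; apply germ_eq_nrm; apply germ_eq_nrm in E; destruct E as (r & Hr & E).
  assert (OPh : big_O 1 (fun z => matvec P (h z))).
  { apply holo_big_O_1; [exact HPh|]; rewrite h0; apply matvec_0. }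
  destruct (big_O_small _ OPh) as (D & HD & S1); destruct (S1 1 Rlt_0_1) as (s1 & Hs1 & K1).
  destruct (big_O_small y Oy) as (D2 & HD2 & S2).
  destruct (S2 (Rmin rho s1)) as (s2 & Hs2 & K2); [apply Rmin_pos; assumption|].
  exists (Rmin r s2); split; [apply Rmin_pos; lra|]; intros z Hz.
  pose proof (Rmin_l r s2); pose proof (Rmin_r r s2).
  pose proof (Rmin_l rho s1); pose proof (Rmin_r rho s1).
  destruct (K2 z ltac:(lra)) as [_ Y]; destruct (K1 (y z) ltac:(lra)) as [_ Y1].
  specialize (E z ltac:(lra)); unfold mcomp in E; rewrite (EH (y z)) in E by lra.
  destruct (Rlt_dec (nrm (x z)) rho) as [l|l].
  + rewrite (EH (x z) l) in E; apply Inj; [exact l|lra|].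
    rewrite <- (QP (h (x z))), E; apply QP.
  + exfalso; apply l.
    assert (Eb : b = matvec P (h (y z))).
    { rewrite <- E; unfold H; destruct (Rlt_dec (nrm (x z)) rho); [contradiction|reflexivity]. }
    rewrite <- Eb in Y1; unfold b, nrm in Y1; rewrite Cnorm_C1, Rsum_const, Rmult_1_r in Y1.
    (* Only dimension 0 remains, where every vector has norm [0 < rho]. *)
    assert (n0 : n = 0%nat).
    { destruct n as [|n']; [reflexivity|]; rewrite S_INR in Y1; pose proof (pos_INR n'); lra. }
    clear - n0 Hrho; destruct n as [|n']; [exact Hrho|discriminate].
Qed.

Theorem theorem1p1 (n : nat) (G : Map n -> Prop) (gens : list (Map n))
  (A : Mat n) (p : nat) :
  subgroup G ->
  basic_set G gens ->
  (forall f, In f gens -> linear_part f A) ->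
  prime (Z.of_nat p) ->
  (forall lam, eigenvalue A lam -> exists s : nat, root_of_unity_of_order lam (p ^ s)%nat) ->
  finite_cyclic G /\
  exists (h : Map n) (xi : Fin.t n -> Cx),
    germ_diff h /\
    (forall j, exists r : nat, root_of_unity_of_order (xi j) (p ^ r)%nat) /\
    (forall f, G f <-> exists k : nat, germ_eq (mcomp h f) (mcomp (map_pow (diag_map xi) k) h)).
Proof.
intros HG (Hnil & Hgen & Hprod & Hconj) Hlin Hp Heig.
assert (HGg : forall g, In g gens -> G g).
{ intros g Hg; apply Hgen; intros H _ K; apply K, Hg. }
assert (HD : forall g, G g -> germ_diff g) by (destruct HG as (K & _); exact K).
assert (HA : forall g, In g gens -> eqO 2 g (matvec A)).
{ intros g Hg; apply linear_part_eqO; [apply germ_diff_holo|apply germ_diff_0|]; auto. }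
assert (Hex : exists f, In f gens).
{ destruct gens as [|f l]; [contradiction|exists f; left; reflexivity]. }
destruct Hex as [f Hf]; set (m := length gens).
assert (Hm0 : (0 < m)%nat).
{ unfold m; destruct gens; [contradiction|simpl; lia]. }
assert (Am : forall v, matvec (matpow A m) v = v).
{ intros v; rewrite <- (matvec_matid v) at 2; apply eqO_linear.
  apply eqO_trans with (compose_list gens); [apply eqO_sym, compose_list_eqO, HA|].
  apply (eqO_ext 2 (compose_list gens) _ (idmap n)); [reflexivity| |apply eqO_germ, Hprod].
  intros z; symmetry; apply matvec_matid. }
(* Two periods of [A] occur: [m] makes [A] diagonalizable and serves for the averaging, while [p^e],
   read off from the eigenvalues of the diagonal form, serves for [generators_equal]. *)
destruct (mat_diagonalize Hm0 Am) as (P & Q & xi & PQ & QP & PA).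
assert (Hxi : forall j, exists r : nat, root_of_unity_of_order (xi j) (p ^ r)%nat).
{ intros j; apply Heig, (diagonal_eigenvalue n A P Q); assumption. }
(* The largest exponent works for all coordinates, as the powers of [p] divide one another. *)
destruct (fin_bound n (fun j r => Cpow (xi j) (p ^ r) = C1)) as [e He].
{ intros j r r' Hr H; replace r' with ((r' - r) + r)%nat by lia.
  rewrite Nat.pow_add_r; apply Cpow_mul_1, H. }
{ intros j; destruct (Hxi j) as (r & _ & H & _); exists r; exact H. }
assert (Aq := diagonal_period n A P Q xi QP PA _ He).
assert (Heq := generators_equal n G gens A p e f HG Hgen Hconj Hp Aq HA Hf).
assert (HO := cyclic_pow_O n G gens f HG Hgen Hf).
assert (Hm : germ_eq (map_pow f m) (idmap n)).
{ apply germ_trans with (compose_list gens); [|exact Hprod].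
  apply germ_sym, compose_list_germ; assumption. }
assert (Gel := cyclic_elements n G gens f m HG Hgen Hf Heq Hm0 Hm).
split; [apply (cyclic_finite n G gens f m); assumption|].
assert (Gf := HGg f Hf); assert (HfA := HA f Hf).
set (h := linearizer n f A m).
destruct (conjugacy_extension n h P Q PQ QP) as (H & DH & EH & UH).
- apply (linearizer_holo n G f A m); assumption.
- apply (linearizer_0 n G f A m); assumption.
- apply (linearizer_eqO n G f A m); assumption.
- assert (Conj : forall k, germ_eq (mcomp H (map_pow f k)) (mcomp (map_pow (diag_map xi) k) H)).
  { intros k; apply germ_trans with (fun z => matvec P (h (map_pow f k z))).
    { exact (germ_comp_r _ _ (map_pow f k) EH (HO k)). }
    apply germ_trans with (fun z => matvec P (matvec (matpow A k) (h z))).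
    { apply (germ_comp_l (matvec P) (fun z => h (map_pow f k z))
        (fun z => matvec (matpow A k) (h z))).
      apply (linearizer_conj n G f A m); assumption. }
    apply germ_trans with (fun z => map_pow (diag_map xi) k (matvec P (h z))).
    - apply germ_eq_nrm; exists 1; split; [lra|]; intros z _.
      apply (diagonal_pow n A P xi PA).
    - apply germ_sym; exact (germ_comp_l (map_pow (diag_map xi) k) _ _ EH). }
  exists H, xi; split; [exact DH|split; [exact Hxi|]]; intros x; rewrite Gel.
  split; intros [k Hk]; exists k.
  + apply germ_trans with (mcomp H (map_pow f k)); [apply germ_comp_l, Hk|apply Conj].
  (* An arbitrary map [x] is determined as a germ by [H x], so it agrees with a power of [f]. *)
  + apply UH; [apply HO|].
    apply germ_trans with (mcomp (map_pow (diag_map xi) k) H); [exact Hk|apply germ_sym, Conj].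
Qed.
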